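(* Let $G$ be a connected reductive real Lie group, let $\Omega$ be a symmetric compact neighborhood of the identity in $G$ with associated word metric $d_\Omega$ on $G$, and let $S\subset G$ be a compact subset generating a Zariski-dense subgroup. Then $$\ell(S)=\lambda_\infty(S)=\max_{x\in J(S)}N_\Omega(x).$$
   Context: A connected reductive real Lie group $G$ is the identity component (for the Lie group topology) of the group of real points of a reductive linear algebraic group defined over $\mathbb{R}$. A subgroup of $G$ is Zariski-dense if it is not contained in any proper algebraic subgroup of $G$. Fix a maximal $\mathbb{R}$-split torus $A$ of $G$ (a closed connected subgroup isomorphic to $(\mathbb{R}_+^* )^d$) with Lie algebra $\mathfrak{a}$, a maximal compact subgroup $K$ whose Lie algebra is orthogonal to $\mathfrak{a}$ for the Killing form, so that $G=KAK$, and a system of positive roots of $\mathfrak{a}$ in $\mathrm{Lie}(G)$. The closed Weyl chamber is $\mathfrak{a}^+=\{x\in\mathfrak{a}:\alpha(x)\geq 0 \text{ for every positive root }\alpha\}$, and $W=N_G(A)/Z_G(A)$ is the Weyl group, acting on $\mathfrak{a}$. The Cartan projection $\kappa:G\to\mathfrak{a}^+$ sends $g$ to the unique $\kappa(g)\in\mathfrak{a}^+$ with $g\in K\exp(\kappa(g))K$. For $n\geq1$, $S^n:=\{s_1\cdots s_n : s_i\in S\}$. When $S$ is compact and generates a Zariski-dense subgroup, the joint spectrum $J(S)\subset\mathfrak{a}^+$ is the limit in the Hausdorff metric of $\frac1n\kappa(S^n)$ as $n\to+\infty$ (this limit exists). The word metric of $\Omega$ is $d_\Omega(x,y):=\inf\{n\in\mathbb{N}:x^{-1}y\in\Omega^n\}$.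 By a theorem of Abels and Margulis there is a $W$-invariant norm $N_\Omega:\mathfrak{a}\to\mathbb{R}_+$ (necessarily unique) and a constant $C>0$ such that $|d_\Omega(x,y)-N_\Omega(\kappa(x^{-1}y))|\leq C$ for all $x,y\in G$. The group $G$ acts by left translations, hence by isometries, on $(G,d_\Omega)$, and one sets $$\ell(S):=\lim_{n\to+\infty}\frac1n\max_{g\in S^n}d_\Omega(gx,x)$$ (which does not depend on $x\in G$) and $$\lambda_\infty(S):=\limsup_{n\to+\infty}\frac1n\sup_{g\in S^n}\inf_{x\in G}d_\Omega(gx,x).$$ *)

(* Defs.v *)
From HB Require Import structures.
From mathcomp Require Import all_boot all_order all_algebra.
From mathcomp Require Import all_classical all_reals all_analysis.
From mathcomp Require mpoly.
From mathcomp Require Import complex.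

Set Implicit Arguments.
Unset Strict Implicit.
Unset Printing Implicit Defensive.
Import Order.TTheory GRing.Theory Num.Theory.
Import numFieldNormedType.Exports.

Local Open Scope classical_set_scope.
Local Open Scope ring_scope.

Section Subgroups.
Variables (F : fieldType) (n : nat).
Implicit Types (g h : 'M[F]_n) (H S : set 'M[F]_n).

Definition is_subgroup H : Prop :=
  [/\ H `<=` [set g | g \in unitmx], H 1%:M,
      (forall g h, H g -> H h -> H (g *m h)) &
      (forall g, H g -> H (invmx g))].

Definition generated_subgroup S : set 'M[F]_n :=
  \bigcap_(H in [set H | is_subgroup H /\ S `<=` H]) H.

Definition word_set S (k : nat) : set 'M[F]_n :=
  [set g | exists2 s : 'I_k -> 'M[F]_n,
     (forall i, S (s i)) & g = \prod_(i < k) s i].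

(* A polynomial in the n ^ 2 matrix entries, evaluated at g. *)
Definition poly_at (p : mpoly.mpoly (n * n) F) g : F :=
  mpoly.meval (fun i => mxvec g 0 i) p.

(* Closed subsets of GL_n; equations involving the inverse of the determinant
   define the same sets once denominators are cleared. *)
Definition zariski_closed (X : set 'M[F]_n) : Prop :=
  exists I : set (mpoly.mpoly (n * n) F),
    X = [set g | g \in unitmx /\ forall p, I p -> poly_at p g = 0].

Definition zariski_connected (X : set 'M[F]_n) : Prop :=
  forall Y Z : set 'M[F]_n, zariski_closed Y -> zariski_closed Z ->
    X `<=` Y `|` Z -> X `&` (Y `&` Z) = set0 -> X `<=` Y \/ X `<=` Z.

Definition algebraic_subgroup H : Prop := is_subgroup H /\ zariski_closed H.

Definition unipotent g : Prop := exists k : nat, (g - 1%:M) ^+ k = 0.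

(* Triviality of the unipotent radical, the largest connected normal unipotent
   algebraic subgroup. *)
Definition trivial_unipotent_radical H : Prop :=
  forall U : set 'M[F]_n,
    algebraic_subgroup U -> U `<=` H -> zariski_connected U ->
    (forall g u, H g -> U u -> U (g *m u *m invmx g)) ->
    (forall u, U u -> unipotent u) ->
    U = [set 1%:M].

Definition diagonal_torus : set 'M[F]_n :=
  [set g | g \in unitmx /\ is_diag_mx g].

(* Algebraic subgroups of the group G, which need not itself be algebraic, are
   the traces on G of algebraic subgroups of GL_n. *)
Definition zariski_dense (G H : set 'M[F]_n) : Prop :=
  forall Z, algebraic_subgroup Z -> H `<=` G `&` Z -> G `&` Z = G.

End Subgroups.
Arguments diagonal_torus : clear implicits.

(* Linear algebraic groups over R are represented by their complex points. *)
Section AlgebraicGroupsOverR.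
Variable R : realType.
Local Notation C := (complex R).

Definition complexify (n : nat) (g : 'M[R]_n) : 'M[C]_n :=
  map_mx (real_complex R) g.

Definition complexify_poly (n : nat) (p : mpoly.mpoly (n * n) R) :
    mpoly.mpoly (n * n) C :=
  mpoly.map_mpoly (real_complex R) p.

(* In characteristic zero, being the zero locus of real polynomials is the same
   as having an ideal generated by real polynomials. *)
Definition closed_over_R (n : nat) (X : set 'M[C]_n) : Prop :=
  exists I : set (mpoly.mpoly (n * n) R),
    X = [set g | g \in unitmx /\
                 forall p, I p -> poly_at (complexify_poly p) g = 0].

Definition algebraic_group_over_R (n : nat) (H : set 'M[C]_n) : Prop :=
  is_subgroup H /\ closed_over_R H.

Definition reductive_group_over_R (n : nat) (H : set 'M[C]_n) : Prop :=
  algebraic_group_over_R H /\ trivial_unipotent_radical H.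

Definition regular_over_R (n m : nat) (X : set 'M[C]_n)
    (f : 'M[C]_n -> 'M[C]_m) : Prop :=
  forall i j, exists (p : mpoly.mpoly (n * n) R) (k : nat),
    forall g, X g -> f g i j = poly_at (complexify_poly p) g / (\det g) ^+ k.

Definition isomorphic_over_R (n m : nat) (H : set 'M[C]_n) (L : set 'M[C]_m) :
    Prop :=
  exists (f : 'M[C]_n -> 'M[C]_m) (f' : 'M[C]_m -> 'M[C]_n),
    [/\ regular_over_R H f, regular_over_R L f',
        (forall g, H g -> L (f g) /\ f' (f g) = g),
        (forall l, L l -> H (f' l) /\ f (f' l) = l) &
        (forall g h, H g -> H h -> f (g *m h) = f g *m f h)].

Definition split_algebraic_torus (n : nat) (T : set 'M[C]_n) : Prop :=
  algebraic_group_over_R T /\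
  exists d : nat, isomorphic_over_R T (diagonal_torus C d).

Definition real_points (n : nat) (H : set 'M[C]_n) : set 'M[R]_n :=
  [set g | H (complexify g)].

Definition real_identity_component (n : nat) (H : set 'M[C]_n) : set 'M[R]_n :=
  connected_component (real_points H) 1%:M.

End AlgebraicGroupsOverR.

Section LieGroups.
Variables (R : realType) (n : nat).
Implicit Types (G H A K L : set 'M[R]_n) (X Y : 'M[R]_n).

Definition connected_reductive_lie_group G : Prop :=
  exists2 GC : set 'M[complex R]_n,
    reductive_group_over_R GC & G = real_identity_component GC.

Definition split_torus A : Prop :=
  exists2 T : set 'M[complex R]_n,
    split_algebraic_torus T & A = real_identity_component T.

Definition maximal_split_torus G A : Prop :=
  [/\ split_torus A, A `<=` G &
      forall B, split_torus B -> B `<=` G -> A `<=` B -> B = A].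

Definition maximal_compact_subgroup G K : Prop :=
  [/\ is_subgroup K, compact K, K `<=` G &
      forall L, is_subgroup L -> compact L -> L `<=` G -> K `<=` L -> L = K].

Definition mexp X : 'M[R]_n :=
  lim (series (fun k : nat => (k`!%:R)^-1 *: X ^+ k) @ \oo).

Definition lie_algebra H : set 'M[R]_n :=
  [set X | forall t : R, H (mexp (t *: X))].

(* The Lie algebra of a closed subgroup of GL_n(R) is a linear subspace; the
   default value 0 is never used for such H. *)
Definition lie_space H : {vspace 'M[R]_n} :=
  xget 0%VS [set V : {vspace 'M[R]_n} | forall X, X \in V <-> lie_algebra H X].

Definition lie_bracket X Y : 'M[R]_n := X *m Y - Y *m X.

(* The trace of ad X \o ad Y on the Lie algebra of G. *)
Definition killing_form G X Y : R :=
  let b := vbasis (lie_space G) in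
  \sum_(i < \dim (lie_space G))
     coord b i (lie_bracket X (lie_bracket Y b`_i)).

Definition killing_orthogonal G K A : Prop :=
  forall X Y, lie_algebra K X -> lie_algebra A Y -> killing_form G X Y = 0.

End LieGroups.

Notation lie A := (subvs_of (lie_space A)).
Notation lie_dual A := 'Hom(lie A, GRing.regular _).

Section CartanProjection.
Variables (R : realType) (n : nat).
Implicit Types (G A K Om S : set 'M[R]_n).

Definition restricted_root G A (alpha : lie_dual A) : Prop :=
  alpha != 0 /\
  exists X : 'M[R]_n, [/\ X != 0, lie_algebra G X &
    forall H : lie A, lie_bracket (vsval H) X = (alpha H : R) *: X].

Definition positive_root_system G A (P : set (lie_dual A)) : Prop :=
  [/\ forall alpha, P alpha -> restricted_root G alpha,
      forall alpha, restricted_root G alpha -> P alpha \/ P (- alpha),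
      forall alpha, ~ (P alpha /\ P (- alpha)) &
      forall alpha beta, P alpha -> P beta ->
        restricted_root G (alpha + beta) -> P (alpha + beta)].

Definition closed_weyl_chamber A (P : set (lie_dual A)) : set (lie A) :=
  [set x | forall alpha, P alpha -> 0 <= (alpha x : R)].

(* For g in G there is exactly one such x, by the Cartan decomposition. *)
Definition cartan_projection A K (P : set (lie_dual A)) (g : 'M[R]_n) : lie A :=
  xget 0 [set x | closed_weyl_chamber P x /\
    exists k1 k2, [/\ K k1, K k2 & g = k1 *m mexp (vsval x) *m k2]].

Definition normalizer G A : set 'M[R]_n :=
  [set w | G w /\ [set w *m a *m invmx w | a in A] = A].

Definition is_norm A (N : lie A -> R) : Prop :=
  [/\ forall x, 0 <= N x, forall x, N x = 0 -> x = 0,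
      forall (c : R) x, N (c *: x) = `|c| * N x &
      forall x y, N (x + y) <= N x + N y].

Definition weyl_invariant G A (N : lie A -> R) : Prop :=
  forall (w : 'M[R]_n) (x y : lie A), normalizer G A w ->
    vsval y = w *m vsval x *m invmx w -> N y = N x.

Definition symmetric_compact_nbhs_of_1 G Om : Prop :=
  [/\ Om `<=` G, compact Om, within G (nbhs (1%:M : 'M[R]_n)) Om &
      forall g, Om g -> Om (invmx g)].

(* The infimum includes k = 0, with word_set Om 0 = {1}. *)
Definition word_dist Om (x y : 'M[R]_n) : \bar R :=
  ereal_inf [set (k%:R)%:E | k in [set k | word_set Om k (invmx x *m y)]].

Definition abels_margulis_norm G A K (P : set (lie_dual A)) Om
    (N : lie A -> R) : Prop :=
  [/\ is_norm N, weyl_invariant G N &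
      exists2 C : R, 0 < C & forall x y, G x -> G y ->
        (`|word_dist Om x y - (N (cartan_projection K P (invmx x *m y)))%:E|
           <= C%:E)%E].

Definition hausdorff_dist (M : pseudoMetricType R) (X Y : set M) : \bar R :=
  Order.max (ereal_sup [set edist_inf Y x | x in X])
            (ereal_sup [set edist_inf X y | y in Y]).

Definition is_joint_spectrum A K (P : set (lie_dual A)) S (J : set (lie A)) :
    Prop :=
  [/\ J !=set0, compact (vsval @` J) &
      hausdorff_dist
        (vsval @` [set k%:R^-1 *: cartan_projection K P g | g in word_set S k])
        (vsval @` J) @[k --> \oo] --> 0%E].

(* The sequence whose limit is the drift of S; the values of word_dist are
   integers, so that on a compact S^k this supremum is a maximum. *)
Definition drift_seq Om S (x : 'M[R]_n) (k : nat) : \bar R :=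
  ((k%:R^-1)%:E * ereal_sup [set word_dist Om (g *m x) x | g in word_set S k])%E.

Definition lambda_infty G Om S : \bar R :=
  limn_esup (fun k : nat => ((k%:R^-1)%:E *
    ereal_sup [set ereal_inf [set word_dist Om (g *m x) x | x in G]
              | g in word_set S k])%E).

Definition is_max_on (T : Type) (J : set T) (N : T -> R) (m : R) : Prop :=
  (exists2 x, J x & N x = m) /\ forall x, J x -> N x <= m.

End CartanProjection.

(* Main.v *)
Require Import Defs.
From HB Require Import structures.
From mathcomp Require Import all_boot all_order all_algebra.
From mathcomp Require Import all_classical all_reals all_analysis.
From mathcomp Require Import lra ring.
From mathcomp Require Import perm fingroup.
From mathcomp Require mpoly.
From mathcomp Require Import complex.
Set Implicit Arguments.
Unset Strict Implicit.
Unset Printing Implicit Defensive.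
Import Order.TTheory GRing.Theory Num.Theory.
Import numFieldNormedType.Exports.
Local Open Scope classical_set_scope.
Local Open Scope ring_scope.

(** Up to a bounded error the word distance from 1 to g is N (kappa g), and N is
    Lipschitz, so the convergence of kappa (S^k) / k to J gives the drift: it is
    the maximum m of N on J (drift_cvg).  Taking the displacement at 1 shows that
    lambda_infty is at most m.  The content of the theorem is the reverse
    inequality: some long words displace every point by about m times their
    length.

    For an isometry h, the displacement of any point x is at least the limit of
    d (h^r, 1) / r, so it is bounded below by the growth of N (kappa (h^r)) / r
    (displacement_lower).  Let x0 in J maximise N.  It is enough to find words h
    of length k + O(1) such that kappa (h^r) / (r k) is close to x0 for every r.
    Start from g in S^k with kappa g / k close to x0, and put h = g f for a suitable
    f in a finite set of words that depends on x0 only (stable_power, stable_words).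

    The Cartan projections of powers are controlled by linear representations of
    G, built as follows.  The torus A is diagonalisable over the reals
    (split_torus_codiag), which gives weights chi i on the Lie algebra of A.
    For z in the Weyl chamber, call layer of z a set of indices i such that chi i z
    is above some threshold, and let theta be the sum of the weights of a
    layer, or of several layers.  A tensor product of exterior powers contains a
    decomposable vector of weight theta, and the G-module that it generates has
    all its weights bounded by theta on the chamber, and a line as its weight
    space for theta (flag_module).  This module is the span of the words in the
    root vectors that are positive at z, applied to that vector: the span is
    stable under the Lie algebra of G because this algebra is spanned by root
    vectors (root_decomposition), and it is then stable under G because a closed
    connected group is determined by its Lie algebra (closed_subgroup_open).

    Writing beta for the action of G on the module, the norm of beta g is
    comparable to exp (theta (kappa g)).  By Zariski density, the operators that
    extract the top coefficient from beta g are bounded combinations of the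
    beta f for finitely many words f; so some f makes the trace of beta (g f) as
    large as the norm of beta g (flag_rep).  A matrix has its trace bounded by
    the r-th root of the norm of its r-th power, up to a factor (trace_power), hence
    theta (kappa (h^r)) is at least r (theta (kappa g) - L), and submultiplicativity
    of the norm gives the opposite inequality.  These estimates hold for the layers
    of x0 and of kappa (h^r), and summation by parts turns them into a bound on
    all coordinates (layer_cake, layers_close).

    All this uses the Cartan decomposition g = k1 exp (kappa g) k2 with bounded k1 and
    k2 in G only.  When g has no such decomposition with k1 and k2 in K, its Cartan
    projection is 0 by convention, so the comparison with the word metric bounds g
    itself (cartan_projection_kak). *)

(** * Norms of matrices and the exponential *)

HB.instance Definition _ (R : realType) m n := Complete.on 'M[R]_(m, n).

Section MatrixNorms.
Variable R : realType.

Lemma mx_norm_leP m n (A : 'M[R]_(m, n)) (c : R) : 0 <= c ->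
  (`|A| <= c) <-> (forall i j, `|A i j| <= c).
Proof.
move=> c0; rewrite {1}/Num.norm /= mx_normrE; split.
  by move/bigmax_leP => [_ H] i j; exact: (H (i, j)).
by move=> H; apply/bigmax_leP; split => // -[i j] _; exact: H.
Qed.

Lemma entry_le_norm m n (A : 'M[R]_(m, n)) i j : `|A i j| <= `|A|.
Proof. exact: (mx_norm_leP A (normr_ge0 _)).1. Qed.

Lemma sum_le_card n (F : 'I_n -> R) c :
  (forall j, F j <= c) -> \sum_j F j <= n%:R * c.
Proof.
move=> H; apply: le_trans (ler_sum _ (fun j _ => H j)) _.
by rewrite sumr_const card_ord mulr_natl.
Qed.

Lemma mx_norm_mul m n p (A : 'M[R]_(m, n)) (B : 'M[R]_(n, p)) :
  `|A *m B| <= n%:R * `|A| * `|B|.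
Proof.
apply/mx_norm_leP => [|i j]; first by rewrite !mulr_ge0.
rewrite mxE (le_trans (ler_norm_sum _ _ _)) //.
rewrite -mulrA; apply: sum_le_card => k.
by rewrite normrM ler_pM // entry_le_norm.
Qed.

(** A bound for the operator norm attached to the maximum norm; contrary to the
    entrywise norm it is submultiplicative, without dimensional factors. *)
Definition rowle m n (A : 'M[R]_(m, n)) (c : R) : Prop :=
  forall i, \sum_j `|A i j| <= c.

Lemma rowle_le m n (A : 'M[R]_(m, n)) c c' : rowle A c -> c <= c' -> rowle A c'.
Proof. by move=> H cc i; exact: le_trans (H i) cc. Qed.

Lemma rowle0 m n c : 0 <= c -> rowle (0 : 'M[R]_(m, n)) c.
Proof. by move=> c0 i; rewrite big1 // => j _; rewrite mxE normr0. Qed.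

Lemma rowle1 n : rowle (1 : 'M[R]_n) 1.
Proof.
move=> i; rewrite (bigD1 i) //= mxE eqxx normr1 big1 ?addr0 // => j ji.
by rewrite mxE eq_sym (negPf ji) normr0.
Qed.

Lemma rowleD m n (A B : 'M[R]_(m, n)) a b :
  rowle A a -> rowle B b -> rowle (A + B) (a + b).
Proof.
move=> HA HB i; rewrite (le_trans _ (lerD (HA i) (HB i))) //.
by rewrite -big_split ler_sum //= => j _; rewrite mxE ler_normD.
Qed.

Lemma rowleZ m n (A : 'M[R]_(m, n)) a c : rowle A a -> rowle (c *: A) (`|c| * a).
Proof.
move=> HA i; under eq_bigr do rewrite mxE normrM.
by rewrite -mulr_sumr ler_wpM2l.
Qed.

Lemma rowleN m n (A : 'M[R]_(m, n)) a : rowle A a -> rowle (- A) a.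
Proof. by move=> HA i; under eq_bigr do rewrite mxE normrN; exact: HA. Qed.

Lemma rowleM m n p (A : 'M[R]_(m, n)) (B : 'M[R]_(n, p)) a b :
  0 <= b -> rowle A a -> rowle B b -> rowle (A *m B) (a * b).
Proof.
move=> b0 HA HB i.
apply: (@le_trans _ _ (\sum_k `|A i k| * \sum_j `|B k j|)).
  under [leRHS]eq_bigr do rewrite mulr_sumr.
  rewrite [leRHS]exchange_big ler_sum //= => j _.
  rewrite mxE (le_trans (ler_norm_sum _ _ _)) // ler_sum // => k _.
  by rewrite normrM.
apply: (@le_trans _ _ (\sum_k `|A i k| * b)).
  by rewrite ler_sum // => k _; rewrite ler_wpM2l.
by rewrite -mulr_suml ler_wpM2r.
Qed.

Lemma rowleX n (A : 'M[R]_n) a k : 0 <= a -> rowle A a -> rowle (A ^+ k) (a ^+ k).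
Proof.
move=> a0 HA; elim: k => [|k IH]; first exact: rowle1.
by rewrite !exprS; apply: rowleM => //; exact: exprn_ge0.
Qed.

Lemma rowle_sum m n (I : Type) (r : seq I) (F : I -> 'M[R]_(m, n)) f :
  (forall i, rowle (F i) (f i)) -> rowle (\sum_(i <- r) F i) (\sum_(i <- r) f i).
Proof.
move=> H; elim: r => [|x r IH]; first by rewrite !big_nil; exact: rowle0.
by rewrite !big_cons; exact: rowleD.
Qed.

Lemma rowle_norm m n (A : 'M[R]_(m, n)) : rowle A (n%:R * `|A|).
Proof.
by move=> i; apply: sum_le_card => j; exact: entry_le_norm.
Qed.

Lemma norm_rowle m n (A : 'M[R]_(m, n)) a : 0 <= a -> rowle A a -> `|A| <= a.
Proof.
move=> a0 HA; apply/mx_norm_leP => // i j; apply: le_trans (HA i).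
by rewrite (bigD1 j) //= lerDl sumr_ge0.
Qed.

(** Telescoping A^k - B^k. *)
Lemma rowle_powB n (A B : 'M[R]_n) a e k : 1 <= a -> 0 <= e ->
  rowle A a -> rowle B a -> rowle (A - B) e ->
  rowle (A ^+ k - B ^+ k) (k%:R * e * a ^+ k).
Proof.
move=> a1 e0 HA HB HAB; have a0 : 0 <= a by exact: le_trans a1.
elim: k => [|k IH]; first by rewrite !expr0 subrr !mul0r; exact: rowle0.
have -> : A ^+ k.+1 - B ^+ k.+1 = A ^+ k *m (A - B) + (A ^+ k - B ^+ k) *m B.
  rewrite mulmxBr mulmxBl -[A ^+ k *m A]/(A ^+ k * A) -[B ^+ k *m B]/(B ^+ k * B).
  by rewrite -!exprSr addrA subrK.
have ak := exprn_ge0 k a0.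
apply: rowle_le (rowleD (rowleM e0 (rowleX k a0 HA) HAB) (rowleM a0 IH HB)) _.
rewrite -natr1 exprSr -mulrA [e * _]mulrC.
have : a ^+ k * e <= a ^+ k * e * a by rewrite ler_peMr // mulr_ge0.
lra.
Qed.

End MatrixNorms.

Section Exponential.
Variable R : realType.

(** With u = z / k, the inequality (1 - u) exp u <= 1 gives
    (1 - u^2)^k exp z <= (1 + u)^k, and Bernoulli bounds (1 - u^2)^k below. *)
Lemma expR_powB (z : R) k : 0 <= z -> (0 < k)%N ->
  expR z - (1 + z / k%:R) ^+ k <= z ^+ 2 / k%:R * expR z.
Proof.
move=> z0 k0; have k0' : 0 < k%:R :> R by rewrite ltr0n.
set u := z / k%:R; have u0 : 0 <= u by rewrite divr_ge0 // ltW.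
have zu : z = k%:R * u by rewrite /u mulrCA divff ?mulr1 // gt_eqF.
have -> : z ^+ 2 / k%:R = k%:R * u ^+ 2.
  by rewrite zu; field; rewrite gt_eqF.
have e0 := expR_gt0 z.
suff : (1 - k%:R * u ^+ 2) * expR z <= (1 + u) ^+ k by lra.
case: (lerP u 1) => u1; last first.
  apply: (@le_trans _ _ 0); last by rewrite exprn_ge0 //; lra.
  rewrite pmulr_lle0 // subr_le0 expr2.
  have : 1 <= k%:R :> R by rewrite ler1n.
  nra.
have bern j : 1 - j%:R * u ^+ 2 <= (1 - u ^+ 2) ^+ j.
  elim: j => [|j IH]; first by rewrite expr0; lra.
  have u21 : u ^+ 2 <= 1 by rewrite expr_le1.
  have u22 : 0 <= 1 - u ^+ 2 by rewrite subr_ge0.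
  rewrite [leRHS]exprSr; apply: le_trans (ler_wpM2r u22 IH).
  rewrite -natr1; have : 0 <= (j%:R : R) by [].
  have := sqr_ge0 (u ^+ 2); nra.
apply: (le_trans (ler_wpM2r (ltW e0) (bern k))).
rewrite zu expRM_natl -exprMn lerXn2r ?nnegrE //.
- by rewrite mulr_ge0 ?expR_ge0 // subr_ge0 expr_le1.
- lra.
have := expR_ge1Dx (- u); rewrite expRN => H.
have eu := expR_gt0 u.
have : (1 - u) * expR u <= 1.
  by rewrite -[leRHS](mulVf (lt0r_neq0 eu)) ler_wpM2r // ltW.
by rewrite expr2; nra.
Qed.

Lemma pow1D_le_expR (z : R) k : 0 <= z -> (1 + z) ^+ k <= expR (k%:R * z).
Proof.
by move=> z0; rewrite expRM_natl lerXn2r ?nnegrE ?expR_ge0 ?addr_ge0 // expR_ge1Dx.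
Qed.

Lemma mexp_series_cvg n (Z : 'M[R]_n) :
  cvgn (series (fun k : nat => (k`!%:R)^-1 *: Z ^+ k)).
Proof.
apply: normed_cvg.
pose z : R := n%:R * `|Z|.
apply: (@series_le_cvg _ _ (exp_coeff z)) => //.
- by move=> k /=.
- by move=> k; apply: exp_coeff_ge0; rewrite mulr_ge0.
- move=> k /=; have z0 : 0 <= z by rewrite mulr_ge0.
  apply: norm_rowle; first exact: exp_coeff_ge0.
  apply: rowle_le (rowleZ _ (rowleX k z0 (rowle_norm Z))) _.
  by rewrite ger0_norm ?invr_ge0 // mulrC.
- exact: is_cvg_series_exp_coeff.
Qed.

Lemma mexp_partial n (Z : 'M[R]_n) (e : R) : 0 < e ->
  exists N, forall m, (N <= m)%N ->
  `|mexp Z - \sum_(0 <= k < m) (k`!%:R)^-1 *: Z ^+ k| < e.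
Proof.
move=> e0; have /cvgrPdist_lt/(_ _ e0) [N _ H] := @mexp_series_cvg _ Z.
by exists N => m Nm; exact: H.
Qed.

Lemma rowle_closed m n (A : 'M[R]_(m, n)) c :
  (forall e, 0 < e -> exists B, rowle B c /\ `|A - B| < e) -> rowle A c.
Proof.
move=> H i; apply/ler_addgt0Pl => e e0.
have n1 : 0 < n%:R + 1 :> R by rewrite ltr_wpDl.
have [|B [HB AB]] := H (e / (n%:R + 1)); first by rewrite divr_gt0.
rewrite -(subrK B A) addrC; apply: (rowle_le (rowleD HB (rowle_norm _))).
rewrite addrC lerD2r; apply: (@le_trans _ _ (n%:R * (e / (n%:R + 1)))).
  by rewrite ler_wpM2l // ltW.
rewrite mulrCA ger_pMr // ler_pdivrMr // mul1r; lra.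
Qed.

Lemma expmxZ n (c : R) (Z : 'M[R]_n) k : (c *: Z) ^+ k = c ^+ k *: Z ^+ k.
Proof.
elim: k => [|k IH]; first by rewrite !expr0 scale1r.
rewrite !exprS IH -[LHS]/((c *: Z) *m (c ^+ k *: Z ^+ k)).
by rewrite -scalemxAl -scalemxAr scalerA.
Qed.

(** The coefficients of (1 + Z / k)^k are dominated by those of the exponential
    series, so the scalar error bound applies coefficientwise. *)
Lemma mexp_pow1D n (Z : 'M[R]_n) k (z : R) : (0 < k)%N -> 0 <= z -> rowle Z z ->
  rowle ((1 + k%:R^-1 *: Z) ^+ k - mexp Z) (z ^+ 2 / k%:R * expR z).
Proof.
move=> k0 z0 HZ; apply: rowle_closed => e e0.
have [N HN] := mexp_partial Z e0.
pose m := maxn N k.+1.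
exists ((1 + k%:R^-1 *: Z) ^+ k - \sum_(0 <= i < m) (i`!%:R)^-1 *: Z ^+ i).
split; last first.
  by rewrite opprB addrC addrA subrK -normrN opprB HN // leq_maxl.
have -> : (1 + k%:R^-1 *: Z) ^+ k =
    \sum_(0 <= i < m) ('C(k, i)%:R / k%:R ^+ i) *: Z ^+ i.
  rewrite addrC exprD1n -(big_mkord xpredT (fun i => (k%:R^-1 *: Z) ^+ i *+ 'C(k, i))).
  rewrite [RHS](@big_cat_nat _ _ _ k.+1) ?leq_maxr //=.
  rewrite [X in _ + X]big_nat_cond [X in _ + X]big1 ?addr0.
    by apply: eq_bigr => i _; rewrite expmxZ -scaler_nat scalerA exprVn.
  by move=> i /andP[/andP[ki _] _]; rewrite bin_small // mul0r scale0r.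
rewrite -sumrB.
apply: (@rowle_le _ _ _ _ (\sum_(0 <= i < m)
    ((i`!%:R)^-1 - 'C(k, i)%:R / k%:R ^+ i) * z ^+ i)).
  apply: rowle_sum => i; rewrite -scalerBl.
  apply: rowle_le (rowleZ _ (rowleX i z0 HZ)) _.
  rewrite distrC ger0_norm // subr_ge0 ler_pdivrMr ?exprn_gt0 ?ltr0n //.
  rewrite ler_pdivlMl ?ltr0n ?fact_gt0 // -natrM mulnC bin_ffact -natrX ler_nat.
  rewrite ffact_prod -[in leqRHS](card_ord i) -prod_nat_const.
  by apply: leq_prod => j _; exact: leq_subr.
under eq_bigr do rewrite mulrBl.
rewrite sumrB; apply: le_trans (expR_powB z0 k0).
apply: lerB.
  apply: (@le_trans _ _ (series (exp_coeff z) m)).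
    by rewrite /series /= ler_sum // => i _; rewrite mulrC.
  apply: nondecreasing_cvgn_le; last exact: is_cvg_series_exp_coeff.
  by apply: nondecreasing_series => i _ _; exact: exp_coeff_ge0.
rewrite addrC exprD1n -(big_mkord xpredT (fun i => (z / k%:R) ^+ i *+ 'C(k, i))).
rewrite [leRHS](@big_cat_nat _ _ _ k.+1) ?leq_maxr //= -[leLHS]addr0.
apply: lerD; last by apply: sumr_ge0 => i _; rewrite mulr_ge0 ?exprn_ge0 // divr_ge0 ?exprn_ge0.
by apply: ler_sum => i _; rewrite expr_div_n -mulr_natl mulrA mulrAC.
Qed.

Lemma mexp_approx n (v Z : 'M[R]_n) k (z d : R) : (0 < k)%N -> 0 <= z -> 0 <= d ->
  rowle Z z -> rowle (k%:R *: v) z -> rowle (k%:R *: v - Z) d ->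
  rowle ((1 + v) ^+ k - mexp Z) ((d + z ^+ 2 / k%:R) * expR z).
Proof.
move=> k0 z0 d0 HZ Hv Hd.
have k0' : 0 < k%:R :> R by rewrite ltr0n.
have kn : k%:R != 0 :> R by rewrite gt_eqF.
pose a := 1 + z / k%:R.
have zk0 : 0 <= z / k%:R by rewrite divr_ge0 // ltW.
have HA : rowle (1 + v) a.
  rewrite /a; apply: rowleD; first exact: rowle1.
  rewrite -[v](scalerK kn).
  by apply: rowle_le (rowleZ _ Hv) _; rewrite ger0_norm ?invr_ge0 // mulrC.
have HB : rowle (1 + k%:R^-1 *: Z) a.
  rewrite /a; apply: rowleD; first exact: rowle1.
  by apply: rowle_le (rowleZ _ HZ) _; rewrite ger0_norm ?invr_ge0 // mulrC.
have HAB : rowle ((1 + v) - (1 + k%:R^-1 *: Z)) (d / k%:R).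
  rewrite opprD addrACA subrr add0r -[v](scalerK kn) -scalerBr.
  by apply: rowle_le (rowleZ _ Hd) _; rewrite ger0_norm ?invr_ge0 // mulrC.
have a1 : 1 <= a by rewrite lerDl.
have dk0 : 0 <= d / k%:R by rewrite divr_ge0 // ltW.
rewrite -(subrK ((1 + k%:R^-1 *: Z) ^+ k) ((1 + v) ^+ k)) -addrA mulrDl.
apply: rowleD (mexp_pow1D k0 z0 HZ).
apply: rowle_le (rowle_powB k a1 dk0 HA HB HAB) _.
rewrite mulrCA divff // mulr1 ler_wpM2l //.
by apply: le_trans (pow1D_le_expR _ zk0) _; rewrite mulrCA divff ?mulr1.
Qed.

Lemma mexp_rem n (Z : 'M[R]_n) (z : R) : 0 <= z -> rowle Z z ->
  rowle (1 + Z - mexp Z) (z ^+ 2 * expR z).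
Proof.
move=> z0 HZ; have := @mexp_approx n Z Z 1 z 0 isT z0 (lexx _) HZ.
rewrite scale1r expr1 subrr add0r invr1 mulr1; apply => //; exact: rowle0.
Qed.

Lemma archi_le (x e : R) : 0 < e -> exists k, (0 < k)%N /\ x / k%:R <= e.
Proof.
move=> e0; exists (Num.bound (x / e)).+1; split => //.
rewrite ler_pdivrMr ?ltr0n // mulrC -ler_pdivrMr //.
apply: (le_trans (ler_norm _)); apply: (le_trans (ltW (archi_boundP (normr_ge0 _)))).
rewrite /Num.bound normr_id -natr1; lra.
Qed.

(** Any approximation (1 + v) ^ k with k v close to Z and k large computes
    the exponential; the algebraic properties of mexp all come from here. *)
Lemma mexp_limit n (Z W : 'M[R]_n) (z : R) : 0 <= z -> rowle Z z ->
  (forall e, 0 < e -> exists k v, [/\ (0 < k)%N, z ^+ 2 / k%:R <= e,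
     rowle (k%:R *: v) z, rowle (k%:R *: v - Z) e & `|(1 + v) ^+ k - W| <= e]) ->
  mexp Z = W.
Proof.
move=> z0 HZ H; apply/eqP; rewrite -subr_eq0 -normr_le0.
apply/ler_addgt0Pl => e e0; rewrite addr0.
have E := expR_gt0 z.
have c0 : 0 < 2 * expR z + 1 by lra.
have [|k [v [k0 zk kv kvZ]]] := H (e / (2 * expR z + 1)); first by rewrite divr_gt0.
set d := e / _ => W1; have d0 : 0 <= d by rewrite divr_ge0 // ltW.
have zk0 : 0 <= z ^+ 2 / k%:R by rewrite divr_ge0 ?exprn_ge0.
have := mexp_approx k0 z0 d0 HZ kv kvZ.
move/norm_rowle; rewrite mulr_ge0 ?addr_ge0 ?expR_ge0 // => /(_ isT) W2.
rewrite -(subrK ((1 + v) ^+ k) (mexp Z)) -addrA.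
apply: (le_trans (ler_normD _ _)); rewrite distrC.
apply: (le_trans (lerD W2 W1)).
have -> : e = d * (2 * expR z + 1) by rewrite /d mulfVK // gt_eqF.
have : z ^+ 2 / k%:R * expR z <= d * expR z by rewrite ler_wpM2r // ltW.
lra.
Qed.

Lemma rowle_lim m n (A : 'M[R]_(m, n)) (c : R) :
  (forall e, 0 < e -> rowle A (c + e)) -> rowle A c.
Proof. by move=> H i; apply/ler_addgt0Pr => e /H; apply. Qed.

Lemma mexp_lip n (Z W : 'M[R]_n) (z d : R) : 0 <= z -> 0 <= d ->
  rowle Z z -> rowle W z ->
  rowle (W - Z) d -> rowle (mexp W - mexp Z) (d * expR z).
Proof.
move=> z0 d0 HZ HW HWZ; apply: rowle_lim => e e0.
have E := expR_gt0 z; have E2 : 0 < 2 * expR z by rewrite mulr_gt0.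
have [|k [k0 kz]] := @archi_le (z ^+ 2) (e / (2 * expR z)).
  by rewrite divr_gt0.
have kn : k%:R != 0 :> R by rewrite pnatr_eq0 -lt0n.
have A1 := mexp_pow1D k0 z0 HW.
have A2 := @mexp_approx n (k%:R^-1 *: W) Z k z d k0 z0 d0 HZ.
rewrite scalerA divff // scale1r in A2; have {}A2 := A2 HW HWZ.
have -> : mexp W - mexp Z = - ((1 + k%:R^-1 *: W) ^+ k - mexp W) +
    ((1 + k%:R^-1 *: W) ^+ k - mexp Z) by rewrite opprB addrA subrK.
apply: rowle_le (rowleD (rowleN A1) A2) _.
move: kz; rewrite ler_pdivlMr // mulrDl; lra.
Qed.

Lemma mexp_bound n (Z : 'M[R]_n) (z : R) : 0 <= z -> rowle Z z ->
  rowle (mexp Z) (1 + z + z ^+ 2 * expR z).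
Proof.
move=> z0 HZ; rewrite -[mexp Z](subrK (1 + Z)) addrC -opprB.
apply: rowleD; last exact: (rowleN (mexp_rem z0 HZ)).
by apply: rowleD HZ; exact: rowle1.
Qed.

(** exp Z exp (- Z) is compared with (1 - (Z / k)^2)^k, which tends to 1. *)
Lemma mexpN n (Z : 'M[R]_n) : mexp Z *m mexp (- Z) = 1.
Proof.
pose z : R := n%:R * `|Z|; have z0 : 0 <= z by rewrite mulr_ge0.
have HZ : rowle Z z := rowle_norm Z.
have HN : rowle (- Z) z := rowleN HZ.
have E0 := expR_gt0 z.
apply/eqP; rewrite -subr_eq0 -normr_le0; apply/ler_addgt0Pl => e e0; rewrite addr0.
(* c / k bounds the error on each factor; k is chosen to beat the total error *)
pose c := z ^+ 2 * expR z.
have c0 : 0 <= c by rewrite mulr_ge0 ?exprn_ge0 ?expR_ge0.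
pose b := 1 + z + c.
have b0 : 0 <= b by rewrite !addr_ge0.
have [k [k0 kb]] := @archi_le (c * b + expR z * c + z ^+ 2 * expR (z ^+ 2)) e e0.
have kn : k%:R != 0 :> R by rewrite pnatr_eq0 -lt0n.
have k0' : 0 < k%:R :> R by rewrite ltr0n.
pose P := (1 + k%:R^-1 *: Z) ^+ k; pose Q := (1 + k%:R^-1 *: - Z) ^+ k.
have cz : z ^+ 2 / k%:R * expR z = c / k%:R by rewrite mulrAC.
have A1 : rowle (P - mexp Z) (c / k%:R) by rewrite -cz; exact: mexp_pow1D.
have A2 : rowle (Q - mexp (- Z)) (c / k%:R) by rewrite -cz; exact: mexp_pow1D.
have B2 : rowle (mexp (- Z)) b by exact: mexp_bound.
have B1 : rowle P (expR z).
  have zk0 : 0 <= z / k%:R by rewrite divr_ge0 // ltW.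
  have := pow1D_le_expR k zk0; rewrite mulrCA divff // mulr1.
  apply: rowle_le; apply: rowleX; first by rewrite addr_ge0.
  apply: rowleD; first exact: rowle1.
  by apply: rowle_le (rowleZ _ HZ) _; rewrite ger0_norm ?invr_ge0 // mulrC.
have PQ : rowle (P *m Q - 1) (z ^+ 2 * expR (z ^+ 2) / k%:R).
  have -> : P *m Q = (1 - (k%:R^-1 *: Z) ^+ 2) ^+ k.
    rewrite -[P *m Q]/(P * Q) /P /Q -exprMn_comm.
      by congr (_ ^+ k); rewrite scalerN mulrDl mul1r mulrBr mulr1 addrA subrK expr2.
    rewrite scalerN; apply: commrB; first exact: commr1.
    by apply/commr_sym; apply: commrD; [exact: commr1|].
  set w := (k%:R^-1 *: Z) ^+ 2; pose u := z / k%:R.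
  have u0 : 0 <= u by rewrite divr_ge0.
  have Hw : rowle w (u ^+ 2).
    apply: rowleX => //.
    by apply: rowle_le (rowleZ _ HZ) _; rewrite ger0_norm ?invr_ge0 // mulrC.
  have u20 : 0 <= u ^+ 2 by rewrite exprn_ge0.
  have a1 : 1 <= 1 + u ^+ 2 by rewrite lerDl.
  have W1 : rowle (1 - w) (1 + u ^+ 2).
    by apply: rowleD; [exact: rowle1|exact: rowleN].
  have W2 : rowle (1 : 'M[R]_n) (1 + u ^+ 2) by apply: rowle_le a1; exact: rowle1.
  have W3 : rowle (1 - w - 1) (u ^+ 2).
    by rewrite addrC addrA addNr add0r; exact: rowleN.
  have := rowle_powB k a1 u20 W1 W2 W3; rewrite expr1n => W4; apply: rowle_le W4 _.
  have kuz : k%:R * u ^+ 2 = z ^+ 2 / k%:R.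
    by rewrite /u; field.
  rewrite kuz mulrAC ler_wpM2r ?invr_ge0 // ler_wpM2l ?exprn_ge0 //.
  apply: le_trans (pow1D_le_expR k u20) _.
  by rewrite ler_expR kuz ler_piMr ?exprn_ge0 // invf_le1 // ler1n.
have ck : 0 <= c / k%:R by rewrite divr_ge0 // ltW.
have -> : mexp Z *m mexp (- Z) - 1 = - ((P - mexp Z) *m mexp (- Z))
   - P *m (Q - mexp (- Z)) + (P *m Q - 1).
  by rewrite mulmxBl mulmxBr !opprB !addrA !subrK.
apply: (le_trans (norm_rowle _ (rowleD (rowleD (rowleN (rowleM b0 A1 B2))
   (rowleN (rowleM ck B1 A2))) PQ))).
  have zz : 0 <= z ^+ 2 * expR (z ^+ 2) / k%:R.
    by rewrite mulr_ge0 ?invr_ge0 // mulr_ge0 ?expR_ge0 ?exprn_ge0.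
  have cb : 0 <= c / k%:R * b by rewrite mulr_ge0.
  by rewrite !addr_ge0 // mulr_ge0 // ltW.
apply: le_trans kb; rewrite le_eqVlt; apply/orP; left; apply/eqP; ring.
Qed.

Lemma mexp_unit n (Z : 'M[R]_n) : mexp Z \in unitmx.
Proof. by have [] := mulmx1_unit (mexpN Z). Qed.

Lemma mexp_conj n (g Z : 'M[R]_n) : g \in unitmx ->
  mexp (g *m Z *m invmx g) = g *m mexp Z *m invmx g.
Proof.
move=> gu.
pose z0 : R := n%:R * `|Z|; pose z1 : R := n%:R * `|g *m Z *m invmx g|.
pose z := z0 + z1; have z00 : 0 <= z0 by rewrite mulr_ge0.
have z10 : 0 <= z1 by rewrite mulr_ge0.
have zz : 0 <= z by rewrite addr_ge0.
have HZ : rowle Z z by apply: rowle_le (rowle_norm Z) _; rewrite lerDl.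
have HgZ : rowle (g *m Z *m invmx g) z.
  by apply: rowle_le (rowle_norm _) _; rewrite lerDr.
apply: (mexp_limit zz HgZ) => e e0.
pose c := (z ^+ 2 * expR z) * (n%:R * `|g|) * (n%:R * `|invmx g|).
have [k [k0 kb]] := @archi_le (z ^+ 2 + c) e e0.
have kn : k%:R != 0 :> R by rewrite pnatr_eq0 -lt0n.
have c0 : 0 <= c by rewrite !mulr_ge0 ?exprn_ge0 ?expR_ge0.
have ck0 : 0 <= c / k%:R by rewrite divr_ge0.
have zk0 : 0 <= z ^+ 2 / k%:R by rewrite divr_ge0 ?exprn_ge0.
rewrite mulrDl in kb.
exists k, (k%:R^-1 *: (g *m Z *m invmx g)); split => //.
- lra.
- by rewrite scalerA divff // scale1r.
- by rewrite scalerA divff // scale1r subrr; apply: rowle0; exact: ltW.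
have conjX (B : 'M[R]_n) j : (g *m B *m invmx g) ^+ j = g *m B ^+ j *m invmx g.
  elim: j => [|j IH]; first by rewrite !expr0 mulmx1 mulmxV.
  by rewrite !exprS IH -[_ * (_ *m _ *m _)]/(_ *m _) !mulmxA mulmxKV.
have -> : 1 + k%:R^-1 *: (g *m Z *m invmx g) = g *m (1 + k%:R^-1 *: Z) *m invmx g.
  by rewrite mulmxDr mulmxDl mulmx1 mulmxV // -scalemxAr -scalemxAl.
rewrite conjX -mulmxBl -mulmxBr.
have := mexp_pow1D k0 zz HZ => H.
apply: (@le_trans _ _ (c / k%:R)); last by lra.
have ng0 (A : 'M[R]_n) : 0 <= n%:R * `|A| by rewrite mulr_ge0.
have H2 := rowleM (ng0 _) (rowleM _ (rowle_norm g) H) (rowle_norm (invmx g)).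
have z3 : 0 <= z ^+ 2 / k%:R * expR z by rewrite mulr_ge0 ?expR_ge0.
apply: le_trans (norm_rowle _ (H2 z3)) _; first by rewrite !mulr_ge0 ?expR_ge0.
rewrite /c; lra.
Qed.

Lemma diagX n (e : 'rV[R]_n) k : diag_mx e ^+ k = diag_mx (map_mx (fun x => x ^+ k) e).
Proof.
elim: k => [|k IH].
  by rewrite expr0; apply/matrixP => i j; rewrite !mxE; case: eqP.
rewrite exprS IH -[_ * _]/(_ *m _) mulmx_diag; congr diag_mx.
by apply/rowP => i; rewrite !mxE exprS.
Qed.

(** Entry by entry, the partial sums of both exponentials coincide. *)
Lemma mexp_diag n (d : 'rV[R]_n) : mexp (diag_mx d) = diag_mx (map_mx expR d).
Proof.
apply/matrixP => i j; rewrite [in RHS]mxE [in RHS]mxE.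
apply/eqP; rewrite -subr_eq0 -normr_le0; apply/ler_addgt0Pl => e e0; rewrite addr0.
have e20 : 0 < e / 2 by rewrite divr_gt0.
have [N1 H1] := mexp_partial (diag_mx d) e20.
have /cvgrPdist_lt/(_ _ e20) [N2 _ H2] := @is_cvg_series_exp_coeff R (d 0 i).
pose m := maxn N1 N2; have {}H1 := H1 m (leq_maxl _ _).
have {}H2 := H2 m (leq_maxr _ _).
have := le_lt_trans (entry_le_norm _ i j) H1.
rewrite mxE [X in _ + X]mxE summxE.
under eq_bigr do rewrite diagX !mxE.
case: (altP (i =P j)) => [ij|ij]; last first.
  rewrite big1; last by move=> k _; rewrite mulr0n mulr0.
  by rewrite mulr0n !subr0; lra.
move=> H3; rewrite mulr1n.
have -> : (mexp (diag_mx d)) i j - expR (d 0 i) =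
  (mexp (diag_mx d) i j - \sum_(0 <= k < m) k`!%:R^-1 * d 0 i ^+ k) -
  (expR (d 0 i) - series (exp_coeff (d 0 i)) m).
  rewrite /series /= opprB addrA; congr (_ - _).
  rewrite -[LHS]addr0 -addrA; congr (_ + _).
  by apply/eqP; rewrite eq_sym addrC subr_eq0; apply/eqP/eq_bigr => k _; rewrite mulrC.
apply: (le_trans (ler_normB _ _)).
move: H3; under eq_bigr do rewrite mulr1n; move: H2 => /=.
rewrite -/(expR (d 0 i)); lra.
Qed.

End Exponential.

(** * The Lie algebra of a closed subgroup *)

Section MatrixLie.
Variables (R : realType) (n : nat).
Implicit Types (G H : set 'M[R]_n) (X Y Z g h v : 'M[R]_n).

(** Closed in GL_n, not in the space of all matrices. *)
Definition rel_closed G : Prop := forall g, g \in unitmx ->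
  (forall e : R, 0 < e -> exists h, G h /\ `|h - g| <= e) -> G g.

Lemma conj_expand (U V Y S : 'M[R]_n) :
  U *m Y *m V - Y - (S *m Y - Y *m S) =
  (U - (1 + S)) *m Y + Y *m (V - (1 - S)) + (U - 1) *m Y *m (V - 1).
Proof.
rewrite !(mulmxBl, mulmxBr, mulmxDl, mulmxDr).
rewrite -[_ *m 1]/(_ *m 1%:M) !mulmx1 -![1 *m _]/(1%:M *m _) !mul1mx !mulNmx.
move: (U *m Y *m V) (U *m Y) (Y *m V) (S *m Y) (Y *m S) => A B C D E.
by apply/matrixP => i j; rewrite !mxE; ring.
Qed.

Lemma mul_expand (U V S : 'M[R]_n) :
  U *m V - 1 = (V - (1 - S)) + (U - 1 - S) + (U - 1) *m (V - 1).
Proof.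
rewrite !(mulmxBl, mulmxBr) -![_ *m 1]/(_ *m 1%:M) !mulmx1.
rewrite -![1 *m _]/(1%:M *m _) !mul1mx; move: (U *m V) => A.
by apply/matrixP => i j; rewrite !mxE; ring.
Qed.

Lemma mexp0 : mexp (0 : 'M[R]_n) = 1.
Proof.
have H0 : rowle (0 : 'M[R]_n) 0 by exact: rowle0.
have := mexp_rem (lexx 0) H0.
rewrite expr2 !mul0r addr0 => /(norm_rowle (lexx _)).
by rewrite normr_le0 subr_eq0 => /eqP.
Qed.

Lemma subgroup_unit G g : is_subgroup G -> G g -> g \in unitmx.
Proof. by move=> [GU _ _ _] /GU. Qed.

Lemma subgroupX G g k : is_subgroup G -> G g -> G (g ^+ k).
Proof.
move=> [_ G1 GM _] Gg; elim: k => [|k IH]; first by rewrite expr0.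
by rewrite exprS; exact: GM.
Qed.

(** If G contains elements 1 + v with v almost equal to s Z for small s, their
    powers of order about t / s converge to exp (t Z). *)
Lemma lie_criterion G Z : is_subgroup G -> rel_closed G ->
  (forall e : R, 0 < e -> exists s v, [/\ 0 < s, s <= e, G (1 + v) &
     `|v - s *: Z| <= e * s]) -> lie_algebra G Z.
Proof.
move=> hG hc H.
have pos t : 0 < t -> G (mexp (t *: Z)).
  move=> t0; apply: hc; first exact: mexp_unit.
  move=> e e0.
  pose z := n%:R * (`|t *: Z| + t + `|Z| ).
  have z0 : 0 <= z by rewrite mulr_ge0 // !addr_ge0 // ltW.
  have E := expR_gt0 z.
  pose q := (n%:R * (t + `|Z|) + 2 * z ^+ 2 / t) * expR z + 1.
  have q0 : 0 < q.
    by rewrite ltr_wpDl // mulr_ge0 ?expR_ge0 // addr_ge0 // ?mulr_ge0 ?addr_ge0 ?exprn_ge0 ?invr_ge0 // ltW.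
  pose d := Num.min 1 (Num.min (t / 2) (e / q)).
  have d0 : 0 < d by rewrite !lt_min ltr01 !divr_gt0.
  have [s [v [s0 sd Gv vZ]]] := H d d0.
  pose k := Num.truncn (t / s).
  have ts0 : 0 <= t / s by rewrite divr_ge0 // ltW.
  have /andP[k1 k2] := truncn_itv ts0.
  rewrite ler_pdivlMr // in k1; rewrite ltr_pdivrMr // -natr1 mulrDl mul1r in k2.
  have [d1 dt de] : [/\ d <= 1, d <= t / 2 & d <= e / q].
    by split; rewrite !ge_min lexx ?orbT.
  have ks : t / 2 <= k%:R * s by lra.
  have k0 : (0 < k)%N.
    by rewrite lt0n; apply/eqP => k0; move: ks; rewrite k0 mul0r; lra.
  have kr0 : 0 <= k%:R :> R by [].
  have kvZ : `|k%:R *: v - t *: Z| <= d * (t + `|Z|).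
    have -> : k%:R *: v - t *: Z = k%:R *: (v - s *: Z) + (k%:R * s - t) *: Z.
      by rewrite scalerBr scalerBl scalerA addrA subrK.
    apply: le_trans (ler_normD _ _) _; rewrite mulrDr; apply: lerD.
      rewrite normrZ ger0_norm //; apply: le_trans (ler_wpM2l kr0 vZ) _.
      by rewrite mulrCA ler_wpM2l // ltW.
    rewrite normrZ ler_wpM2r // distrC ger0_norm; lra.
  have kv : rowle (k%:R *: v) z.
    apply: rowle_le (rowle_norm _) _; rewrite ler_wpM2l //.
    rewrite -(subrK (t *: Z) (k%:R *: v)).
    apply: le_trans (ler_normD _ _) _.
    have : d * (t + `|Z|) <= t + `|Z| by rewrite ler_piMl // addr_ge0 // ltW.
    lra.
  have tz : rowle (t *: Z) z.
    apply: rowle_le (rowle_norm _) _; rewrite ler_wpM2l // -addrA lerDl addr_ge0 //.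
    exact: ltW.
  have dn0 : 0 <= n%:R * (d * (t + `|Z|)).
    by rewrite !mulr_ge0 ?addr_ge0 // ltW.
  have kvZ' : rowle (k%:R *: v - t *: Z) (n%:R * (d * (t + `|Z|))).
    by apply: rowle_le (rowle_norm _) _; rewrite ler_wpM2l.
  exists ((1 + v) ^+ k); split; first exact: subgroupX.
  have kn : 0 < k%:R :> R by rewrite ltr0n.
  apply: le_trans (norm_rowle _ (mexp_approx k0 z0 dn0 tz kv kvZ')) _.
    by rewrite mulr_ge0 ?expR_ge0 // addr_ge0 // divr_ge0 ?exprn_ge0.
  have k3 : z ^+ 2 / k%:R <= d * (2 * z ^+ 2 / t).
    have -> : d * (2 * z ^+ 2 / t) = z ^+ 2 * (d * 2 / t) by ring.
    rewrite ler_wpM2l ?exprn_ge0 // -[k%:R^-1]mul1r ler_pdivrMr // mulrAC.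
    rewrite ler_pdivlMr // mul1r.
    apply: (@le_trans _ _ (2 * (k%:R * s))); first by lra.
    have : k%:R * s <= k%:R * d by rewrite ler_wpM2l.
    lra.
  have -> : e = (e / q) * q by rewrite mulfVK // gt_eqF.
  apply: (@le_trans _ _ (d * q)); last by rewrite ler_wpM2r // ltW.
  apply: (@le_trans _ _ (d * ((n%:R * (t + `|Z|) + 2 * z ^+ 2 / t) * expR z))).
    rewrite [leRHS]mulrA; apply: ler_wpM2r; first exact: expR_ge0.
    rewrite [leRHS]mulrDr; apply: lerD => //.
    by rewrite mulrCA.
  by rewrite /q ler_wpM2l ?(ltW d0) // lerDl.
have G1 : G 1 by case: hG.
move=> t; case: (ltrgtP t 0) => [t0|t0|->]; last first.
- by rewrite scale0r mexp0.
- exact: pos.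
have Gm : G (mexp (- t *: Z)) by apply: pos; rewrite oppr_gt0.
have -> : mexp (t *: Z) = invmx (mexp (- t *: Z)); last by case: hG => _ _ _; apply.
have := mexpN (t *: Z); rewrite -scaleNr => E.
rewrite -[LHS]mulmx1 -(mulmxV (mexp_unit (- t *: Z))) mulmxA E.
by rewrite -[1 *m _]/(1%:M *m _) mul1mx.
Qed.

Lemma lie0 G : is_subgroup G -> lie_algebra G 0.
Proof.
by move=> hG t; rewrite scaler0 mexp0; case: hG.
Qed.

Lemma lieZ G c X : lie_algebra G X -> lie_algebra G (c *: X).
Proof. by move=> H t; rewrite scalerA. Qed.

Lemma lie_closed G X : rel_closed G ->
  (forall e : R, 0 < e -> exists Y, lie_algebra G Y /\ `|Y - X| <= e) ->
  lie_algebra G X.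
Proof.
move=> hc H t; apply: hc; first exact: mexp_unit.
move=> e e0.
pose z := n%:R * (`|t *: X| + `|t| + 1).
have z0 : 0 <= z by rewrite mulr_ge0 // !addr_ge0.
pose q := n%:R * `|t| * expR z + 1.
have q0 : 0 < q by rewrite ltr_wpDl // !mulr_ge0 ?expR_ge0.
have [|Y [GY YX]] := H (Num.min 1 (e / q)); first by rewrite lt_min ltr01 divr_gt0.
move: YX; rewrite le_min => /andP[Y1 Ye].
exists (mexp (t *: Y)); split; first exact: GY.
have tYX : `|t *: Y - t *: X| <= `|t| * `|Y - X| by rewrite -scalerBr normrZ.
have d0 : 0 <= n%:R * (`|t| * `|Y - X|) by rewrite !mulr_ge0.
have := @mexp_lip _ _ (t *: X) (t *: Y) z (n%:R * (`|t| * `|Y - X|)) z0 d0.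
have HX : rowle (t *: X) z.
  by apply: rowle_le (rowle_norm _) _; rewrite ler_wpM2l // -addrA lerDl addr_ge0.
have HY : rowle (t *: Y) z.
  apply: rowle_le (rowle_norm _) _; rewrite ler_wpM2l //.
  rewrite -(subrK (t *: X) (t *: Y)); apply: le_trans (ler_normD _ _) _.
  have : `|t| * `|Y - X| <= `|t| by rewrite ler_piMr.
  lra.
have HXY : rowle (t *: Y - t *: X) (n%:R * (`|t| * `|Y - X|)).
  by apply: rowle_le (rowle_norm _) _; rewrite ler_wpM2l.
move/(_ HX HY HXY)/norm_rowle => H1.
apply: le_trans (H1 _) _; first by rewrite mulr_ge0 ?expR_ge0.
have -> : e = (e / q) * q by rewrite mulfVK // gt_eqF.
apply: (@le_trans _ _ (`|Y - X| * q)); last by rewrite ler_wpM2r // ltW.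
have -> : n%:R * (`|t| * `|Y - X|) * expR z = `|Y - X| * (n%:R * `|t| * expR z) by ring.
by rewrite ler_wpM2l // lerDl.
Qed.

Lemma lie_conj G g X : is_subgroup G -> G g -> lie_algebra G X ->
  lie_algebra G (g *m X *m invmx g).
Proof.
move=> hG Gg HX t; rewrite scalemxAl scalemxAr.
rewrite mexp_conj; last exact: subgroup_unit Gg.
case: hG => _ _ GM GV; apply: (GM); last exact: GV.
exact: (GM _ _ Gg (HX t)).
Qed.

Lemma mexp_rem2 X : exists2 c : R, 0 <= c & forall s : R, `|s| <= 1 ->
  `|mexp (s *: X) - (1 + s *: X)| <= c * s ^+ 2.
Proof.
pose x := n%:R * `|X|; have x0 : 0 <= x by rewrite mulr_ge0.
exists (x ^+ 2 * expR x); first by rewrite mulr_ge0 ?exprn_ge0 ?expR_ge0.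
move=> s s1; have sx0 : 0 <= `|s| * x by rewrite mulr_ge0.
have := mexp_rem sx0 (rowleZ s (rowle_norm X)) => /norm_rowle H.
rewrite distrC; apply: le_trans (H _) _.
  by rewrite mulr_ge0 ?exprn_ge0 ?expR_ge0.
rewrite exprMn real_normK ?num_real // -mulrA mulrC ler_wpM2r ?sqr_ge0 //.
by rewrite ler_wpM2l ?exprn_ge0 // ler_expR ler_piMl.
Qed.

Lemma mexp_rem1 X : exists2 c : R, 0 <= c & forall s : R, `|s| <= 1 ->
  `|mexp (s *: X) - 1| <= c * `|s|.
Proof.
have [c c0 H] := mexp_rem2 X; exists (c + `|X|); first by rewrite addr_ge0.
move=> s s1.
have -> : mexp (s *: X) - 1 = (mexp (s *: X) - (1 + s *: X)) + s *: X.
  by rewrite opprD addrA subrK.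
apply: le_trans (ler_normD _ _) _; rewrite normrZ mulrDl [`|X| * _]mulrC lerD2r.
apply: le_trans (H s s1) _; rewrite ler_wpM2l // -real_normK ?num_real //.
by rewrite expr2 ler_piMr.
Qed.

(** exp (s X) exp (s Y) = 1 + s (X + Y) + O(s^2). *)
Lemma lieD G X Y : is_subgroup G -> rel_closed G ->
  lie_algebra G X -> lie_algebra G Y -> lie_algebra G (X + Y).
Proof.
move=> hG hc HX HY; apply: lie_criterion => // e e0.
have [c1 c10 H1] := mexp_rem2 X; have [c2 c20 H2] := mexp_rem2 Y.
have [d1 d10 K1] := mexp_rem1 X; have [d2 d20 K2] := mexp_rem1 Y.
pose q := c1 + c2 + n%:R * d1 * d2 + 1.
have q0 : 0 < q by rewrite ltr_wpDl // !addr_ge0 // !mulr_ge0.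
pose s := Num.min 1 (Num.min e (e / q)).
have s0 : 0 < s by rewrite !lt_min ltr01 e0 divr_gt0.
have [s1 se sq] : [/\ s <= 1, s <= e & s <= e / q].
  by split; rewrite !ge_min lexx ?orbT.
have sa : `|s| <= 1 by rewrite gtr0_norm.
exists s, (mexp (s *: X) *m mexp (s *: Y) - 1); split => //.
  by rewrite addrC subrK; case: hG => _ _ GM _; apply: GM; [exact: HX|exact: HY].
have -> : mexp (s *: X) *m mexp (s *: Y) - 1 - s *: (X + Y) =
  (mexp (s *: X) - (1 + s *: X)) + (mexp (s *: Y) - (1 + s *: Y)) +
  (mexp (s *: X) - 1) *m (mexp (s *: Y) - 1).
  rewrite mulmxBl !mulmxBr -[_ *m 1]/(_ *m 1%:M) !mulmx1 -[1 *m _]/(1%:M *m _) mul1mx.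
  rewrite scalerDr.
  move: (mexp (s *: X)) (mexp (s *: Y)) (s *: X) (s *: Y) => A B C D.
  by move: (A *m B) => E; apply/matrixP => i j; rewrite !mxE; ring.
apply: le_trans (ler_normD _ _) _; apply: le_trans (lerD (ler_normD _ _) (mx_norm_mul _ _)) _.
have L1 := H1 s sa; have L2 := H2 s sa.
have L3 : n%:R * `|mexp (s *: X) - 1| * `|mexp (s *: Y) - 1| <= n%:R * d1 * d2 * s ^+ 2.
  have -> : n%:R * d1 * d2 * s ^+ 2 = n%:R * (d1 * s) * (d2 * s) by ring.
  have K1' := K1 s sa; have K2' := K2 s sa; rewrite gtr0_norm // in K1' K2'.
  by rewrite ler_pM // ?mulr_ge0 // ler_wpM2l.
apply: (@le_trans _ _ (q * s ^+ 2)).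
  apply: le_trans (lerD (lerD L1 L2) L3) _.
  by rewrite -!mulrDl ler_wpM2r ?sqr_ge0 // lerDl.
rewrite expr2 mulrA ler_wpM2r ?(ltW s0) //.
by rewrite mulrC -ler_pdivlMr.
Qed.

Lemma lieB G X Y : is_subgroup G -> rel_closed G ->
  lie_algebra G X -> lie_algebra G Y -> lie_algebra G (X - Y).
Proof. by move=> hG hc HX HY; rewrite -scaleN1r; apply: lieD => //; exact: lieZ. Qed.

Lemma lie_sum G (I : Type) (r : seq I) (F : I -> 'M[R]_n) :
  is_subgroup G -> rel_closed G -> (forall i, lie_algebra G (F i)) ->
  lie_algebra G (\sum_(i <- r) F i).
Proof.
move=> hG hc H; elim/big_ind: _ => //; first exact: lie0.
by move=> X Y; exact: lieD.
Qed.

Lemma invmx_mexp X : invmx (mexp X) = mexp (- X).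
Proof.
rewrite -[LHS]mulmx1 -[1%:M]/1 -(mexpN X) mulmxA mulVmx ?mexp_unit //.
by rewrite mul1mx.
Qed.

(** The bracket is the limit of (exp (s X) Y exp (- s X) - Y) / s. *)
Lemma lie_bracket_closed G X Y : is_subgroup G -> rel_closed G ->
  lie_algebra G X -> lie_algebra G Y -> lie_algebra G (lie_bracket X Y).
Proof.
move=> hG hc HX HY; apply: lie_closed => // e e0.
have [c c0 H] := mexp_rem2 X; have [d d0 K] := mexp_rem1 X.
pose q := 2 * n%:R * c * `|Y| + n%:R * (n%:R * d * `|Y|) * d + 1.
have q0 : 0 < q by rewrite ltr_wpDl // !addr_ge0 // !mulr_ge0.
pose s := Num.min 1 (e / q).
have s0 : 0 < s by rewrite !lt_min ltr01 divr_gt0.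
have [s1 sq] : s <= 1 /\ s <= e / q.
  by split; rewrite !ge_min lexx ?orbT.
have sa : `|s| <= 1 by rewrite gtr0_norm.
have sn : `|- s| <= 1 by rewrite normrN.
exists (s^-1 *: (mexp (s *: X) *m Y *m invmx (mexp (s *: X)) - Y)); split.
  by apply: lieZ; apply: lieB => //; apply: lie_conj.
rewrite invmx_mexp -scaleNr /lie_bracket.
set Z := _ - Y.
have -> : s^-1 *: Z - (X *m Y - Y *m X) = s^-1 *: (Z - s *: (X *m Y - Y *m X)).
  by rewrite [RHS]scalerBr; congr (_ - _); rewrite scalerA mulVf ?gt_eqF // scale1r.
rewrite normrZ gtr0_norm ?invr_gt0 // ler_pdivrMl //.
have -> : Z - s *: (X *m Y - Y *m X) = (mexp (s *: X) - (1 + s *: X)) *m Y +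
   Y *m (mexp (- s *: X) - (1 + - s *: X)) +
   (mexp (s *: X) - 1) *m Y *m (mexp (- s *: X) - 1).
  rewrite /Z scalerBr scaleNr scalemxAl scalemxAr; exact: conj_expand.
apply: le_trans (ler_normD _ _) _.
apply: le_trans (lerD (ler_normD _ _) (mx_norm_mul _ _)) _.
have L1 : `|(mexp (s *: X) - (1 + s *: X)) *m Y| <= n%:R * (c * s ^+ 2) * `|Y|.
  apply: le_trans (mx_norm_mul _ _) _; rewrite ler_wpM2r // ler_wpM2l //; exact: H.
have L2 : `|Y *m (mexp (- s *: X) - (1 + - s *: X))| <= n%:R * `|Y| * (c * s ^+ 2).
  apply: le_trans (mx_norm_mul _ _) _; rewrite ler_wpM2l ?mulr_ge0 //.
  by rewrite -[s ^+ 2]sqrrN; exact: H.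
have K1 := K s sa; have K2 := K (- s) sn; rewrite normrN gtr0_norm // in K1 K2.
have L3 : n%:R * `|(mexp (s *: X) - 1) *m Y| * `|mexp (- s *: X) - 1| <=
    n%:R * (n%:R * (d * s) * `|Y|) * (d * s).
  have n0 : 0 <= n%:R :> R by [].
  apply: ler_pM K2 => //.
  apply: ler_wpM2l => //; apply: le_trans (mx_norm_mul _ _) _.
  by apply: ler_wpM2r => //; apply: ler_wpM2l.
apply: (@le_trans _ _ (q * s ^+ 2)).
  apply: le_trans (lerD (lerD L1 L2) L3) _.
  rewrite [leRHS](_ : _ = n%:R * (c * s ^+ 2) * `|Y| + n%:R * `|Y| * (c * s ^+ 2) +
    n%:R * (n%:R * (d * s) * `|Y|) * (d * s) + s ^+ 2); last by rewrite /q; ring.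
  by rewrite lerDl sqr_ge0.
have -> : q * s ^+ 2 = q * s * s by ring.
have -> : s * e = e * s by ring.
by apply: ler_wpM2r; [exact: ltW|rewrite mulrC -ler_pdivlMr].
Qed.

(** Compactness of balls, transported to matrices from row vectors. *)
Lemma bounded_cluster (u : nat -> 'M[R]_n) (M : R) : (forall j, `|u j| <= M) ->
  exists Y, forall e : R, 0 < e -> forall N, exists2 j, (N <= j)%N & `|u j - Y| <= e.
Proof.
move=> uM; have M0 : 0 <= M by apply: le_trans (uM 0%N).
pose w j := mxvec (u j).
have vecn (v : 'rV[R]_(n * n)) (c : R) : 0 <= c -> `|v| <= c -> `|vec_mx v| <= c.
  move=> c0 vc; apply/mx_norm_leP => // i j; rewrite mxE.
  exact: le_trans (entry_le_norm _ _ _) vc.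
pose A : set 'rV[R]_(n * n) := [set v | `|v| <= M].
have cA : compact A.
  apply: bounded_closed_compact.
    by exists M; split; [exact: num_real|move=> x Mx v /= /le_trans; apply; exact: ltW].
  apply: closed_comp (@closed_le R M) => v _; exact: norm_continuous.
have wA j : A (w j).
  apply/mx_norm_leP => // i k; rewrite ord1 {i}.
  case/mxvec_indexP: k => i k; rewrite mxvecE.
  exact: le_trans (entry_le_norm _ _ _) (uM j).
have [|y [Ay cy]] := cA (w @ \oo) _.
  by exists 0%N => // j _; exact: wA.
exists (vec_mx y) => e e0 N.
have [||v [[j Nj <-] /= yv]] := cy (w @` [set j | (N <= j)%N]) (ball y e).
- by exists N => // j Nj; exists j.
- exact: nbhsx_ballx.
exists j => //; rewrite -[u j]mxvecK -linearB; apply: vecn; first exact: ltW.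
by move: yv; rewrite mx_norm_ball /ball_ /= distrC => /ltW.
Qed.

(** A closed subgroup G' of G containing every one-parameter subgroup of G is
    open: otherwise some h close to 1 stays out of G', and after moving h along
    G' it is almost at minimal distance from 1 in its coset.  The direction
    in which these h approach 1 lies in the Lie algebra, hence can be used to
    move h closer to 1, against minimality. *)
Lemma closed_subgroup_open G G' : is_subgroup G -> rel_closed G ->
  is_subgroup G' -> rel_closed G' -> G' `<=` G ->
  (forall X, lie_algebra G X -> G' (mexp X)) ->
  exists2 d : R, 0 < d & forall h, G h -> `|h - 1| <= d -> G' h.
Proof.
move=> hG hc hG' hc' sub Hexp; apply: contrapT => Habs.
have near d : 0 < d -> exists w, [/\ G w, 0 < `|w - 1|, `|w - 1| <= d &
    forall h', G' h' -> `|w - 1| <= 2 * `|w *m h' - 1|].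
  move=> d0.
  have [h [Gh hd Nh]] : exists h, [/\ G h, `|h - 1| <= d / 2 & ~ G' h].
    apply: contrapT => H; apply: Habs; exists (d / 2); first by rewrite divr_gt0.
    by move=> h Gh hd; apply: contrapT => Nh; apply: H; exists h.
  have hu := subgroup_unit hG Gh.
  have [G'1 G'V] : G' 1 /\ forall g, G' g -> G' (invmx g) by case: hG'.
  have [eta eta0 Heta] : exists2 eta : R, 0 < eta &
      forall h', G' h' -> eta <= `|h *m h' - 1|.
    apply: contrapT => H; apply: Nh; rewrite -[h]invmxK; apply: G'V.
    apply: hc'; first by rewrite unitmx_inv.
    move=> e e0; apply: contrapT => H'; apply: H.
    have q0 : 0 < n%:R * `|invmx h| + 1 :> R by rewrite ltr_wpDl // mulr_ge0.
    exists (e / (n%:R * `|invmx h| + 1)); first by rewrite divr_gt0.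
    move=> h' G'h'; rewrite leNgt; apply/negP => Hlt; apply: H'.
    exists h'; split => //.
    have -> : h' - invmx h = invmx h *m (h *m h' - 1).
      by rewrite mulmxBr mulmxA mulVmx // mul1mx -[_ *m 1]/(_ *m 1%:M) mulmx1.
    apply: le_trans (mx_norm_mul _ _) _.
    apply: (@le_trans _ _ ((n%:R * `|invmx h| + 1) * `|h *m h' - 1|)).
      by rewrite ler_wpM2r // lerDl.
    by rewrite mulrC -ler_pdivlMr // ltW.
  pose D := [set `|h *m h' - 1| | h' in G'].
  have hD : has_inf D.
    split; first by exists `|h *m 1 - 1|, 1.
    by exists eta => _ [h' G'h' <-]; exact: Heta.
  have m0 : 0 < inf D.
    apply: lt_le_trans eta0 _; apply: lb_le_inf; first by case: hD.
    by move=> _ [h' G'h' <-]; exact: Heta.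
  have [_ [h' G'h' <-] hh'] := inf_adherent m0 hD.
  have infle k : G' k -> inf D <= `|h *m k - 1|.
    by move=> G'k; apply: ge_inf; [case: hD|exists k].
  exists (h *m h'); split.
  - by case: hG => _ _ GM _; apply: GM => //; exact: sub.
  - exact: lt_le_trans (infle _ G'h').
  - have := infle 1 G'1; rewrite -[_ *m 1]/(_ *m 1%:M) mulmx1 => H1; lra.
  - move=> k G'k; rewrite -mulmxA.
    have := infle (h' *m k); case: hG' => _ _ GM _ => /(_ (GM _ _ G'h' G'k)); lra.
have inv_gt0 j : 0 < (j.+1%:R : R)^-1 by rewrite invr_gt0 ltr0n.
have /choice[w wP] : forall j : nat, exists w, [/\ G w, 0 < `|w - 1|,
    `|w - 1| <= (j.+1%:R : R)^-1 &
    forall h', G' h' -> `|w - 1| <= 2 * `|w *m h' - 1|].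
  by move=> j; exact: near.
pose u j := `|w j - 1|^-1 *: (w j - 1).
have [j|Y HY] := @bounded_cluster u 1.
  by have [_ s0 _ _] := wP j; rewrite normrZ normfV normr_id mulVf // gt_eqF.
have close e : 0 < e -> exists j, `|w j - 1| <= e /\
    `|(w j - 1) - `|w j - 1| *: Y| <= e * `|w j - 1|.
  move=> e0; have [k [k0 ke]] := @archi_le R 1 e e0.
  have [j kj uY] := HY e e0 k.
  have [_ s0 s1 _] := wP j; exists j; split.
    apply: le_trans s1 _; apply: le_trans ke; rewrite mul1r.
    by rewrite lef_pV2 ?posrE ?ltr0n // ler_nat ltnW.
  have -> : w j - 1 - `|w j - 1| *: Y = `|w j - 1| *: (u j - Y).
    by rewrite scalerBr scalerA divff ?scale1r // gt_eqF.
  by rewrite normrZ normr_id mulrC ler_wpM2r.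
have GY : lie_algebra G Y.
  apply: lie_criterion => // e e0; have [j [j1 j2]] := close e e0.
  have [Gw s0 _ _] := wP j.
  by exists `|w j - 1|, (w j - 1); split => //; rewrite addrC subrK.
have [c c0 H2] := mexp_rem2 Y; have [d d0 H1] := mexp_rem1 Y.
pose q := 8 * (c + n%:R * d) + 8.
have q0 : 0 < q by rewrite ltr_wpDl // mulr_ge0 // addr_ge0 // mulr_ge0.
have [|j [j1 j2]] := close q^-1; first by rewrite invr_gt0.
have [_ s0 _ Hmin] := wP j; move: j1 j2 s0 (Hmin); set s := `|w j - 1| => j1 j2 s0.
move/(_ (mexp (- s *: Y)) (Hexp _ (lieZ (- s) GY))).
have s1 : `|- s| <= 1.
  rewrite normrN normr_id; apply: le_trans j1 _; rewrite invf_le1 // /q.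
  have : 0 <= c + n%:R * d by rewrite addr_ge0 // mulr_ge0.
  lra.
have {}H2 := H2 (- s) s1; have {}H1 := H1 (- s) s1.
rewrite sqrrN normrN normr_id in H1 H2.
have -> : w j *m mexp (- s *: Y) - 1 = (mexp (- s *: Y) - (1 + - s *: Y)) +
   (w j - 1 - s *: Y) + (w j - 1) *m (mexp (- s *: Y) - 1).
  by rewrite scaleNr; exact: mul_expand.
set A := mexp _ - _; set B := w j - 1 - _; set C := mexp _ - 1 => Hm.
have L3 : `|A + B + (w j - 1) *m C| <= `|A| + `|B| + n%:R * `|w j - 1| * `|C|.
  apply: le_trans (ler_normD _ _) _; exact: lerD (ler_normD _ _) (mx_norm_mul _ _).
have L4 : n%:R * `|w j - 1| * `|C| <= n%:R * s * (d * s).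
  by rewrite ler_wpM2l // mulr_ge0.
have sq : q * s <= 1 by rewrite mulrC -ler_pdivlMr // div1r.
have q8 : 8 <= q by rewrite lerDr mulr_ge0 // addr_ge0 // mulr_ge0.
have L5 : q^-1 * s <= s / 8.
  by rewrite mulrC ler_wpM2l ?(ltW s0) // lef_pV2 ?posrE.
have L6 : (c + n%:R * d) * s ^+ 2 <= s / 8.
  rewrite expr2 mulrA [leRHS]mulrC ler_wpM2r ?(ltW s0) //.
  rewrite -[8^-1]mul1r ler_pdivlMr //; apply: le_trans sq.
  rewrite mulrAC ler_wpM2r ?(ltW s0) // /q; lra.
have L7 : (c + n%:R * d) * s ^+ 2 = c * s ^+ 2 + n%:R * s * (d * s) by ring.
rewrite L7 in L6.
have L8 : `|A + B + (w j - 1) *m C| <= s / 8 + s / 8.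
  apply: le_trans L3 _; rewrite -[leLHS]addrA [leLHS]addrCA addrC.
  by apply: lerD (le_trans j2 L5); exact: le_trans (lerD H2 L4) L6.
move: Hm L8 s0; move: (`|A + B + _|) => x; clearbody s; clear; lra.
Qed.

Lemma invmx_mul (g h : 'M[R]_n) : g \in unitmx -> h \in unitmx ->
  invmx (g *m h) = invmx h *m invmx g.
Proof.
move=> gu hu; have ghu : g *m h \in unitmx by rewrite unitmx_mul gu.
apply: (row_free_inj (_ : row_free (g *m h))); first by rewrite row_free_unit.
by rewrite mulVmx // -mulmxA (mulmxA (invmx g)) mulVmx // mul1mx mulVmx.
Qed.

(** Cosets of an open subgroup are open, so an open subgroup is also closed. *)
Lemma connected_subgroup_eq G G' : is_subgroup G -> connected G ->
  is_subgroup G' -> G' `<=` G ->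
  (exists2 d : R, 0 < d & forall h, G h -> `|h - 1| <= d -> G' h) -> G' = G.
Proof.
move=> hG hconn hG' sub [d d0 Hd].
pose U (B : set 'M[R]_n) := \bigcup_(h in B) [set g : 'M[R]_n | `|invmx h *m g - 1| < d].
have openU B : open (U B).
  apply: bigcup_open => h _.
  rewrite openE => g /= hg; apply/nbhs_ballP.
  have q0 : 0 < n%:R * `|invmx h| + 1 :> R by rewrite ltr_wpDl // mulr_ge0.
  exists ((d - `|invmx h *m g - 1|) / (n%:R * `|invmx h| + 1)) => /=.
    by rewrite divr_gt0 // subr_gt0.
  move=> k; rewrite mx_norm_ball /ball_ /= distrC ltr_pdivlMr // => kg.
  have -> : invmx h *m k - 1 = invmx h *m (k - g) + (invmx h *m g - 1).
    by rewrite mulmxBr addrA subrK.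
  apply: le_lt_trans (ler_normD _ _) _; rewrite -ltrBrDr.
  apply: le_lt_trans (mx_norm_mul _ _) _; apply: le_lt_trans kg.
  by rewrite mulrC ler_wpM2l // lerDl.
have Ucoset h g : G h -> G g -> `|invmx h *m g - 1| < d -> G' (invmx h *m g).
  move=> Gh Gg hg; apply: Hd; last exact: ltW.
  by case: hG => _ _ GM GV; apply: GM => //; exact: GV.
have [G1 GM GV] : [/\ G' 1, forall g h, G' g -> G' h -> G' (g *m h) &
   forall g, G' g -> G' (invmx g)] by case: hG'.
have self h : G h -> `|invmx h *m h - 1| < d.
  by move=> Gh; rewrite mulVmx ?(subgroup_unit hG) // -[1%:M]/1 subrr normr0.
apply: hconn; first by exists 1.
- exists (U G') => //; apply/seteqP; split => [g G'g|g [Gg [h G'h hg]]].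
    by split; [exact: sub|exists g => //; apply: self; exact: sub].
  have := GM _ _ G'h (Ucoset _ _ (sub _ G'h) Gg hg).
  by rewrite mulmxA mulmxV ?mul1mx // (subgroup_unit hG') .
- exists (~` U (G `&` ~` G')); first exact: open_closedC.
  apply/seteqP; split => [g G'g|g [Gg Ng]].
    split; first exact: sub.
    move=> [h [Gh Nh] hg]; apply: Nh.
    have := GM _ _ G'g (GV _ (Ucoset _ _ Gh (sub _ G'g) hg)).
    have hu := subgroup_unit hG Gh; have gu := subgroup_unit hG' G'g.
    by rewrite invmx_mul ?unitmx_inv // invmxK mulmxA mulmxV // mul1mx.
  apply: contrapT => Ng'; apply: Ng; exists g => //; exact: self.
Qed.

End MatrixLie.

(** * Tensor powers and decomposable vectors *)

Section Tensor.
Variables (R : realType) (n d : nat).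
Notation T := {ffun 'I_d -> 'I_n}.
Notation m := #|{: T}|.

(** The operator acting by M l on the l-th factor of the d-th tensor power, in the
    basis indexed by the functions from slots to coordinates. *)
Definition tens (M : 'I_d -> 'M[R]_n) : 'M[R]_m :=
  \matrix_(a, b) \prod_l M l ((enum_val a : T) l) ((enum_val b : T) l).

Lemma sum_enum_val (F : T -> R) : \sum_(a < m) F (enum_val a) = \sum_f F f.
Proof.
rewrite (reindex (@enum_val T {: T})) //=.
exists enum_rank => x _; [exact: enum_valK|exact: enum_rankK].
Qed.

Lemma tens_mul M N : tens M *m tens N = tens (fun l => M l *m N l).
Proof.
apply/matrixP => a b; rewrite !mxE.
pose F (f : T) := \prod_l (M l ((enum_val a : T) l) (f l) *
   N l (f l) ((enum_val b : T) l)).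
transitivity (\sum_(c < m) F (enum_val c)).
  by apply: eq_bigr => c _; rewrite !mxE -big_split.
rewrite sum_enum_val.
under [RHS]eq_bigr do rewrite mxE.
by rewrite bigA_distr_bigA.
Qed.

Lemma tens1 : tens (fun _ => 1%:M) = 1%:M.
Proof.
apply/matrixP => a b; rewrite !mxE.
case: (altP (a =P b)) => [->|ab].
  by rewrite big1 // => l _; rewrite mxE eqxx.
suff [l ne] : exists l, (enum_val a : T) l != (enum_val b : T) l.
  by rewrite (bigD1 l) //= mxE (negPf ne) mul0r.
apply/existsP; apply: contraR ab; rewrite negb_exists => /forallP H.
apply/eqP/enum_val_inj/ffunP => l; apply/eqP; have := H l.
by rewrite negbK.
Qed.

Lemma eq_tens M N : M =1 N -> tens M = tens N.
Proof. by move=> MN; apply/matrixP => a b; rewrite !mxE; apply: eq_bigr => l _; rewrite MN. Qed.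

Definition trho (g : 'M[R]_n) := tens (fun _ => g).

Lemma trhoM g h : trho (g *m h) = trho g *m trho h.
Proof. by rewrite tens_mul. Qed.

Lemma trho1 : trho 1%:M = 1%:M. Proof. exact: tens1. Qed.

Lemma trhoX g k : trho (g ^+ k) = trho g ^+ k.
Proof.
elim: k => [|k IH]; first by rewrite !expr0 -[1]/1%:M trho1.
by rewrite !exprS -[g * _]/(g *m _) trhoM IH.
Qed.

Lemma trho_unit g : g \in unitmx -> trho g \in unitmx.
Proof. by move=> gu; have [] := mulmx1_unit (etrans (esym (trhoM g (invmx g))) (etrans (congr1 trho (mulmxV gu)) trho1)). Qed.

Definition slot (k : 'I_d) (X : 'M[R]_n) := tens (fun l => if l == k then X else 1%:M).

Lemma slotD k X Y : slot k (X + Y) = slot k X + slot k Y.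
Proof.
apply/matrixP => a b; rewrite !mxE !(bigD1 k (P := predT)) //= !eqxx mxE mulrDl.
by congr (_ * _ + _ * _); apply: eq_bigr => l /negPf ->.
Qed.

Lemma slotZ k c X : slot k (c *: X) = c *: slot k X.
Proof.
apply/matrixP => a b; rewrite !mxE !(bigD1 k (P := predT)) //= !eqxx mxE -mulrA.
by congr (_ * (_ * _)); apply: eq_bigr => l /negPf ->.
Qed.

Lemma slotM k X Y : slot k X *m slot k Y = slot k (X *m Y).
Proof. by rewrite tens_mul; apply: eq_tens => l; case: eqP; rewrite ?mulmx1. Qed.

Lemma slotC k l X Y : k != l -> slot k X *m slot l Y = slot l Y *m slot k X.
Proof.
move=> kl; rewrite !tens_mul; apply: eq_tens => j.
case: (altP (j =P k)) => [->|_]; first by rewrite (negPf kl) mulmx1 mul1mx.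
by rewrite mulmx1 mul1mx.
Qed.

(** The differential of trho at the identity. *)
Definition tdrho X := \sum_k slot k X.

Lemma tdrhoD X Y : tdrho (X + Y) = tdrho X + tdrho Y.
Proof. by rewrite -big_split; apply: eq_bigr => k _; exact: slotD. Qed.

Lemma tdrhoZ c X : tdrho (c *: X) = c *: tdrho X.
Proof. by rewrite scaler_sumr; apply: eq_bigr => k _; exact: slotZ. Qed.

(** Operators acting in different slots commute. *)
Lemma tdrho_bracket X Y :
  tdrho X *m tdrho Y = tdrho Y *m tdrho X + tdrho (lie_bracket X Y).
Proof.
have -> : tdrho (lie_bracket X Y) =
    \sum_k (slot k X *m slot k Y - slot k Y *m slot k X).
  by apply: eq_bigr => k _; rewrite slotD -scaleN1r slotZ scaleN1r !slotM.
have expand U V : tdrho U *m tdrho V = \sum_k \sum_l slot k U *m slot l V.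
  by rewrite mulmx_suml; apply: eq_bigr => k _; rewrite mulmx_sumr.
rewrite !expand [\sum_k \sum_l slot k Y *m _]exchange_big -big_split /=.
apply: eq_bigr => k _; rewrite (bigD1 k) //= [X in _ = X + _](bigD1 k) //=.
rewrite addrC [RHS]addrC addrA subrK addrC; congr (_ + _).
by apply: eq_bigr => l lk; rewrite slotC // eq_sym.
Qed.

(** First-order expansion of a product of perturbed factors, with constants
    that depend on the number of factors only; it is applied to the entries of
    a tensor power. *)
Lemma prod_taylor (p : nat) : exists2 c : R, 0 <= c &
  forall (a x : 'I_p -> R) (e : R), 0 <= e -> e <= 1 ->
    (forall i, `|a i| <= 1) -> (forall i, `|x i| <= e) ->
  `|\prod_i (a i + x i) - \prod_i a i
    - \sum_k \prod_i (if i == k then x i else a i)| <= c * e ^+ 2 /\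
  `|\sum_k \prod_i (if i == k then x i else a i)| <= p%:R * e.
Proof.
elim: p => [|p [c c0 IH]].
  exists 0 => // a x e e0 e1 Ha Hx; rewrite !big_ord0 subrr subr0 normr0.
  by rewrite !mul0r.
exists (p%:R + 2 * c); first by rewrite addr_ge0 // mulr_ge0.
move=> a x e e0 e1 Ha Hx.
pose a' i := a (lift ord0 i); pose x' i := x (lift ord0 i).
have [] := IH a' x' e e0 e1 (fun i => Ha _) (fun i => Hx _).
have -> : \sum_k \prod_i (if i == k then x i else a i) =
   x ord0 * \prod_i a' i + a ord0 * \sum_k \prod_i (if i == k then x' i else a' i).
  rewrite big_ord_recl; congr (_ + _).
    by rewrite big_ord_recl eqxx; congr (_ * _); apply: eq_bigr.
  rewrite mulr_sumr; apply: eq_bigr => k _; rewrite big_ord_recl /=.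
  by congr (_ * _); apply: eq_bigr => i _; rewrite (inj_eq lift_inj).
rewrite !big_ord_recl -/(a' _) -/(x' _).
rewrite -[\prod_i (a (lift ord0 i) + _)]/(\prod_i (a' i + x' i)).
rewrite -[\prod_(i < p) a (lift ord0 i)]/(\prod_i a' i).
set P := \prod_i (a' i + x' i); set Q := \prod_i a' i; set D := \sum_k _.
move=> H1 H2.
have Q1 : `|Q| <= 1.
  rewrite normr_prod; apply: prodr_ile1 => i _; rewrite normr_ge0 /=; exact: Ha.
have a0 := Ha ord0; have x0 := Hx ord0.
have -> : (a ord0 + x ord0) * P - a ord0 * Q - (x ord0 * Q + a ord0 * D) =
  (a ord0 + x ord0) * (P - Q - D) + x ord0 * D by ring.
split.
  apply: le_trans (ler_normD _ _) _; rewrite !normrM addrC mulrDl; apply: lerD.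
    have -> : p%:R * e ^+ 2 = e * (p%:R * e) by ring.
    by apply: ler_pM.
  rewrite -mulrA; apply: ler_pM => //.
  apply: le_trans (ler_normD _ _) _; lra.
apply: le_trans (ler_normD _ _) _; rewrite !normrM -natr1 mulrDl mul1r addrC.
apply: lerD; first by rewrite -[leRHS]mul1r; apply: ler_pM.
by rewrite -[leRHS]mulr1; apply: ler_pM.
Qed.

Lemma trho_taylor : exists2 c : R, 0 <= c & forall v : 'M[R]_n, `|v| <= 1 ->
  `|trho (1 + v) - 1 - tdrho v| <= c * `|v| ^+ 2.
Proof.
have [c c0 H] := prod_taylor d; exists c => // v v1.
apply/mx_norm_leP => [|a b]; first by rewrite mulr_ge0 // exprn_ge0.
pose A (l : 'I_d) := (1%:M : 'M[R]_n) ((enum_val a : T) l) ((enum_val b : T) l).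
pose x (l : 'I_d) := v ((enum_val a : T) l) ((enum_val b : T) l).
have [] := H A x `|v| (normr_ge0 _) v1.
- by move=> l; rewrite /A mxE; case: eqP; rewrite ?normr1 ?normr0.
- by move=> l; exact: entry_le_norm.
move=> H1 _; apply: le_trans H1; rewrite le_eqVlt; apply/orP; left; apply/eqP.
congr (`| _ |).
have sub3 (U V W : 'M[R]_m) : (U - V - W) a b = U a b - V a b - W a b.
  by rewrite !mxE.
rewrite sub3; congr (_ - _ - _).
- by rewrite mxE; apply: eq_bigr => l _; rewrite mxE.
- by rewrite -[1]/(1%:M) -tens1 mxE.
- rewrite summxE; apply: eq_bigr => k _; rewrite mxE; apply: eq_bigr => l _.
  by case: eqP.
Qed.

Lemma tdrho_norm : exists2 c : R, 0 <= c & forall v : 'M[R]_n,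
   `|tdrho v| <= c * `|v|.
Proof.
exists d%:R => // v; apply/mx_norm_leP => [|a b]; first by rewrite mulr_ge0.
rewrite summxE; apply: le_trans (ler_norm_sum _ _ _) _.
apply: sum_le_card => k; rewrite mxE (bigD1 k) //= eqxx normrM.
rewrite -[leRHS]mulr1; apply: ler_pM => //; first exact: entry_le_norm.
rewrite normr_prod; apply: prodr_ile1 => l /negPf ->; rewrite normr_ge0 /= mxE.
by case: eqP; rewrite ?normr1 ?normr0.
Qed.

(** Translation by g reduces this to the expansion at the identity. *)
Lemma trho_lip g : g \in unitmx -> exists2 c : R, 0 < c &
  forall h, `|h - g| <= c^-1 -> `|trho h - trho g| <= c * `|h - g|.
Proof.
move=> gu; have [c1 c10 H1] := trho_taylor; have [c2 c20 H2] := tdrho_norm.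
pose q := n%:R * `|invmx g| + 1.
have q0 : 0 < q by rewrite ltr_wpDl // mulr_ge0.
pose c := q + m%:R * `|trho g| * (c1 + c2) * q.
have c0 : 0 < c.
  by rewrite ltr_pwDl // mulr_ge0 ?(ltW q0) // mulr_ge0 ?addr_ge0 // mulr_ge0.
exists c => // h hg; pose v := invmx g *m (h - g).
have vq : `|v| <= q * `|h - g|.
  by apply: le_trans (mx_norm_mul _ _) _; apply: ler_wpM2r => //; rewrite lerDl.
have v1 : `|v| <= 1.
  apply: le_trans vq _; apply: le_trans (ler_wpM2l (ltW q0) hg) _.
  rewrite ler_pdivrMr // mul1r /c lerDl.
  by rewrite mulr_ge0 ?(ltW q0) // mulr_ge0 ?addr_ge0 // mulr_ge0.
have -> : h = g *m (1 + v).
  by rewrite mulmxDr mulmxA mulmxV // mul1mx -[_ *m 1]/(_ *m 1%:M) mulmx1 addrC subrK.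
have -> : trho (g *m (1 + v)) - trho g = trho g *m (trho (1 + v) - 1).
  by rewrite trhoM mulmxBr -[_ *m 1]/(_ *m 1%:M) mulmx1.
apply: le_trans (mx_norm_mul _ _) _.
have -> : g *m (1 + v) - g = h - g.
  by rewrite mulmxDr mulmxA mulmxV // mul1mx -[_ *m 1]/(_ *m 1%:M) mulmx1 addrC addKr.
have L : `|trho (1 + v) - 1| <= (c1 + c2) * `|v|.
  rewrite -(subrK (tdrho v) (trho (1 + v) - 1)); apply: le_trans (ler_normD _ _) _.
  rewrite mulrDl; apply: lerD; last exact: H2.
  apply: le_trans (H1 v v1) _; apply: ler_wpM2l => //.
  by rewrite expr2 ler_piMr.
have mg : 0 <= m%:R * `|trho g| by rewrite mulr_ge0.
apply: le_trans (ler_wpM2l mg L) _.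
have mg2 : 0 <= m%:R * `|trho g| * (c1 + c2) by rewrite mulr_ge0 // addr_ge0.
rewrite mulrA; apply: le_trans (ler_wpM2l mg2 vq) _.
by rewrite mulrA ler_wpM2r // /c lerDr ltW.
Qed.

(** trho maps (1 + X / k)^k to the k-th power of some 1 + v with k v close to
    tdrho X, so that mexp_limit identifies the limit. *)
Lemma trho_mexp X : trho (mexp X) = mexp (tdrho X).
Proof.
have [c1 c10 H1] := trho_taylor; have [c2 c20 H2] := tdrho_norm.
have [c3 c30 H3] := trho_lip (mexp_unit X).
apply/esym.
pose x := n%:R * `|X|; have x0 : 0 <= x by rewrite mulr_ge0.
pose z := m%:R * (`|tdrho X| + c1 * `|X| ^+ 2).
have z0 : 0 <= z by rewrite mulr_ge0 // addr_ge0 // mulr_ge0 ?exprn_ge0.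
have HZ : rowle (tdrho X) z.
  apply: rowle_le (rowle_norm _) _; rewrite ler_wpM2l // lerDl.
  by rewrite mulr_ge0 ?exprn_ge0.
apply: (mexp_limit z0 HZ) => e e0.
pose E := x ^+ 2 * expR x; have E0 : 0 <= E by rewrite mulr_ge0 ?exprn_ge0 ?expR_ge0.
pose B1 := z ^+ 2; pose B2 := m%:R * (c1 * `|X| ^+ 2); pose B3 := c3 * E.
have [B10 B20 B30] : [/\ 0 <= B1, 0 <= B2 & 0 <= B3].
  by rewrite exprn_ge0 // !mulr_ge0 // ?exprn_ge0 // ltW.
have e'0 : 0 < Num.min e (Num.min 1 c3^-1) by rewrite !lt_min e0 ltr01 invr_gt0.
have [k [k0 ke]] := @archi_le R (B1 + B2 + B3 + `|X| + E) _ e'0.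
move: ke; rewrite !le_min => /andP[ke /andP[k1 kc]].
have kn : k%:R != 0 :> R by rewrite pnatr_eq0 -lt0n.
have kr : 0 < k%:R :> R by rewrite ltr0n.
have part y w : 0 <= y -> y <= B1 + B2 + B3 + `|X| + E ->
   (B1 + B2 + B3 + `|X| + E) / k%:R <= w -> y / k%:R <= w.
  by move=> _ yB; apply: le_trans; rewrite ler_wpM2r ?invr_ge0.
have X0 := normr_ge0 X.
have Xk : `|k%:R^-1 *: X| <= 1.
  rewrite normrZ ger0_norm ?invr_ge0 // mulrC; apply: part k1 => //; lra.
pose v := trho (1 + k%:R^-1 *: X) - 1.
have kv : `|k%:R *: v - tdrho X| <= c1 * `|X| ^+ 2 / k%:R.
  have -> : k%:R *: v - tdrho X = k%:R *: (v - tdrho (k%:R^-1 *: X)).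
    by rewrite [RHS]scalerBr -tdrhoZ scalerA divff // scale1r.
  rewrite normrZ ger0_norm //; apply: le_trans (ler_wpM2l (ltW kr) (H1 _ Xk)) _.
  rewrite normrZ ger0_norm ?invr_ge0 // exprMn le_eqVlt; apply/orP; left; apply/eqP.
  by field.
exists k, v; split => //.
- by rewrite -/B1; apply: part ke => //; lra.
- apply: rowle_le (rowle_norm _) _; rewrite ler_wpM2l //.
  rewrite -(subrK (tdrho X) (k%:R *: v)) addrC; apply: le_trans (ler_normD _ _) _.
  rewrite lerD2l; apply: le_trans kv _.
  by rewrite ler_piMr ?mulr_ge0 ?exprn_ge0 // invf_le1 // ler1n.
- apply: rowle_le (rowle_norm _) _.
  apply: le_trans (ler_wpM2l (ler0n _ _) kv) _.
  by rewrite mulrA; apply: part ke => //; rewrite -/B2; lra.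
- rewrite /v [1 + _]addrC subrK -trhoX.
  have L : `|(1 + k%:R^-1 *: X) ^+ k - mexp X| <= E / k%:R.
    have := mexp_pow1D k0 x0 (rowle_norm X) => /norm_rowle H.
    apply: le_trans (H _) _; first by rewrite mulr_ge0 ?expR_ge0 // divr_ge0 ?exprn_ge0.
    by rewrite mulrAC.
  apply: le_trans (H3 _ _) _.
    by apply: le_trans L _; apply: part kc => //; lra.
  apply: le_trans (ler_wpM2l (ltW c30) L) _.
  by rewrite mulrA; apply: part ke => //; rewrite -/B3; lra.
Qed.

(** The decomposable vector attached to the coordinates i k, antisymmetrised
    within each block of slots having the same label j k: the tensor product
    over the blocks of the exterior products of the vectors e_(i k). *)
Definition wedge_at (J : eqType) (i : 'I_d -> 'I_n) (j : 'I_d -> J) (f : T) : R :=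
  \det (\matrix_(k < d, l < d) ((j k == j l) && (i k == f l))%:R).

Definition wedge (J : eqType) (i : 'I_d -> 'I_n) (j : 'I_d -> J) : 'rV[R]_m :=
  \row_a wedge_at i j (enum_val a).

(** Multilinearity of the determinant in its columns (a Cauchy-Binet formula
    whose second factor is the product of the entries of g). *)
Lemma wedge_trho_det (J : eqType) (i : 'I_d -> 'I_n) (j : 'I_d -> J) (g : 'M[R]_n) a :
  (wedge i j *m trho g) 0 a =
  \det (\matrix_(k < d, l < d) ((j k == j l)%:R * g (i k) ((enum_val a : T) l))).
Proof.
pose F (f : T) := wedge_at i j f * \prod_l g (f l) ((enum_val a : T) l).
rewrite mxE; transitivity (\sum_(c < m) F (enum_val c)).
  by apply: eq_bigr => c _; rewrite !mxE.
rewrite sum_enum_val {}/F.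
transitivity (\sum_(s : {perm 'I_d}) \sum_(f : T) (-1) ^+ s *
    \prod_l (((j (s^-1 l)%g == j l) && (i (s^-1 l)%g == f l))%:R *
       g (f l) ((enum_val a : T) l))).
  rewrite exchange_big /=; apply: eq_bigr => f _; rewrite big_distrl /=.
  apply: eq_bigr => s _; rewrite -mulrA; congr (_ * _).
  rewrite [X in X * _](reindex_inj (@perm_inj _ (s^-1)%g)) /= -big_split.
  by apply: eq_bigr => l _; rewrite mxE permKV.
apply: eq_bigr => s _; rewrite -mulr_sumr; congr (_ * _).
rewrite [RHS](reindex_inj (@perm_inj _ (s^-1)%g)) /=.
under [RHS]eq_bigr do rewrite mxE permKV.
rewrite -(bigA_distr_bigA (fun l c => ((j ((s^-1)%g l) == j l) && (i ((s^-1)%g l) == c))%:R *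
  g c ((enum_val a : T) l))).
apply: eq_bigr => l _; rewrite (bigD1 (i ((s^-1)%g l))) //= eqxx andbT.
rewrite big1 ?addr0 // => c ci; by rewrite [i _ == c]eq_sym (negPf ci) andbF mul0r.
Qed.

(** When the span of the coordinates of each block is stable under g, the
    exterior powers are multiplied by the determinants of g on these spans. *)
Lemma wedge_trho (J : eqType) (i : 'I_d -> 'I_n) (j : 'I_d -> J) (g : 'M[R]_n) :
  injective (fun k => (i k, j k)) ->
  (forall k c, g (i k) c != 0 -> exists p, j p = j k /\ i p = c) ->
  wedge i j *m trho g =
  \det (\matrix_(k < d, p < d) ((j k == j p)%:R * g (i k) (i p))) *: wedge i j.
Proof.
move=> inj H; apply/rowP => a; rewrite wedge_trho_det [RHS]mxE [wedge _ _ _ _]mxE.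
rewrite /wedge_at -det_mulmx; congr (\det _); apply/matrixP => k l.
rewrite !mxE; under eq_bigr do rewrite !mxE.
set c := (enum_val a : T) l.
case: (altP (g (i k) c =P 0)) => [g0|gn].
  rewrite g0 mulr0 big1 // => p _.
  case: (altP (i p =P c)) => [ic|_]; last by rewrite andbF mulr0.
  by rewrite ic g0 mulr0 mul0r.
have [p [jp ip]] := H k c gn.
rewrite (bigD1 p) //= jp ip !eqxx andbT mul1r mulrC big1 ?addr0 // => q qp.
case: (altP (j k =P j q)) => [jkq|_]; last by rewrite !mul0r.
case: (altP (i q =P c)) => [iq|_]; last by rewrite andbF mulr0.
case/eqP: qp; apply: inj; by rewrite iq ip -jkq jp.
Qed.

Lemma wedge_neq0 (J : eqType) (i : 'I_d -> 'I_n) (j : 'I_d -> J) :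
  injective (fun k => (i k, j k)) -> wedge i j != 0.
Proof.
move=> inj; apply/eqP => /rowP/(_ (enum_rank ([ffun k => i k] : T))).
rewrite mxE [RHS]mxE enum_rankK /wedge_at => /eqP.
rewrite (_ : \matrix_(k, l) _ = 1%:M) ?det1 ?oner_eq0 //.
apply/matrixP => k l; rewrite !mxE ffunE; congr (nat_of_bool _)%:R.
apply/andP/eqP => [[/eqP jkl /eqP ikl]|->]; last by rewrite !eqxx.
by apply: inj; rewrite jkl ikl.
Qed.

(** Differentiating wedge_trho at the identity. *)
Lemma wedge_tdrho (J : eqType) (i : 'I_d -> 'I_n) (j : 'I_d -> J) (X : 'M[R]_n) :
  injective (fun k => (i k, j k)) ->
  (forall k c, X (i k) c != 0 -> exists p, j p = j k /\ i p = c) ->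
  (wedge i j *m tdrho X <= wedge i j)%MS.
Proof.
move=> inj H; have [c c0 HT] := trho_taylor.
set t := wedge i j; set q := cokermx t.
have line s : (t *m trho (1 + s *: X) <= t)%MS.
  rewrite wedge_trho ?scalemx_sub // => k l.
  rewrite !mxE; case: (altP (i k =P l)) => [<- _|_]; first by exists k.
  by rewrite mulr0n add0r => sX; apply: H; apply: contraNneq sX => ->; rewrite mulr0.
rewrite submxE -/q -normr_le0; apply/ler_addgt0Pr => e e0; rewrite add0r.
pose C := m%:R * (m%:R * `|t| * (c * `|X| ^+ 2)) * `|q|.
have C0 : 0 <= C by rewrite !mulr_ge0 ?exprn_ge0.
have me : 0 < Num.min 1 e by rewrite lt_min ltr01.
have [k [k0 kC]] := @archi_le R (C + `|X|) _ me.
move: kC; rewrite le_min => /andP[k1 ke].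
have kr : 0 < k%:R :> R by rewrite ltr0n.
have kn : k%:R != 0 :> R by rewrite gt_eqF.
have Xk : `|k%:R^-1 *: X| <= 1.
  rewrite normrZ ger0_norm ?invr_ge0 // mulrC; apply: le_trans k1.
  by rewrite ler_wpM2r ?invr_ge0 // lerDr.
set r := trho (1 + k%:R^-1 *: X) - 1 - tdrho (k%:R^-1 *: X).
have rb : `|r| <= c * `|k%:R^-1 *: X| ^+ 2 by exact: HT.
have -> : t *m tdrho X *m q = - k%:R *: (t *m r *m q).
  have Lq : t *m trho (1 + k%:R^-1 *: X) *m q = 0.
    by apply/eqP; rewrite -submxE.
  have tq : t *m q = 0 by apply/eqP; rewrite -submxE.
  rewrite /r !mulmxBr !mulmxBl Lq -[_ *m 1]/(_ *m 1%:M) mulmx1 tq subr0 sub0r.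
  by rewrite tdrhoZ -scalemxAr -scalemxAl scalerN scaleNr opprK scalerA divff // scale1r.
rewrite normrZ normrN ger0_norm //.
have rC : `|t *m r *m q| <= C / k%:R ^+ 2.
  apply: le_trans (mx_norm_mul _ _) _.
  have -> : C / k%:R ^+ 2 = m%:R * (m%:R * `|t| * (c * (k%:R^-1 * `|X|) ^+ 2)) * `|q|.
    by rewrite /C; field.
  apply: ler_wpM2r => //; apply: ler_wpM2l => //.
  apply: le_trans (mx_norm_mul _ _) _; apply: ler_wpM2l; first by rewrite mulr_ge0.
  by move: rb; rewrite normrZ ger0_norm ?invr_ge0.
apply: le_trans (ler_wpM2l (ltW kr) rC) _.
have -> : k%:R * (C / k%:R ^+ 2) = C / k%:R by field.
by apply: le_trans ke; rewrite ler_wpM2r ?invr_ge0 // lerDl.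
Qed.

Lemma trho_diag (e : 'rV[R]_n) :
  trho (diag_mx e) = diag_mx (\row_a \prod_l e 0 ((enum_val a : T) l)).
Proof.
apply/matrixP => a b; rewrite !mxE; case: (altP (a =P b)) => [->|ab].
  by rewrite mulr1n; apply: eq_bigr => l _; rewrite mxE eqxx mulr1n.
suff [l ne] : exists l, (enum_val a : T) l != (enum_val b : T) l.
  by rewrite (bigD1 l) //= mxE (negPf ne) mulr0n mul0r.
apply/existsP; apply: contraR ab; rewrite negb_exists => /forallP H.
apply/eqP/enum_val_inj/ffunP => l; apply/eqP; have := H l.
by rewrite negbK.
Qed.

Lemma tdrho_diag (e : 'rV[R]_n) :
  tdrho (diag_mx e) = diag_mx (\row_a \sum_l e 0 ((enum_val a : T) l)).
Proof.
have slotd k : slot k (diag_mx e) = diag_mx (\row_a e 0 ((enum_val a : T) k)).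
  apply/matrixP => a b; rewrite !mxE (bigD1 k) //= eqxx mxE.
  case: (altP (a =P b)) => [->|ab].
    rewrite eqxx !mulr1n big1 ?mulr1 // => l /negPf lk.
    by rewrite lk mxE eqxx.
  case: (altP ((enum_val a : T) k =P (enum_val b : T) k)) => [abk|_]; last first.
    by rewrite mulr0n mul0r.
  suff [l ne] : exists l, (enum_val a : T) l != (enum_val b : T) l.
    have lk : l != k by apply: contraNneq ne => ->; rewrite abk.
    by rewrite (bigD1 l) //= (negPf lk) mxE (negPf ne) mul0r mulr0.
  apply/existsP; apply: contraR ab; rewrite negb_exists => /forallP H.
  apply/eqP/enum_val_inj/ffunP => l; apply/eqP; have := H l.
  by rewrite negbK.
rewrite /tdrho; under eq_bigr do rewrite slotd.
by rewrite -linear_sum; congr diag_mx; apply/rowP => a; rewrite summxE !mxE;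
  apply: eq_bigr => l _; rewrite mxE.
Qed.

(** The coordinates of the wedge vector are supported on the rearrangements
    of i, so it is a weight vector for the diagonal matrices. *)
Lemma wedge_support (J : eqType) (i : 'I_d -> 'I_n) (j : 'I_d -> J) a :
  wedge i j 0 a != 0 ->
  forall e : 'I_n -> R, \sum_l e ((enum_val a : T) l) = \sum_k e (i k).
Proof.
rewrite mxE => dn e.
have [s Hs] : exists s : {perm 'I_d}, forall k, i k = (enum_val a : T) (s k).
  apply: contrapT => N; case/eqP: dn; apply: big1 => s _.
  have /existsP[k ki] : [exists k, i k != (enum_val a : T) (s k)].
    apply: contrapT => /negP; rewrite negb_exists => /forallP H; apply: N.
    by exists s => k; apply/eqP; have := H k; rewrite negbK.
  by rewrite (bigD1 k) //= mxE (negPf ki) andbF mul0r mulr0.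
rewrite (reindex_inj (@perm_inj _ s)) /=.
by apply: eq_bigr => k _; rewrite -Hs.
Qed.

End Tensor.

(** The partial sums of the exponential series preserve the row space of M. *)
Lemma mexp_stable (R : realType) p m (M : 'M[R]_(p, m)) (B : 'M[R]_m) :
  (M *m B <= M)%MS -> (M *m mexp B <= M)%MS.
Proof.
move=> MB; set q := cokermx M.
have pow k : (M *m B ^+ k <= M)%MS.
  elim: k => [|k IH]; first by rewrite expr0 -[_ *m 1]/(_ *m 1%:M) mulmx1.
  by rewrite exprS -[B * _]/(B *m _) mulmxA; apply: submx_trans (submxMr _ MB) IH.
rewrite submxE -/q -normr_le0; apply/ler_addgt0Pr => e e0; rewrite add0r.
pose C := m%:R * (m%:R * `|M|) * `|q| + 1.
have C0 : 0 < C by rewrite ltr_wpDl // !mulr_ge0.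
have [|N /(_ _ (leqnn N)) HN] := @mexp_partial _ _ B (e / C); first by rewrite divr_gt0.
set S := \sum_(0 <= k < N) _ in HN.
have MS : M *m S *m q = 0.
  apply/eqP; rewrite -submxE mulmx_sumr summx_sub // => k _.
  by rewrite -scalemxAr scalemx_sub.
have -> : M *m mexp B *m q = M *m (mexp B - S) *m q.
  by rewrite mulmxBr mulmxBl MS subr0.
apply: le_trans (mx_norm_mul _ _) _.
apply: (@le_trans _ _ (m%:R * (m%:R * `|M| * `|mexp B - S|) * `|q|)).
  by apply: ler_wpM2r => //; apply: ler_wpM2l => //; exact: mx_norm_mul.
apply: (@le_trans _ _ (C * `|mexp B - S|)).
  have -> : C * `|mexp B - S| =
    m%:R * (m%:R * `|M| * `|mexp B - S|) * `|q| + `|mexp B - S| by rewrite /C; ring.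
  by rewrite lerDl.
by rewrite mulrC -ler_pdivlMr // ltW.
Qed.

(** * Weights and root vectors *)

Lemma span_basis (F : fieldType) m (P : 'rV[F]_m -> Prop) :
  exists r (B : 'M[F]_(r, m)), [/\ forall i, P (row i B), row_free B &
    forall v, P v -> (v <= B)%MS].
Proof.
pose good r := exists B : 'M[F]_(r, m), (forall i, P (row i B)) /\ row_free B.
have ex : exists r, `[< good r >].
  exists 0%N; apply/asboolP; exists 0; split; first by case.
  by rewrite /row_free mxrank0.
have ub r : `[< good r >] -> (r <= m)%N.
  move/asboolP => [B [_ /eqP <-]]; exact: rank_leq_col.
case: (ex_maxnP ex ub) => r /asboolP[B [PB fB]] max.
exists r, B; split => // v Pv; apply: contrapT => /negP vB.
suff /max : `[< good (r + 1)%N >] by rewrite addn1 ltnn.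
apply/asboolP; exists (col_mx B v); split.
  move=> i; case: (split_ordP i) => k ->; first by rewrite rowKu.
  by rewrite rowKd ord1 (_ : row 0 v = v) //; apply/rowP => a; rewrite mxE.
rewrite /row_free eqn_leq rank_leq_row /= -(addsmxE B v) addn1 -[X in (X < _)%N](eqP fB).
by rewrite rank_ltmx // ltmxE addsmxSl /= addsmx_sub submx_refl.
Qed.

Lemma mul_mx_diagE (F : fieldType) p m (M : 'M[F]_(p, m)) (e : 'rV[F]_m) i a :
  (M *m diag_mx e) i a = M i a * e 0 a.
Proof. by rewrite mul_mx_diag mxE. Qed.

Lemma mx_norm_mul3 (R : realType) p m n q (A : 'M[R]_(p, m)) (X : 'M[R]_(m, n))
    (B : 'M[R]_(n, q)) :
  `|A *m X *m B| <= m%:R * n%:R * `|A| * `|B| * `|X|.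
Proof.
apply: le_trans (mx_norm_mul _ _) _.
have -> : m%:R * n%:R * `|A| * `|B| * `|X| = n%:R * (m%:R * `|A| * `|X|) * `|B| by ring.
by apply: ler_wpM2r => //; apply: ler_wpM2l => //; exact: mx_norm_mul.
Qed.

(** Lagrange interpolation on the values in s. *)
Lemma indicator_poly (F : fieldType) (s : seq F) (c : F) :
  exists q : {poly F}, forall b, b \in s -> q.[b] = (b == c)%:R.
Proof.
exists (\prod_(a <- s | a != c) ((c - a)^-1 *: ('X - a%:P))) => b bs.
rewrite horner_prod; case: (altP (b =P c)) => [->|bc].
  by apply: big1 => a ac; rewrite !hornerE mulVf // subr_eq0 eq_sym.
by rewrite (big_rem b) //= bc !hornerE subrr mulr0 mul0r.
Qed.

(** The setting of this section and of the next ones: E stands for the Lie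
    algebra of the torus and el for its inclusion in the matrices; Q diagonalises
    it, with weights chi; C stands for the Weyl chamber, on which the
    roots of G do not change sign. *)
Section Module.
Variables (R : realType) (n d : nat) (G : set 'M[R]_n).
Hypothesis hG : is_subgroup G.
Hypothesis hGc : rel_closed G.
Hypothesis hGconn : connected G.
Variables (E : lmodType R) (el : E -> 'M[R]_n) (Q : 'M[R]_n) (chi : 'I_n -> E -> R).
Hypothesis Qu : Q \in unitmx.
Hypothesis elG : forall h, lie_algebra G (el h).
Hypothesis elD : forall h, Q *m el h *m invmx Q = diag_mx (\row_i chi i h).
Hypothesis chiL : forall i c x y, chi i (c *: x + y) = c * chi i x + chi i y.
Variable C : set E.

Definition conjQ (X : 'M[R]_n) := Q *m X *m invmx Q.

Definition root_vector (X : 'M[R]_n) (i j : 'I_n) : Prop :=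
  forall h, lie_bracket (el h) X = (chi i h - chi j h) *: X.

Hypothesis hroot : forall X i j, lie_algebra G X -> X != 0 -> root_vector X i j ->
  forall z, C z -> 0 < chi i z - chi j z -> forall x, C x -> 0 <= chi i x - chi j x.

Lemma conjQM X Y : conjQ (X *m Y) = conjQ X *m conjQ Y.
Proof. by rewrite /conjQ !mulmxA mulmxKV. Qed.

Lemma conjQ1 : conjQ 1%:M = 1%:M.
Proof. by rewrite /conjQ mulmx1 mulmxV. Qed.

Lemma conjQD X Y : conjQ (X + Y) = conjQ X + conjQ Y.
Proof. by rewrite /conjQ mulmxDr mulmxDl. Qed.

Lemma conjQN X : conjQ (- X) = - conjQ X.
Proof. by rewrite /conjQ mulmxN mulNmx. Qed.

Lemma conjQZ c X : conjQ (c *: X) = c *: conjQ X.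
Proof. by rewrite /conjQ -scalemxAr -scalemxAl. Qed.

Lemma conjQ_sum (I : Type) (r : seq I) (F : I -> 'M[R]_n) :
  conjQ (\sum_(i <- r) F i) = \sum_(i <- r) conjQ (F i).
Proof. by rewrite /conjQ mulmx_sumr mulmx_suml. Qed.

Lemma conjQ_inj : injective conjQ.
Proof.
move=> X Y /(congr1 (fun Z => invmx Q *m Z *m Q)).
by rewrite /conjQ !mulmxA mulVmx // !mul1mx !mulmxKV.
Qed.

Lemma conjQ_bracket X Y :
  conjQ (lie_bracket X Y) = lie_bracket (conjQ X) (conjQ Y).
Proof. by rewrite /lie_bracket conjQD conjQN !conjQM. Qed.

Lemma conjQ_mexp X : conjQ (mexp X) = mexp (conjQ X).
Proof. by rewrite /conjQ mexp_conj. Qed.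

Lemma conjQ_unit X : X \in unitmx -> conjQ X \in unitmx.
Proof. by move=> Xu; rewrite !unitmx_mul Qu Xu unitmx_inv. Qed.

Lemma conjQ_mexp_el h : conjQ (mexp (el h)) = diag_mx (\row_i expR (chi i h)).
Proof.
rewrite conjQ_mexp /conjQ elD mexp_diag; congr diag_mx.
by apply/rowP => i; rewrite !mxE.
Qed.

Lemma root_vectorP X i j : (forall k l, conjQ X k l != 0 ->
   forall h, chi k h - chi l h = chi i h - chi j h) <-> root_vector X i j.
Proof.
have br h k l : conjQ (lie_bracket (el h) X) k l =
    (chi k h - chi l h) * conjQ X k l.
  rewrite conjQ_bracket /lie_bracket.
  have -> : conjQ (el h) = diag_mx (\row_i chi i h) by exact: elD.
  by rewrite mul_diag_mx mul_mx_diag !mxE; ring.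
split => [H h|H k l nz h].
  apply: conjQ_inj; rewrite conjQZ; apply/matrixP => k l; rewrite br [RHS]mxE.
  case: (altP (conjQ X k l =P 0)) => [->|nz]; first by rewrite !mulr0.
  by rewrite (H k l nz).
by apply/(mulIf nz); rewrite -br H conjQZ mxE.
Qed.

(** E is not a finite union of proper subspaces: the one-parameter families
    c h1 + h' avoid each hyperplane for all but one c. *)
Lemma generic_element : exists h0 : E, forall i j k l,
  chi i h0 - chi j h0 = chi k h0 - chi l h0 ->
  forall h, chi i h - chi j h = chi k h - chi l h.
Proof.
pose I := ('I_n * 'I_n * ('I_n * 'I_n))%type.
pose f (p : I) h := chi p.1.1 h - chi p.1.2 h - (chi p.2.1 h - chi p.2.2 h).
have fL p c x y : f p (c *: x + y) = c * f p x + f p y.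
  by rewrite /f !chiL; ring.
have avoid (s : seq R) : exists c, c \notin s.
  exists (1 + \sum_(x <- s) `|x|); apply/negP => cs.
  have : 1 + \sum_(x <- s) `|x| <= \sum_(x <- s) `|x|.
    rewrite [leRHS](big_rem _ cs) /= ler_wpDr ?sumr_ge0 //; exact: ler_norm.
  by rewrite gerDr ler10.
have H (s : seq I) : exists h0, forall p, p \in s -> f p h0 = 0 -> forall h, f p h = 0.
  elim: s => [|p s [h1 H1]]; first by exists 0.
  case: (pselect (forall h, f p h = 0)) => [p0|].
    exists h1 => q; rewrite inE => /orP[/eqP-> _ //|qs]; exact: H1.
  move=> /existsNP[h' /eqP ph'].
  have [c cs] := avoid [seq - f q h' / f q h1 | q <- p :: s].
  exists (c *: h1 + h') => q qs; rewrite fL => e.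
  case: (eqVneq (f q h1) 0) => [q0|q0].
    move: e; rewrite q0 mulr0 add0r => e.
    move: qs; rewrite inE => /orP[/eqP qp|qs]; last exact: H1.
    by case/eqP: ph'; rewrite -qp.
  case/negP: cs; apply/mapP; exists q => //.
  apply/(mulIf q0); rewrite mulfVK //; apply/eqP; rewrite -subr_eq0 opprK; exact/eqP.
have [h0 Hh0] := H (enum {: I}).
exists h0 => i j k l e h; apply/eqP; rewrite -subr_eq0; apply/eqP.
apply: (Hh0 (i, j, (k, l))); first by rewrite mem_enum.
by apply/eqP; rewrite subr_eq0; exact/eqP.
Qed.

(** The Lie algebra is spanned by the root vectors it contains: it is stable
    under conjugation by a generic element of the torus, hence under the
    spectral projections of that conjugation. *)
Lemma root_decomposition (L : 'M[R]_n -> Prop) :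
  L 0 -> (forall X Y, L X -> L Y -> L (X + Y)) ->
  (forall X i j, lie_algebra G X -> root_vector X i j -> L X) ->
  forall X, lie_algebra G X -> L X.
Proof.
move=> L0 LD Lroot X GX.
have [h0 Hh0] := generic_element.
pose mu (p : 'I_n * 'I_n) := expR (chi p.1 h0 - chi p.2 h0).
pose vals := undup [seq mu p | p <- enum {: 'I_n * 'I_n}].
have mu_in p : mu p \in vals by rewrite mem_undup; apply: map_f; rewrite mem_enum.
pose comp c := invmx Q *m (\matrix_(i, j) (conjQ X i j * (mu (i, j) == c)%:R)) *m Q.
have conj_comp c : conjQ (comp c) = \matrix_(i, j) (conjQ X i j * (mu (i, j) == c)%:R).
  by rewrite /conjQ /comp !mulmxA mulmxV // mul1mx -mulmxA mulmxV // mulmx1.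
have -> : X = \sum_(c <- vals) comp c.
  apply: conjQ_inj; rewrite conjQ_sum; apply/matrixP => i j; rewrite summxE.
  under eq_bigr do rewrite conj_comp mxE.
  rewrite (bigD1_seq (mu (i, j))) ?undup_uniq //= eqxx mulr1 big1 ?addr0 // => c.
  by rewrite eq_sym => /negPf ->; rewrite mulr0.
apply: big_ind => // c _.
have Gc : lie_algebra G (comp c).
  have [q Hq] := indicator_poly vals c.
  pose g k := mexp (el h0) ^+ k.
  have Gg k : G (g k) by apply: subgroupX => //; rewrite -[el h0]scale1r; exact: elG.
  have -> : comp c = \sum_(k < size q) q`_k *: (g k *m X *m invmx (g k)).
    apply: conjQ_inj; rewrite conj_comp conjQ_sum; apply/matrixP => i j.
    rewrite mxE summxE -Hq // horner_coef mulr_sumr; apply: eq_bigr => k _.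
    rewrite conjQZ [RHS]mxE mulrCA; congr (_ * _); rewrite !conjQM.
    have cg : conjQ (g k) = diag_mx (\row_i expR (chi i h0) ^+ k).
      rewrite /g; elim: (nat_of_ord k) => [|l IHl].
        rewrite expr0 -[1]/1%:M conjQ1; apply/matrixP => a b; rewrite !mxE.
        by rewrite expr0.
      rewrite exprS -[_ * _]/(_ *m _) conjQM IHl conjQ_mexp_el mulmx_diag.
      by congr diag_mx; apply/rowP => a; rewrite !mxE exprS.
    have cgV : conjQ (invmx (g k)) = diag_mx (\row_i (expR (chi i h0) ^+ k)^-1).
      have gu : g k \in unitmx by exact: subgroup_unit (Gg k).
      apply: (row_free_inj (_ : row_free (conjQ (g k)))).
        by rewrite row_free_unit conjQ_unit.
      rewrite -conjQM mulVmx // conjQ1 cg mulmx_diag; apply/matrixP => a b.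
      by rewrite !mxE mulVf // expf_neq0 // gt_eqF ?expR_gt0.
    rewrite cg cgV; move: (conjQ X) => Y.
    by rewrite mul_diag_mx mul_mx_diag !mxE /mu /= expRB expr_div_n; ring.
  by apply: lie_sum => // k; apply: lieZ; apply: lie_conj.
case: (eqVneq (comp c) 0) => [->//|nz].
have [[i j] /eqP eij] : exists p, mu p == c.
  apply: contrapT => N; case/eqP: nz; apply: conjQ_inj; rewrite conj_comp.
  apply/matrixP => i j; rewrite mxE; case: (altP (mu (i, j) =P c)) => [e|_].
    by case: N; exists (i, j); rewrite e.
  by rewrite mulr0 /conjQ mulmx0 mul0mx mxE.
apply: (Lroot _ i j) => //; apply/root_vectorP => k l.
rewrite conj_comp mxE; case: (altP (mu (k, l) =P c)) => [e _|_]; last by rewrite mulr0 eqxx.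
by apply: Hh0; apply: expR_inj; rewrite -/(mu (k, l)) -/(mu (i, j)) eij.
Qed.

(** * The module generated by a flag vector *)

(** The slots with a given label j carry, once each, the coordinates i for which
    chi i z is above some threshold: each label stands for one member of the
    flag of subspaces attached to z. *)
Variables (J : eqType) (iw : 'I_d -> 'I_n) (jw : 'I_d -> J) (z : E).
Hypothesis slot_inj : injective (fun k => (iw k, jw k)).
Hypothesis slot_up : forall k c, chi (iw k) z <= chi c z ->
  exists p, jw p = jw k /\ iw p = c.
Hypothesis Cz : C z.

Notation T := {ffun 'I_d -> 'I_n}.
Notation m := #|{: T}|.

Definition rep (g : 'M[R]_n) : 'M[R]_m := trho d (conjQ g).
Definition drep (X : 'M[R]_n) : 'M[R]_m := tdrho d (conjQ X).
Definition wt (a : 'I_m) (h : E) : R := \sum_l chi ((enum_val a : T) l) h.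
Definition topwt (h : E) : R := \sum_k chi (iw k) h.
Definition topvec : 'rV[R]_m := wedge R iw jw.

(** The vectors obtained from topvec by operators that lower the weight at z:
    acting on the right, a root vector subtracts its root from the weights. *)
Inductive word : 'rV[R]_m -> Prop :=
| word_top : word topvec
| word_step v X i j : word v -> lie_algebra G X -> X != 0 -> root_vector X i j ->
    0 < chi i z - chi j z -> word (v *m drep X).

Lemma drep_el h : drep (el h) = diag_mx (\row_a wt a h).
Proof.
rewrite /drep /conjQ elD tdrho_diag; congr diag_mx; apply/rowP => a; rewrite !mxE.
by apply: eq_bigr => l _; rewrite mxE.
Qed.

Lemma drep_bracket X Y :
  drep X *m drep Y = drep Y *m drep X + drep (lie_bracket X Y).
Proof. by rewrite /drep tdrho_bracket conjQ_bracket. Qed.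

Lemma drepZ c X : drep (c *: X) = c *: drep X.
Proof. by rewrite /drep conjQZ tdrhoZ. Qed.

Lemma drepD X Y : drep (X + Y) = drep X + drep Y.
Proof. by rewrite /drep conjQD tdrhoD. Qed.

Lemma weight_vectorP (v : 'rV[R]_m) (psi : E -> R) :
  (forall h, v *m drep (el h) = psi h *: v) ->
  forall a, v 0 a != 0 -> forall h, wt a h = psi h.
Proof.
move=> H a va h; have /rowP/(_ a) := H h.
by rewrite drep_el mul_mx_diag !mxE mulrC => /(mulIf va).
Qed.

Lemma word_weight v : word v -> exists psi : E -> R,
  [/\ forall h, v *m drep (el h) = psi h *: v, forall x, C x -> psi x <= topwt x &
   v = topvec \/ psi z < topwt z].
Proof.
elim=> [|{}v X i j _ [psi [Hpsi psiC _]] GX X0 HX ij].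
  exists topwt; split => //; last by left.
  move=> h; rewrite drep_el; apply/rowP => a.
  rewrite mul_mx_diagE [in X in _ * X]mxE [RHS]mxE mulrC.
  case: (eqVneq (topvec 0 a) 0) => [->|nz]; first by rewrite !mulr0.
  by congr (_ * _); exact: (wedge_support nz (fun c => chi c h)).
exists (fun h => psi h - (chi i h - chi j h)); split.
- move=> h; rewrite -mulmxA [drep X *m _]drep_bracket mulmxDr mulmxA Hpsi.
  rewrite -scalemxAl scalerBl; congr (_ + _).
  have -> : lie_bracket X (el h) = - (chi i h - chi j h) *: X.
    by rewrite scaleNr -HX /lie_bracket opprB.
  by rewrite drepZ -scalemxAr scaleNr.
- move=> x Cx; have := psiC x Cx; have := hroot GX X0 HX Cz ij Cx; lra.
- by right; have := psiC z Cz; lra.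
Qed.

Lemma topvec_stable X i j : root_vector X i j -> chi i z - chi j z <= 0 ->
  (topvec *m drep X <= topvec)%MS.
Proof.
move=> /root_vectorP HX ij; apply: wedge_tdrho => // k c nz.
by apply: slot_up; have := HX _ _ nz z; lra.
Qed.

(** The span of the words is stable under the whole Lie algebra: moving an
    operator to the left through a word creates shorter words, and at the top
    vector the remaining operators either act by a scalar or lower it. *)
Lemma word_span_stable r (M : 'M[R]_(r, m)) :
  (forall v, word v -> (v <= M)%MS) -> (forall i, word (row i M)) ->
  forall X, lie_algebra G X -> (M *m drep X <= M)%MS.
Proof.
move=> HM HW.
have low X i j : lie_algebra G X -> root_vector X i j -> 0 < chi i z - chi j z ->
    (M *m drep X <= M)%MS.
  move=> GX HX ij; apply/row_subP => k; rewrite row_mul.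
  case: (eqVneq X 0) => [->|X0].
    by rewrite -(scale0r 0) drepZ scale0r mulmx0 sub0mx.
  by apply: HM; exact: word_step.
have key v : word v -> forall X i j, lie_algebra G X -> root_vector X i j ->
    (v *m drep X <= M)%MS.
  elim=> [|{}v Y k l Wv IH GY Y0 HY kl] X i j GX HX.
    case: (lerP (chi i z - chi j z) 0) => ij.
      exact: submx_trans (topvec_stable HX ij) (HM _ word_top).
    exact: submx_trans (submxMr _ (HM _ word_top)) (low _ _ _ GX HX ij).
  rewrite -mulmxA [drep Y *m _]drep_bracket mulmxDr mulmxA addmx_sub //.
    exact: submx_trans (submxMr _ (IH _ _ _ GX HX)) (low _ _ _ GY HY kl).
  pose L Z := (v *m drep Z <= M)%MS.
  apply: (@root_decomposition L); rewrite /L.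
  - by rewrite -(scale0r 0) drepZ scale0r mulmx0 sub0mx.
  - by move=> Z1 Z2 H1 H2; rewrite drepD mulmxDr addmx_sub.
  - by move=> Z a b; exact: IH.
  - exact: lie_bracket_closed.
apply: root_decomposition.
- by rewrite -(scale0r 0) drepZ scale0r mulmx0 sub0mx.
- by move=> Z1 Z2 H1 H2; rewrite drepD mulmxDr addmx_sub.
by move=> X i j GX HX; apply/row_subP => k; rewrite row_mul; exact: key HX.
Qed.

(** The stabiliser of the row space is a closed subgroup which contains the
    exponentials of the Lie algebra, hence is all of the connected group G. *)
Lemma rep_stable r (M : 'M[R]_(r, m)) :
  (forall X, lie_algebra G X -> (M *m drep X <= M)%MS) ->
  forall g, G g -> (M *m rep g <= M)%MS.
Proof.
move=> HM.
pose G' : set 'M[R]_n := [set g | G g /\ (M *m rep g <= M)%MS].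
suff <- : G' = G by move=> g [].
have GU g : G g -> g \in unitmx by exact: subgroup_unit.
have hG' : is_subgroup G'.
  split=> [g [Gg _]|||]; first exact: GU.
  - split; first by case: hG.
    by rewrite /rep conjQ1 trho1 mulmx1.
  - move=> g h [Gg Mg] [Gh Mh]; split; first by case: hG => _ _ GM _; exact: GM.
    by rewrite /rep conjQM trhoM mulmxA; exact: submx_trans (submxMr _ Mg) Mh.
  - move=> g [Gg Mg]; split; first by case: hG => _ _ _; apply.
    have ru : rep g \in unitmx by apply: trho_unit; apply: conjQ_unit; exact: GU.
    have eqM : (M <= M *m rep g)%MS.
      rewrite -(geq_leqif (mxrank_leqif_sup Mg)) mxrankMfree //.
      by rewrite row_free_unit.
    apply: submx_trans (submxMr _ eqM) _.
    rewrite -mulmxA /rep -trhoM -conjQM mulmxV ?conjQ1 ?trho1 ?mulmx1 //; exact: GU.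
have hcG' : rel_closed G'.
  move=> g gu H; split.
    by apply: hGc => // e e0; have [h [[Gh _] hg]] := H e e0; exists h.
  have [c c0 Hc] := trho_lip d (conjQ_unit gu).
  set q := cokermx M; rewrite submxE -/q -normr_le0.
  apply/ler_addgt0Pr => e e0; rewrite add0r.
  pose A := n%:R * n%:R * `|Q| * `|invmx Q|; have A0 : 0 <= A by rewrite !mulr_ge0.
  pose B := m%:R * (m%:R * `|M|) * `|q|; have B0 : 0 <= B by rewrite !mulr_ge0.
  have conjn X : `|conjQ X| <= A * `|X|.
    exact: mx_norm_mul3.
  have cp : 0 < A * c + A * c * B + 1 by rewrite ltr_wpDl // addr_ge0 // !mulr_ge0 // ltW.
  have [|h [[Gh Mh] hg]] := H (Num.min 1 e / (A * c + A * c * B + 1)).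
    by rewrite divr_gt0 // lt_min ltr01.
  move: hg; rewrite ler_pdivlMr // le_min => /andP[h1 he].
  have hg0 : 0 <= `|h - g| by [].
  have hgA : `|conjQ h - conjQ g| <= A * `|h - g| by rewrite -conjQN -conjQD; exact: conjn.
  have Ac0 : 0 <= A * c by rewrite mulr_ge0 // ltW.
  have L1 : `|conjQ h - conjQ g| <= c^-1.
    apply: le_trans hgA _; rewrite -[c^-1]mul1r ler_pdivlMr //.
    apply: le_trans h1; have -> : A * `|h - g| * c = `|h - g| * (A * c) by ring.
    apply: ler_wpM2l => //; rewrite -addrA lerDl addr_ge0 //; exact: mulr_ge0.
  have {}L1 := Hc _ L1.
  have -> : M *m rep g *m q = - (M *m (rep h - rep g) *m q).
    move/eqP: Mh; rewrite submxE -/q => /eqP Mh.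
    by rewrite mulmxBr mulmxBl (eqP Mh) sub0r opprK.
  rewrite normrN; apply: le_trans (mx_norm_mul _ _) _.
  apply: le_trans he.
  apply: (@le_trans _ _ (m%:R * (m%:R * `|M| * (c * (A * `|h - g|))) * `|q|)).
    apply: ler_wpM2r => //; apply: ler_wpM2l => //.
    apply: le_trans (mx_norm_mul _ _) _; apply: ler_wpM2l; first exact: mulr_ge0.
    by apply: le_trans L1 _; apply: ler_wpM2l => //; exact: ltW.
  have -> : m%:R * (m%:R * `|M| * (c * (A * `|h - g|))) * `|q| =
    `|h - g| * (A * c * B) by rewrite /B; ring.
  by apply: ler_wpM2l => //; rewrite [A * c + _]addrC -addrA lerDl addr_ge0.
apply: connected_subgroup_eq => //; first by move=> g [].
apply: closed_subgroup_open => //; first by move=> g [].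
move=> X GX; split; first by rewrite -[X]scale1r; exact: GX.
rewrite /rep conjQ_mexp trho_mexp; apply: mexp_stable; exact: HM.
Qed.

Definition topproj : 'M[R]_m := diag_mx (\row_a (wt a z == topwt z)%:R).

Lemma topvec_proj : topvec *m topproj = topvec.
Proof.
apply/rowP => a; rewrite mul_mx_diagE [in X in _ * X]mxE.
case: (eqVneq (topvec 0 a) 0) => [->|nz]; first by rewrite mul0r.
by rewrite /wt /topwt (wedge_support nz (fun c => chi c z)) eqxx mulr1.
Qed.

(** Every word but topvec has a weight strictly below the top one at z, and
    below it on the whole chamber since roots positive at z are nonnegative
    there.  So the projection topproj on the weights equal to the top one at z
    maps the module to the line of topvec. *)
Lemma flag_module : exists r (M : 'M[R]_(r, m)),
  [/\ row_free M, (topvec <= M)%MS, forall g, G g -> (M *m rep g <= M)%MS,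
    forall i a, M i a != 0 -> forall x, C x -> wt a x <= topwt x &
    (M *m topproj <= topvec)%MS].
Proof.
have [r [M [HW fM HM]]] := span_basis word.
exists r, M; split => //; first exact: HM word_top.
- by apply: rep_stable; exact: word_span_stable.
- move=> i a Ma x Cx; have [psi [H1 H2 _]] := word_weight (HW i).
  by rewrite (weight_vectorP H1) ?mxE //; exact: H2.
apply/row_subP => i; rewrite row_mul.
have [psi [H1 H2 [->|lt]]] := word_weight (HW i).
  by rewrite topvec_proj.
suff -> : row i M *m topproj = 0 by exact: sub0mx.
apply/rowP => a; rewrite mul_mx_diagE [in X in _ * X]mxE [RHS]mxE.
case: (eqVneq (row i M 0 a) 0) => [->|nz]; first by rewrite mul0r.
by rewrite (weight_vectorP H1 nz) lt_eqF // mulr0.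
Qed.

End Module.

(** * Words, Zariski density and traces of powers *)

Section Words.
Variables (F : fieldType) (n : nat).
Implicit Types (S : set 'M[F]_n) (g h : 'M[F]_n).

Lemma word_set0 S : word_set S 0 1.
Proof. by exists (fun=> 1) => [[]|]; rewrite ?big_ord0. Qed.

Lemma word_setD S a b g h :
  word_set S a g -> word_set S b h -> word_set S (a + b) (g *m h).
Proof.
move=> [s Ss ->] [t St ->].
exists (fun i => match fintype.split i with inl j => s j | inr j => t j end).
  by move=> i; case: (fintype.split i).
rewrite big_split_ord /=; congr (_ * _); apply: eq_bigr => i _.
  by rewrite (_ : fintype.split (lshift b i) = inl i) //; exact: (unsplitK (inl i)).
by rewrite (_ : fintype.split (rshift a i) = inr i) //; exact: (unsplitK (inr i)).
Qed.

Lemma word_set1 S g : S g -> word_set S 1 g.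
Proof. by move=> Sg; exists (fun=> g) => //; rewrite big_ord1. Qed.

Lemma word_set_sub S G k g : is_subgroup G -> S `<=` G -> word_set S k g -> G g.
Proof.
move=> [_ G1 GM _] SG [s Ss ->]; apply: (big_ind G) => // i _; exact: SG.
Qed.

End Words.

Section PolynomialFunctions.
Variables (F : fieldType) (n : nat).

Definition polyfun (f : 'M[F]_n -> F) : Prop :=
  exists p : mpoly.mpoly (n * n) F, forall g, poly_at p g = f g.

Lemma polyfun_cst c : polyfun (fun _ => c).
Proof. by exists (mpoly.mpolyC (n * n) c) => g; exact: mpoly.mevalC. Qed.

Lemma polyfun_entry i j : polyfun (fun g => g i j).
Proof.
exists (mpoly.mpolyX F (mpoly.mnm1 (mxvec_index i j))) => g.
by rewrite /poly_at mpoly.mevalXU mxvecE.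
Qed.

Lemma polyfunD f h : polyfun f -> polyfun h -> polyfun (fun g => f g + h g).
Proof.
move=> [p Hp] [q Hq]; eexists => g; rewrite -Hp -Hq; exact: mpoly.mevalD.
Qed.

Lemma polyfunM f h : polyfun f -> polyfun h -> polyfun (fun g => f g * h g).
Proof.
move=> [p Hp] [q Hq]; eexists => g; rewrite -Hp -Hq; exact: mpoly.mevalM.
Qed.

Lemma polyfun_sum (I : Type) (r : seq I) (f : I -> 'M[F]_n -> F) :
  (forall i, polyfun (f i)) -> polyfun (fun g => \sum_(i <- r) f i g).
Proof.
move=> H; elim: r => [|x r IH].
  have [p Hp] := polyfun_cst 0; by exists p => g; rewrite big_nil.
by have [p Hp] := polyfunD (H x) IH; exists p => g; rewrite big_cons.
Qed.

Lemma polyfun_prod (I : Type) (r : seq I) (f : I -> 'M[F]_n -> F) :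
  (forall i, polyfun (f i)) -> polyfun (fun g => \prod_(i <- r) f i g).
Proof.
move=> H; elim: r => [|x r IH].
  have [p Hp] := polyfun_cst 1; by exists p => g; rewrite big_nil.
by have [p Hp] := polyfunM (H x) IH; exists p => g; rewrite big_cons.
Qed.

Lemma eq_polyfun f h : f =1 h -> polyfun f -> polyfun h.
Proof. by move=> e [p Hp]; exists p => g; rewrite Hp e. Qed.

Definition polymap p q (f : 'M[F]_n -> 'M[F]_(p, q)) : Prop :=
  forall i j, polyfun (fun g => f g i j).

Lemma polymap_mul p q r (f : 'M[F]_n -> 'M[F]_(p, q)) (h : 'M[F]_n -> 'M[F]_(q, r)) :
  polymap f -> polymap h -> polymap (fun g => f g *m h g).
Proof.
move=> Hf Hh i j; apply: (@eq_polyfun (fun g => \sum_k f g i k * h g k j)).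
  by move=> g; rewrite mxE.
by apply: polyfun_sum => k; exact: polyfunM.
Qed.

Lemma polymap_cst p q (A : 'M[F]_(p, q)) : polymap (fun _ => A).
Proof. by move=> i j; exact: polyfun_cst. Qed.

Lemma polymap_id : polymap (fun g : 'M[F]_n => g).
Proof. by move=> i j; exact: polyfun_entry. Qed.

(** A closed set is given by any set of polynomials, so all polynomials that
    represent an entry of f can be taken. *)
Lemma zariski_closed_zero p q (f : 'M[F]_n -> 'M[F]_(p, q)) : polymap f ->
  zariski_closed [set g | g \in unitmx /\ f g = 0].
Proof.
move=> Hf; exists [set P | exists i j, forall g, poly_at P g = f g i j].
apply/seteqP; split => g [gu H]; split => //.
  by move=> P [i [j ->]]; rewrite H mxE.
apply/matrixP => i j; rewrite mxE; have [P HP] := Hf i j.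
by rewrite -HP; apply: H; exists i, j.
Qed.

End PolynomialFunctions.

Lemma stable_unit (F : fieldType) p m (M : 'M[F]_(p, m)) (A : 'M[F]_m) :
  A \in unitmx -> (M *m A <= M)%MS -> (M *m invmx A <= M)%MS.
Proof.
move=> Au MA; have eqM : (M <= M *m A)%MS.
  rewrite -(geq_leqif (mxrank_leqif_sup MA)) mxrankMfree //.
  by rewrite row_free_unit.
by apply: submx_trans (submxMr _ eqM) _; rewrite -mulmxA mulmxV ?mulmx1.
Qed.

(** The elements g such that multiplication by rho g preserves the span of the
    operators of the words form an algebraic subgroup.  It contains S, hence by
    density it contains G; applying it to rho 1 gives the operators of G. *)
Lemma density_span (F : fieldType) (n m : nat) (G S : set 'M[F]_n)
    (rho : 'M[F]_n -> 'M[F]_m) : is_subgroup G -> S `<=` G ->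
  zariski_dense G (generated_subgroup S) -> polymap rho ->
  rho 1%:M = 1%:M -> (forall g h, rho (g *m h) = rho g *m rho h) ->
  exists r (B : 'M[F]_(r, m * m)),
    (forall i, exists k f, word_set S k f /\ row i B = mxvec (rho f)) /\
    forall g, G g -> (mxvec (rho g) <= B)%MS.
Proof.
move=> hG SG dense poly rho1 rhoM.
pose P (v : 'rV[F]_(m * m)) := exists k f, word_set S k f /\ v = mxvec (rho f).
have [r [B [HB _ HP]]] := span_basis P.
exists r, B; split => //.
pose L g : 'M[F]_(m * m) := lin_mx (mulmxr (rho g)).
have LM g h : L (g *m h) = L g *m L h.
  apply/row_matrixP => i; rewrite !rowE -[delta_mx 0 i]vec_mxK mulmxA !mul_vec_lin /=.
  by rewrite rhoM mulmxA.
have L1 : L 1%:M = 1%:M.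
  apply/row_matrixP => i; rewrite !rowE -[delta_mx 0 i]vec_mxK !mul_vec_lin /=.
  by rewrite rho1 mulmx1 mulmx1.
have LU g : g \in unitmx -> L g \in unitmx.
  by move=> gu; have [] := mulmx1_unit (etrans (esym (LM g (invmx g))) (etrans (congr1 L (mulmxV gu)) L1)).
have LV g : g \in unitmx -> L (invmx g) = invmx (L g).
  move=> gu; apply: (row_free_inj (_ : row_free (L g))); first by rewrite row_free_unit LU.
  by rewrite -LM !mulVmx ?LU.
pose Z : set 'M[F]_n := [set g | g \in unitmx /\ B *m L g *m cokermx B = 0].
have ZP g : Z g <-> g \in unitmx /\ (B *m L g <= B)%MS.
  by rewrite submxE; split => -[gu /eqP].
have hZ : is_subgroup Z.
  split=> [g []//|||].
  - by apply/ZP; rewrite unitmx1 L1 mulmx1.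
  - move=> g h /ZP[gu Bg] /ZP[hu Bh]; apply/ZP; rewrite unitmx_mul gu; split => //.
    by rewrite LM mulmxA; exact: submx_trans (submxMr _ Bg) Bh.
  - move=> g /ZP[gu Bg]; apply/ZP; rewrite unitmx_inv; split => //.
    by rewrite LV //; apply: stable_unit => //; exact: LU.
have cZ : zariski_closed Z.
  have polyL : polymap L.
    move=> i j; case/mxvec_indexP: j => k l.
    apply: (@eq_polyfun _ _ (fun g => (vec_mx (delta_mx 0 i) *m rho g) k l)).
      by move=> g; rewrite [RHS]mxE /= mxvecE.
    by apply: polymap_mul; [exact: polymap_cst|exact: poly].
  apply: (@zariski_closed_zero _ _ _ _ (fun g => B *m L g *m cokermx B)).
  apply: polymap_mul; last exact: polymap_cst.
  by apply: polymap_mul; [exact: polymap_cst|].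
have SZ : S `<=` Z.
  move=> g Sg; have gu : g \in unitmx by case: hG => GU _ _ _; exact: GU (SG g Sg).
  apply/ZP; split => //; apply/row_subP => i; rewrite row_mul.
  have [k [f [kf ->]]] := HB i; rewrite mul_vec_lin /= -rhoM.
  by apply: HP; exists (k + 1)%N, (f *m g); split => //; apply: word_setD => //; exact: word_set1.
have GZ : G `<=` Z.
  have E : G `&` Z = G.
    apply: dense; first by split.
    by move=> g gg; split; [exact: (gg G)|exact: (gg Z)].
  by rewrite -E => g [].
move=> g /GZ/ZP[_ Bg].
have one : (mxvec (rho 1%:M) <= B)%MS.
  by apply: HP; exists 0%N, 1%:M; split => //; exact: word_set0.
have -> : mxvec (rho g) = mxvec (rho 1%:M) *m L g by rewrite mul_vec_lin /= -rhoM mul1mx.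
exact: submx_trans (submxMr _ one) Bg.
Qed.

(** Some complex eigenvalue has modulus at least that of the trace divided by r,
    and its k-th power is an eigenvalue of A^k. *)
Lemma trace_power (R : realType) r (A : 'M[R]_r) k : (0 < r)%N ->
  `|\tr A| ^+ k <= r%:R ^+ k * (r%:R * `|A ^+ k|).
Proof.
move=> r0.
have normC (x : R) : `|real_complex R x| = real_complex R `|x|.
  have [x0|x0] := lerP 0 x.
    by rewrite [in RHS]ger0_norm // ger0_norm // ler0c.
  by rewrite [in RHS](ltr0_norm x0) rmorphN ler0_norm // lecR ltW.
have leC (x y : R) : (real_complex R x <= real_complex R y) = (x <= y) by rewrite lecR.
pose Ac := map_mx (real_complex R) A.
have [s Hs] := closed_field_poly_normal (char_poly Ac).
have mon : char_poly Ac \is monic by exact: char_poly_monic.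
rewrite (monicP mon) scale1r in Hs.
have szs : size s = r.
  by have := size_char_poly Ac; rewrite Hs size_prod_XsubC => -[].
have trs : real_complex R (\tr A) = \sum_(a <- s) a.
  rewrite -[LHS]trace_map_mx -/Ac; apply: oppr_inj; rewrite -char_poly_trace // Hs.
  by rewrite -szs coefPn_prod_XsubC // szs -lt0n.
have [a sa ha] : exists2 a, a \in s & `|real_complex R (\tr A)| <= r%:R * `|a|.
  apply: contrapT => N.
  have H a : a \in s -> r%:R * `|a| < `|real_complex R (\tr A)|.
    move=> sa; rewrite real_ltNge ?normr_real ?realM ?realn ?normr_real //.
    by apply/negP => ha; apply: N; exists a.
  have : \sum_(a <- s) r%:R * `|a| < \sum_(a <- s) `|real_complex R (\tr A)|.
    have gen (s' : seq R[i]) : (0 < size s')%N ->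
        (forall b, b \in s' -> r%:R * `|b| < `|real_complex R (\tr A)|) ->
        \sum_(b <- s') r%:R * `|b| < \sum_(b <- s') `|real_complex R (\tr A)|.
      elim: s' => [//|b s' IH] _ Hs'; rewrite !big_cons.
      have Hb := Hs' b (mem_head _ _).
      case: s' IH Hs' => [|b' s'] IH Hs'; first by rewrite !big_nil !addr0.
      by apply: ltrD => //; apply: IH => // b0 b0s; apply: Hs'; rewrite inE b0s orbT.
    by apply: gen; rewrite ?szs.
  rewrite -mulr_sumr big_const_seq count_predT szs iter_addr_0 -[X in _ < X]mulr_natl.
  rewrite ltr_pM2l ?ltr0n // trs; apply/negP; rewrite -real_leNgt ?normr_real //.
    exact: ler_norm_sum.
  by apply: sum_real => b _; exact: normr_real.
have : eigenvalue Ac a by rewrite eigenvalue_root_char Hs root_prod_XsubC.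
move=> /eigenvalueP[v vA v0].
have vAk : v *m Ac ^+ k = a ^+ k *: v.
  elim: k => [|l IH]; first by rewrite !expr0 scale1r -[_ *m 1]/(_ *m 1%:M) mulmx1.
  by rewrite exprS -[Ac * _]/(Ac *m _) mulmxA vA -scalemxAl IH scalerA exprS.
have [j vj] : exists j, forall i, `|v 0 i| <= `|v 0 j|.
  pose nv i := Num.sqrt ((complex.Re (v 0 i)) ^+ 2 + (complex.Im (v 0 i)) ^+ 2).
  exists [arg max_(i > Ordinal r0) nv i]%O; case: arg_maxP => // j _ Hj i.
  by rewrite !normc_def lecR; exact: Hj.
have vj0 : 0 < `|v 0 j|.
  rewrite normr_gt0; apply: contraNneq v0 => vj0; apply/eqP/rowP => i; rewrite mxE.
  by apply/eqP; rewrite -normr_le0; have := vj i; rewrite vj0 normr0.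
have ak : `|a| ^+ k <= r%:R * real_complex R `|A ^+ k|.
  rewrite -(ler_pM2r vj0) -normrX -normrM.
  have /rowP/(_ j) := vAk; rewrite !mxE => <-.
  apply: le_trans (ler_norm_sum _ _ _) _.
  have -> : r%:R * real_complex R `|A ^+ k| * `|v 0 j| = \sum_(i < r) real_complex R `|A ^+ k| * `|v 0 j|.
    by rewrite sumr_const card_ord -mulrA mulr_natl.
  apply: ler_sum => i _; rewrite normrM mulrC ler_pM //.
  rewrite -[Ac ^+ k]/((map_mx (real_complex R) A) ^+ k).
  have -> : map_mx (real_complex R) A ^+ k = map_mx (real_complex R) (A ^+ k).
    elim: k {vAk} => [|l IH]; first by rewrite !expr0 -[1]/1%:M map_mx1.
    by rewrite !exprS -[A * _]/(A *m _) map_mxM -IH.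
  by rewrite mxE normC leC entry_le_norm.
rewrite -leC rmorphXn /= -normC !rmorphM rmorphXn !rmorph_nat.
apply: (@le_trans _ _ ((r%:R * `|a|) ^+ k)).
  by rewrite lerXn2r ?nnegrE ?mulr_ge0.
by rewrite exprMn ler_wpM2l ?exprn_ge0.
Qed.

Lemma trho_norm (R : realType) n d (g : 'M[R]_n) : `|trho d g| <= `|g| ^+ d.
Proof.
apply/mx_norm_leP => [|a b]; first exact: exprn_ge0.
rewrite mxE normr_prod -[X in _ ^+ X]card_ord -prodr_const.
by apply: ler_prod => l _; rewrite normr_ge0 entry_le_norm.
Qed.

(** * The representation attached to a flag *)

Lemma trace_rank1 (F : fieldType) r (X Y Z : 'M[F]_r) (u : 'cV[F]_r) (w : 'rV[F]_r) :
  \tr (X *m (Y *m (u *m w) *m Z)) = \tr (w *m (Z *m X *m Y) *m u).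
Proof. by rewrite !mulmxA -(mulmxA _ w Z) mxtrace_mulC !mulmxA. Qed.

Section FlagRep.
Variables (R : realType) (n d : nat) (G : set 'M[R]_n).
Hypothesis hG : is_subgroup G.
Hypothesis hGc : rel_closed G.
Hypothesis hGconn : connected G.
Variables (E : lmodType R) (el : E -> 'M[R]_n) (Q : 'M[R]_n) (chi : 'I_n -> E -> R).
Hypothesis Qu : Q \in unitmx.
Hypothesis elG : forall h, lie_algebra G (el h).
Hypothesis elD : forall h, Q *m el h *m invmx Q = diag_mx (\row_i chi i h).
Hypothesis chiL : forall i c x y, chi i (c *: x + y) = c * chi i x + chi i y.
Variable C : set E.
Hypothesis hroot : forall X i j, lie_algebra G X -> X != 0 -> root_vector el chi X i j ->
  forall z, C z -> 0 < chi i z - chi j z -> forall x, C x -> 0 <= chi i x - chi j x.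
Variables (J : eqType) (iw : 'I_d -> 'I_n) (jw : 'I_d -> J) (z : E).
Hypothesis slot_inj : injective (fun k => (iw k, jw k)).
Hypothesis slot_up : forall k c, chi (iw k) z <= chi c z ->
  exists p, jw p = jw k /\ iw p = c.
Hypothesis Cz : C z.
Variable S : set 'M[R]_n.
Hypothesis SG : S `<=` G.
Hypothesis Sdense : zariski_dense G (generated_subgroup S).

(** A Cartan decomposition up to bounded factors: k1 and k2 range over a bounded
    part of G and not over a compact subgroup. *)
Definition kak (K : R) (g : 'M[R]_n) (x : E) : Prop := exists k1 k2,
  [/\ G k1 /\ G k2, `|k1| <= K /\ `|invmx k1| <= K,
      `|k2| <= K /\ `|invmx k2| <= K & g = k1 *m mexp (el x) *m k2].

Notation m := #|{: {ffun 'I_d -> 'I_n}}|.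
Notation rho := (rep d Q).
Notation theta := (topwt chi iw).
Notation t := (topvec R iw jw).
Notation proj := (topproj chi iw z).

Lemma rhoM g h : rho (g *m h) = rho g *m rho h.
Proof. by rewrite /rep conjQM // trhoM. Qed.

Lemma rho1 : rho 1%:M = 1%:M.
Proof. by rewrite /rep conjQ1 // trho1. Qed.

Lemma rho_mexp_el h : rho (mexp (el h)) = diag_mx (\row_a expR (wt chi a h)).
Proof.
rewrite /rep (conjQ_mexp_el Qu elD) trho_diag; congr diag_mx; apply/rowP => a.
by rewrite !mxE /wt expR_sum; apply: eq_bigr => l _; rewrite mxE.
Qed.

Lemma rho_norm K : exists2 c : R, 0 <= c & forall k, `|k| <= K -> `|rho k| <= c.
Proof.
exists ((n%:R * n%:R * `|Q| * `|invmx Q| * `|K|) ^+ d).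
  by rewrite exprn_ge0 // !mulr_ge0.
move=> k kK; apply: le_trans (trho_norm _ _) _.
rewrite lerXn2r ?nnegrE ?mulr_ge0 //.
apply: le_trans (mx_norm_mul3 _ _ _) _; rewrite ler_wpM2l ?mulr_ge0 //.
exact: le_trans kK (ler_norm _).
Qed.

Lemma polymap_rho : polymap rho.
Proof.
move=> a b; apply: (@eq_polyfun _ _ (fun g => \prod_l (Q *m g *m invmx Q)
   ((enum_val a : {ffun 'I_d -> 'I_n}) l) ((enum_val b : {ffun 'I_d -> 'I_n}) l))).
  by move=> g; rewrite mxE.
apply: polyfun_prod => l; suff H : polymap (fun g => Q *m g *m invmx Q) by exact: H.
apply: polymap_mul; last exact: polymap_cst.
by apply: polymap_mul; [exact: polymap_cst|exact: polymap_id].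
Qed.

Lemma t_mexp h : t *m rho (mexp (el h)) = expR (theta h) *: t.
Proof.
rewrite rho_mexp_el; apply/rowP => a; rewrite mul_mx_diagE [in X in _ * X]mxE [RHS]mxE mulrC.
case: (eqVneq (t 0 a) 0) => [->|nz]; first by rewrite !mulr0.
by rewrite /wt /topwt (wedge_support nz (fun c => chi c h)).
Qed.

(** Interpolation at the eigenvalues of exp z; in this way the projection on the
    top weights lies in the span of the operators of G. *)
Lemma proj_poly : exists q : {poly R},
  proj = \sum_(k < size q) q`_k *: rho (mexp (el z) ^+ k).
Proof.
have [q Hq] := indicator_poly [seq expR (wt chi a z) | a <- enum 'I_m] (expR (theta z)).
exists q; apply/matrixP => a b; rewrite summxE.
have powr k : rho (mexp (el z) ^+ k) = diag_mx (\row_a expR (wt chi a z) ^+ k).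
  elim: k => [|k IH].
    by rewrite expr0 -[1]/1%:M rho1; apply/matrixP => c e; rewrite !mxE expr0.
  rewrite exprS -[_ * _]/(_ *m _) rhoM IH rho_mexp_el mulmx_diag; congr diag_mx.
  by apply/rowP => c; rewrite !mxE exprS.
under eq_bigr do rewrite powr mxE mxE mxE.
rewrite mxE mxE; case: (altP (a =P b)) => [->|_]; last first.
  by rewrite mulr0n big1 // => k _; rewrite mulr0n mulr0.
rewrite mulr1n; under eq_bigr do rewrite mulr1n.
rewrite -horner_coef Hq; last by apply: map_f; rewrite mem_enum.
by rewrite (inj_eq (@expR_inj R)).
Qed.

(** If g = k1 exp x k2, the trace of
    beta g * beta k2^-1 * proj * beta k1^-1 is the coefficient exp (theta x) of
    exp x on the top line.  By density_span, the product of the last three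
    factors is a bounded combination of the operators of finitely many words f,
    so one of the traces of beta (g f) is comparable to exp (theta x). *)
Theorem flag_rep (K : R) : exists r (beta : 'M[R]_n -> 'M[R]_r) (c : R)
    s (l : 'I_s -> nat) (f : 'I_s -> 'M[R]_n),
  [/\ (0 < r)%N /\ 0 < c, forall i, word_set S (l i) (f i),
    forall g h, G g -> G h -> beta (g *m h) = beta g *m beta h &
    forall g x, C x -> kak K g x ->
      [/\ `|beta g| <= c * expR (theta x), expR (theta x) <= c * `|beta g| &
        exists i, expR (theta x) <= c * `|\tr (beta (g *m f i))|]].
Proof.
have [r [M [fM tM MG MC Mproj]]] :
  exists r (M : 'M[R]_(r, m)),
  [/\ row_free M, (t <= M)%MS, forall g, G g -> (M *m rho g <= M)%MS,
    forall i a, M i a != 0 -> forall x, C x -> wt chi a x <= theta x &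
    (M *m proj <= t)%MS].
  exact: (flag_module hG hGc hGconn Qu elG elD chiL hroot slot_inj slot_up Cz).
have [s [B [HB BG]]] := density_span hG SG Sdense polymap_rho rho1 rhoM.
pose bet (A : 'M[R]_m) := M *m A *m pinvmx M.
pose beta g := bet (rho g).
have betE A : (M *m A <= M)%MS -> bet A *m M = M *m A by move=> H; exact: mulmxKpV.
have MV : M *m pinvmx M = 1%:M by exact: mulmxVp.
have betM A1 A2 : (M *m A1 <= M)%MS -> bet (A1 *m A2) = bet A1 *m bet A2.
  by move=> H; rewrite {3}/bet !mulmxA betE // /bet !mulmxA.
have betaM g h : G g -> G h -> beta (g *m h) = beta g *m beta h.
  by move=> Gg Gh; rewrite /beta rhoM betM //; exact: MG.
have t0 : t != 0 by exact: wedge_neq0.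
have r0 : (0 < r)%N.
  by have := mxrankS tM; rewrite rank_rV t0 => /leq_trans; apply; exact: rank_leq_row.
have GM g h : G g -> G h -> G (g *m h) by case: hG => _ _ + _; apply.
have GV g : G g -> G (invmx g) by case: hG => _ _ _; apply.
have GU g : G g -> g \in unitmx by exact: subgroup_unit.
have Gexp x : G (mexp (el x)) by rewrite -[el x]scale1r; exact: elG.
(* In the coordinates given by the rows of M, the top vector is W and the
   projection on its line is U *m W, a matrix of rank one. *)
pose W := t *m pinvmx M.
have WM : W *m M = t by exact: mulmxKpV.
pose U := M *m proj *m pinvmx t.
have Ut : U *m t = M *m proj by exact: mulmxKpV.
have WU : W *m U = 1%:M.
  apply: (row_free_inj (_ : row_free t)).
    by rewrite /row_free rank_rV t0.
  by rewrite -mulmxA Ut mulmxA WM mul1mx topvec_proj.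
have betproj : bet proj = U *m W.
  by rewrite /bet -Ut -mulmxA.
have projS : (M *m proj <= M)%MS by exact: submx_trans Mproj tM.
pose cc k1 k2 := rho (invmx k2) *m proj *m rho (invmx k1).
have trE g x k1 k2 : G k1 -> G k2 -> g = k1 *m mexp (el x) *m k2 ->
    \tr (beta g *m bet (cc k1 k2)) = expR (theta x).
  move=> G1 G2 gE; have Gg : G g by rewrite gE; apply: GM (GM _ _ _ _) _.
  have -> : bet (cc k1 k2) = beta (invmx k2) *m bet proj *m beta (invmx k1).
    rewrite /cc -mulmxA betM; last exact: MG (GV _ G2).
    by rewrite betM // mulmxA.
  rewrite betproj trace_rank1.
  rewrite -(betaM _ _ (GV _ G1) Gg) -betaM; [|exact: GM (GV _ G1) Gg|exact: GV].
  have -> : invmx k1 *m g *m invmx k2 = mexp (el x).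
    by rewrite gE -!mulmxA mulmxV ?GU // mulmx1 mulmxA mulVmx ?GU // mul1mx.
  have -> : W *m beta (mexp (el x)) = expR (theta x) *: W.
    apply: (row_free_inj fM); rewrite -mulmxA betE; last exact: MG.
    by rewrite mulmxA WM t_mexp -scalemxAl WM.
  by rewrite -scalemxAl WU mxtraceZ mxtrace1 mulr1.
have [cK cK0 HK] := rho_norm K.
pose cC := m%:R * m%:R * cK * cK * `|proj|.
have ccB k1 k2 : `|invmx k1| <= K -> `|invmx k2| <= K -> `|cc k1 k2| <= cC.
  move=> H1 H2; apply: le_trans (mx_norm_mul3 _ _ _) _; rewrite /cC ler_wpM2r //.
  by rewrite -!mulrA; do 2! apply: ler_wpM2l => //; apply: ler_pM => //; exact: HK.
have cC0 : 0 <= cC by rewrite !mulr_ge0.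
pose nb := m%:R * m%:R * `|M| * `|pinvmx M|.
have betN A : `|bet A| <= nb * `|A| by exact: mx_norm_mul3.
have nb0 : 0 <= nb by rewrite !mulr_ge0.
have trN (A : 'M[R]_r) : `|\tr A| <= r%:R * `|A|.
  apply: le_trans (ler_norm_sum _ _ _) _; apply: sum_le_card => i.
  exact: entry_le_norm.
have /choice[ki /choice[fi Hfi]] := HB.
pose cg := (m * m)%:R * cC * `|pinvmx B|.
have cg0 : 0 <= cg by rewrite !mulr_ge0.
have ccspan k1 k2 : G k1 -> G k2 -> `|invmx k1| <= K -> `|invmx k2| <= K ->
    exists ga : 'rV[R]_s, `|ga| <= cg /\ cc k1 k2 = \sum_i ga 0 i *: rho (fi i).
  move=> G1 G2 H1 H2; exists (mxvec (cc k1 k2) *m pinvmx B); split.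
    apply: le_trans (mx_norm_mul _ _) _; rewrite /cg ler_wpM2r // ler_wpM2l //.
    apply/mx_norm_leP => // i j; rewrite ord1; case/mxvec_indexP: j => a b.
    by rewrite mxvecE; apply: le_trans (entry_le_norm _ _ _) (ccB _ _ H1 H2).
  apply: (can_inj mxvecK); rewrite linear_sum /=.
  have ccB' : (mxvec (cc k1 k2) <= B)%MS.
    have [q qE] := proj_poly; rewrite /cc qE mulmx_sumr mulmx_suml linear_sum /=.
    apply: summx_sub => k _; rewrite -scalemxAr -scalemxAl linearZ scalemx_sub //=.
    rewrite -!rhoM; apply: BG.
    exact: (GM _ _ (GM _ _ (GV _ G2) (subgroupX k hG (Gexp z))) (GV _ G1)).
  rewrite -[LHS](mulmxKpV ccB') [LHS]mulmx_sum_row; apply: eq_bigr => i _.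
  by rewrite linearZ /=; have [_ ->] := Hfi i.
pose c1 := r%:R * m%:R * (nb * cK) * (m%:R * cK * `|pinvmx M|) * `|M|.
pose c2 := r%:R * (r%:R * (nb * cC)).
pose c3 := s%:R * cg + 1.
have [c10 c20 c30] : [/\ 0 <= c1, 0 <= c2 & 0 < c3].
  by rewrite /c3 ltr_wpDl // !mulr_ge0.
pose c := c1 + c2 + c3.
exists r, beta, c, s, ki, fi; split => //.
- by split => //; rewrite /c ltr_wpDl // addr_ge0.
- by move=> i; case: (Hfi i).
move=> g x Cx [k1 [k2 [[G1 G2] [K1 K1'] [K2 K2'] gE]]].
have e0 := expR_gt0 (theta x); set e := expR _ in e0 *.
have Gg : G g by rewrite gE; apply: GM (GM _ _ _ _) _.
split.
- apply: (@le_trans _ _ (c1 * e)); last first.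
    by rewrite ler_wpM2r ?(ltW e0) // /c -addrA lerDl addr_ge0 // ltW.
  have -> : beta g = beta k1 *m (M *m rho (mexp (el x))) *m (rho k2 *m pinvmx M).
    rewrite [_ *m (M *m _)]mulmxA betE; last exact: MG.
    by rewrite /beta /bet gE !rhoM !mulmxA.
  apply: le_trans (mx_norm_mul3 _ _ _) _.
  have L1 : `|beta k1| <= nb * cK.
    by apply: le_trans (betN _) _; rewrite ler_wpM2l //; exact: HK.
  have L2 : `|rho k2 *m pinvmx M| <= m%:R * cK * `|pinvmx M|.
    apply: le_trans (mx_norm_mul _ _) _; rewrite ler_wpM2r // ler_wpM2l //.
    exact: HK.
  have L3 : `|M *m rho (mexp (el x))| <= `|M| * e.
    apply/mx_norm_leP => [|i a]; first by rewrite mulr_ge0 // ltW.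
    rewrite rho_mexp_el mul_mx_diagE [in X in _ * X]mxE normrM.
    case: (eqVneq (M i a) 0) => [->|nz].
      by rewrite normr0 mul0r mulr_ge0 // ltW.
    apply: ler_pM => //; first exact: entry_le_norm.
    by rewrite gtr0_norm ?expR_gt0 // ler_expR; exact: MC nz x Cx.
  have r00 : 0 <= r%:R * m%:R :> R by rewrite mulr_ge0.
  rewrite /c1 -[leRHS]mulrA; apply: ler_pM => //.
  apply: ler_pM => //.
  by apply: ler_wpM2l.
- apply: (@le_trans _ _ (c2 * `|beta g|)); last first.
    by rewrite ler_wpM2r // /c [c1 + c2]addrC -addrA lerDl addr_ge0 // ltW.
  rewrite -[e](trE g x k1 k2) //; apply: le_trans (ler_norm _) _.
  apply: le_trans (trN _) _; rewrite /c2 -[leRHS]mulrA ler_wpM2l //.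
  apply: le_trans (mx_norm_mul _ _) _; rewrite -[leRHS]mulrA -[leLHS]mulrA ler_wpM2l //.
  rewrite mulrC ler_wpM2r //.
  by apply: le_trans (betN _) _; rewrite ler_wpM2l //; exact: ccB.
have [ga [gaB gaE]] := ccspan k1 k2 G1 G2 K1' K2'.
have trS : e = \sum_i ga 0 i * \tr (beta (g *m fi i)).
  have bet_sum : bet (\sum_i ga 0 i *: rho (fi i)) = \sum_i ga 0 i *: beta (fi i).
    rewrite /bet mulmx_sumr mulmx_suml; apply: eq_bigr => i _.
    by rewrite -scalemxAr -scalemxAl.
  rewrite -[LHS](trE g x k1 k2) // gaE bet_sum mulmx_sumr raddf_sum /=.
  apply: eq_bigr => i _; rewrite -scalemxAr mxtraceZ; congr (_ * \tr _).
  rewrite betaM //.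
  by have [kf _] := Hfi i; exact: (word_set_sub hG SG kf).
have [i Hi] : exists i, e <= c3 * `|\tr (beta (g *m fi i))|.
  apply: contrapT => N.
  have Hlt i : c3 * `|\tr (beta (g *m fi i))| < e.
    by rewrite ltNge; apply/negP => H; apply: N; exists i.
  suff : e <= s%:R * (cg * (e / c3)).
    have -> : s%:R * (cg * (e / c3)) = e * (s%:R * cg / c3) by ring.
    apply/negP; rewrite -ltNge gtr_pMr // ltr_pdivrMr // mul1r /c3 ltrDl //.
  rewrite {1}trS; apply: le_trans (ler_norm _) _.
  apply: le_trans (ler_norm_sum _ _ _) _; apply: sum_le_card => i.
  rewrite normrM; apply: ler_pM => //.
    by apply: le_trans gaB; exact: entry_le_norm.
  by rewrite ler_pdivlMr // mulrC; exact: ltW.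
exists i; apply: le_trans Hi _; rewrite ler_wpM2r // /c lerDr addr_ge0 //.
Qed.

End FlagRep.

(** * Cartan projections of powers *)

(** Removing the smallest positive value of a, repeatedly, writes the sum as a
    combination of the sums of w over the superlevel sets of a, with
    nonnegative coefficients of total mass at most A. *)
Lemma layer_cake_ge0 (R : realFieldType) (I : finType) (a w : I -> R) (A e : R) :
  0 <= e -> 0 <= A -> (forall i, 0 <= a i <= A) ->
  (forall j, 0 < a j -> \sum_(i | a j <= a i) w i <= e) ->
  \sum_i a i * w i <= A * e.
Proof.
move=> e0; have [p] := ubnP #|[pred i | 0 < a i]|.
elim: p a A => // p IH a A; rewrite ltnS => sp A0 aA H.
case: (pickP [pred i | 0 < a i]) => [j0 /= j0P|none]; last first.
  have a0 i : a i = 0.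
    by have /= := none i; have /andP[] := aA i; rewrite le0r => /orP[/eqP|->].
  by rewrite big1 => [|i _]; rewrite ?a0 ?mul0r // mulr_ge0.
case: (@arg_minP _ R I j0 [pred i | 0 < a i] a j0P) => j /= jP jmin.
pose mn := a j; pose a' i := if 0 < a i then a i - mn else 0.
have mn0 : 0 < mn by [].
have step : \sum_i a i * w i = \sum_i a' i * w i + mn * \sum_(i | mn <= a i) w i.
  rewrite [X in _ + _ * X]big_mkcond mulr_sumr -big_split; apply: eq_bigr => i _ /=.
  rewrite /a'; case: ifP => ai; first by rewrite (jmin i) //; ring.
  have a0 : a i = 0.
    by move: ai; have /andP[] := aA i; rewrite le0r => /orP[/eqP|->].
  by rewrite a0 leNgt mn0 /= !mul0r mulr0 addr0.
rewrite step; have -> : A * e = (A - mn) * e + mn * e by ring.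
apply: lerD; last by rewrite ler_pM2l //; exact: H.
apply: IH.
- apply: leq_trans sp; apply: proper_card; apply/properP; split.
    apply/fintype.subsetP => i; rewrite !inE /a'; case: ifP => //; by rewrite ltxx.
  by exists j; rewrite !inE /a' ?jP // -/mn subrr ltxx.
- by rewrite subr_ge0; have /andP[] := aA j.
- move=> i; rewrite /a'; have /andP[a1 a2] := aA i; case: ifP => ai.
    by rewrite subr_ge0 jmin //= lerD2r.
  by rewrite lexx subr_ge0 /=; have /andP[] := aA j.
- move=> k; rewrite {1}/a'; case: ifP => ak; last by rewrite ltxx.
  rewrite subr_gt0 => mk; apply: le_trans (H k ak).
  rewrite le_eqVlt; apply/orP; left; apply/eqP; apply: eq_bigl => i.
  rewrite /a' ak; case: ifP => ai; first by rewrite lerD2r.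
  have a0 : a i = 0.
    by move: ai; have /andP[] := aA i; rewrite le0r => /orP[/eqP|->].
  by rewrite a0 subr_le0 !leNgt mk ak.
Qed.

(** The coefficients are made nonnegative by adding A to them, at the cost
    of A times the total sum of w. *)
Lemma layer_cake (R : realFieldType) (I : finType) (a w : I -> R) (A e : R) :
  0 <= e -> 0 <= A -> (forall i, `|a i| <= A) ->
  (forall j, \sum_(i | a j <= a i) w i <= e) -> - e <= \sum_i w i ->
  \sum_i a i * w i <= 3 * A * e.
Proof.
move=> e0 A0 aA H Hw.
have : \sum_i (a i + A) * w i <= (2 * A) * e.
  apply: layer_cake_ge0 => //; first by rewrite mulr_ge0.
    by move=> i; have := aA i; rewrite ler_norml => /andP[h1 h2]; apply/andP; split; lra.
  move=> j _; apply: le_trans (H j); rewrite le_eqVlt; apply/orP; left; apply/eqP.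
  by apply: eq_bigl => i; rewrite lerD2r.
under eq_bigr do rewrite mulrDl.
rewrite big_split -mulr_sumr /= => H1.
have : A * - e <= A * \sum_i w i by rewrite ler_wpM2l.
lra.
Qed.

Lemma half_bound (R : realFieldType) (L s q : R) : 12 * L <= s * q -> 6 * L <= q * (s / 2).
Proof. lra. Qed.

Lemma quadratic_bound (R : realFieldType) (b e q t : R) : 0 <= b -> 0 < e -> 0 < q ->
  0 <= t -> q * (2 * b + e) = e ^+ 2 / 2 -> t ^+ 2 <= q * (2 * b + t) -> t <= e.
Proof.
move=> b0 e0 q0 t0 qE tq; have be0 : 0 < 2 * b + e by lra.
have qe : q <= e / 2.
  rewrite -(ler_pM2r be0) qE expr2.
  have : 0 <= e * b by rewrite mulr_ge0 // ltW.
  lra.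
rewrite leNgt; apply/negP => et.
have : t * (t - e) > 0 by rewrite mulr_gt0 ?subr_gt0 //; apply: lt_trans et.
have : e * (t - e) > 0 by rewrite mulr_gt0 ?subr_gt0.
have : t * q <= t * (e / 2) by rewrite ler_wpM2l.
have : 0 <= e * q by rewrite mulr_ge0 // ltW.
move: qE tq; rewrite !expr2; lra.
Qed.

Section MainEstimate.
Variables (R : realType) (n : nat) (G : set 'M[R]_n).
Hypothesis hG : is_subgroup G.
Hypothesis hGc : rel_closed G.
Hypothesis hGconn : connected G.
Variables (E : lmodType R) (el : E -> 'M[R]_n) (Q : 'M[R]_n) (chi : 'I_n -> E -> R).
Hypothesis Qu : Q \in unitmx.
Hypothesis elG : forall h, lie_algebra G (el h).
Hypothesis elD : forall h, Q *m el h *m invmx Q = diag_mx (\row_i chi i h).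
Hypothesis chiL : forall i c x y, chi i (c *: x + y) = c * chi i x + chi i y.
Variable C : set E.
Hypothesis hroot : forall X i j, lie_algebra G X -> X != 0 -> root_vector el chi X i j ->
  forall z, C z -> 0 < chi i z - chi j z -> forall x, C x -> 0 <= chi i x - chi j x.
Hypothesis Ccone : forall (c : R) x, 0 <= c -> C x -> C (c *: x).
Variable S : set 'M[R]_n.
Hypothesis SG : S `<=` G.
Hypothesis Sdense : zariski_dense G (generated_subgroup S).
Variables (K : R) (kap : 'M[R]_n -> E).
Hypothesis kapC : forall g, G g -> C (kap g).
Hypothesis kapE : forall g, G g -> kak G el K g (kap g).

Lemma chi0 i : chi i 0 = 0.
Proof. by have := chiL i 1 0 0; rewrite scaler0 addr0 mul1r; lra. Qed.

Lemma chiZ i c x : chi i (c *: x) = c * chi i x.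
Proof. by rewrite -[c *: x]addr0 chiL chi0 addr0. Qed.

Lemma chiB i x y : chi i (x - y) = chi i x - chi i y.
Proof. by rewrite addrC -scaleN1r chiL mulN1r addrC. Qed.

Definition layer (z : E) (j : 'I_n) : {set 'I_n} := finset (fun i => chi j z <= chi i z).
Definition sumwt (I : {set 'I_n}) (h : E) : R := \sum_(i in I) chi i h.

Lemma sumwtZ I c x : sumwt I (c *: x) = c * sumwt I x.
Proof. by rewrite /sumwt mulr_sumr; apply: eq_bigr => i _; exact: chiZ. Qed.

Lemma sumwtB I x y : sumwt I (x - y) = sumwt I x - sumwt I y.
Proof. by rewrite /sumwt -sumrB; apply: eq_bigr => i _; exact: chiB. Qed.

Lemma power_norm r (A : 'M[R]_r) k : `|A ^+ k| <= (r%:R * `|A|) ^+ k.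
Proof.
apply: norm_rowle; first by rewrite exprn_ge0 // mulr_ge0.
by apply: rowleX; [rewrite mulr_ge0|exact: rowle_norm].
Qed.

Lemma betaX r (beta : 'M[R]_n -> 'M[R]_r) : (forall g h, G g -> G h ->
  beta (g *m h) = beta g *m beta h) -> forall g k, G g ->
  beta (g ^+ k.+1) = beta g ^+ k.+1.
Proof.
move=> bM g k Gg; elim: k => [|k IH]; first by rewrite !expr1.
rewrite exprS -[g * _]/(g *m _) bM //; last exact: subgroupX.
by rewrite IH [RHS]exprS.
Qed.

Lemma ln_bound (x y c : R) : 0 < c -> expR x <= c * expR y -> x <= ln c + y.
Proof. by move=> c0; rewrite -{1}(lnK (_ : c \is Num.pos)) // -expRD ler_expR. Qed.

(** The norm of the representation attached to the layer is comparable to the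
    exponential of its weight, and is submultiplicative. *)
Lemma flag_upper z j s (f : 'I_s -> 'M[R]_n) : C z -> (forall i, G (f i)) ->
  exists2 L : R, 0 <= L & forall g i k, G g ->
    sumwt (layer z j) (kap ((g *m f i) ^+ k.+1)) <=
      k.+1%:R * (sumwt (layer z j) (kap g) + L).
Proof.
move=> Cz Gf; set I := layer z j.
pose iw (k : 'I_#|I|) : 'I_n := enum_val k.
have slot_inj : injective (fun k : 'I_#|I| => (iw k, tt)).
  by move=> a b [] /enum_val_inj.
have slot_up k c : chi (iw k) z <= chi c z -> exists p : 'I_#|I|, tt = tt /\ iw p = c.
  move=> kc; have cI : c \in I.
    by rewrite inE; apply: le_trans kc; have := enum_valP k; rewrite inE.
  by exists (enum_rank_in cI c); rewrite /iw enum_rankK_in.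
have [r [beta [c [s' [l [f' [[r0 c0] _ bM bE]]]]]]] := flag_rep hG hGc hGconn Qu elG
  elD chiL hroot slot_inj slot_up Cz SG Sdense K.
have thE h : topwt chi iw h = sumwt I h.
  by rewrite /topwt /sumwt (big_enum_val (fun i => chi i h)).
have GM g h : G g -> G h -> G (g *m h) by case: hG => _ _ + _; apply.
pose b := 1 + \sum_i `|beta (f i)|.
have b0 : 0 < b by rewrite ltr_pwDl // sumr_ge0.
have bf i : `|beta (f i)| <= b by rewrite /b (bigD1 i) //= addrCA lerDl addr_ge0 // sumr_ge0.
pose a := r%:R * r%:R * c * b.
have rp : 0 < r%:R :> R by rewrite ltr0n.
have a0 : 0 < a by rewrite !mulr_gt0.
exists (`|ln c| + `|ln a|); first by rewrite addr_ge0.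
move=> g i k Gg; have Gh : G (g *m f i) by exact: GM.
have Ghk : G ((g *m f i) ^+ k.+1) by exact: subgroupX.
have [_ H1 _] := bE _ _ (kapC Ghk) (kapE Ghk).
have [H2 _ _] := bE _ _ (kapC Gg) (kapE Gg).
rewrite !thE in H1 H2.
have H3 : expR (sumwt I (kap ((g *m f i) ^+ k.+1))) <=
   c * expR (k.+1%:R * (ln a + sumwt I (kap g))).
  apply: le_trans H1 _; rewrite ler_pM2l // betaX //.
  apply: le_trans (power_norm _ _) _; rewrite expRM_natl lerXn2r ?nnegrE ?expR_ge0 ?mulr_ge0 //.
  rewrite expRD lnK ?posrE // bM //.
  apply: le_trans (ler_wpM2l (ltW rp) (mx_norm_mul _ _)) _.
  have -> : a * expR (sumwt I (kap g)) =
    r%:R * (r%:R * (c * expR (sumwt I (kap g))) * b) by rewrite /a; ring.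
  apply: ler_wpM2l; first exact: ltW.
  by apply: ler_pM => //; rewrite ?mulr_ge0 //; apply: ler_wpM2l => //; exact: ltW.
have := ln_bound c0 H3.
have k1 : 1 <= k.+1%:R :> R by rewrite ler1n.
have : ln c <= k.+1%:R * `|ln c|.
  by apply: le_trans (ler_norm _) _; rewrite ler_peMl.
have : k.+1%:R * ln a <= k.+1%:R * `|ln a| by rewrite ler_wpM2l // ler_norm.
lra.
Qed.

Definition total_layers (z : E) : {set 'I_n * 'I_n} := finset (fun p => chi p.2 z <= chi p.1 z).

(** The lower bound comes from the trace of a power.  A single representation
    is used for the sum of all layers, so that one word f serves for all of
    them at once. *)
Lemma flag_lower z : C z -> exists s (l : 'I_s -> nat) (f : 'I_s -> 'M[R]_n),
  (forall i, word_set S (l i) (f i)) /\ exists2 L : R, 0 <= L &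
    forall g, G g -> exists i, forall k,
      k.+1%:R * (\sum_j sumwt (layer z j) (kap g) - L) <=
        \sum_j sumwt (layer z j) (kap ((g *m f i) ^+ k.+1)).
Proof.
move=> Cz; set I := total_layers z.
pose iw (k : 'I_#|I|) : 'I_n := (enum_val k).1.
pose jw (k : 'I_#|I|) : 'I_n := (enum_val k).2.
have slot_inj : injective (fun k : 'I_#|I| => (iw k, jw k)).
  move=> a b [] h1 h2; apply: enum_val_inj.
  by rewrite [LHS]surjective_pairing [RHS]surjective_pairing -/(iw _) -/(jw _) h1 h2.
have slot_up k c : chi (iw k) z <= chi c z -> exists p, jw p = jw k /\ iw p = c.
  move=> kc; have cI : (c, jw k) \in I.
    by rewrite inE; apply: le_trans kc; have := enum_valP k; rewrite inE.
  by exists (enum_rank_in cI (c, jw k)); rewrite /iw /jw enum_rankK_in.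
have [r [beta [c [s [l [f [[r0 c0] lf bM bE]]]]]]] := flag_rep hG hGc hGconn Qu elG
  elD chiL hroot slot_inj slot_up Cz SG Sdense K.
have thE h : topwt chi iw h = \sum_j sumwt (layer z j) h.
  rewrite /topwt -(big_enum_val (fun p : 'I_n * 'I_n => chi p.1 h)) /sumwt.
  rewrite (exchange_big_dep xpredT) //=.
  rewrite (eq_bigl (fun p : 'I_n * 'I_n => true && (chi p.2 z <= chi p.1 z))); last first.
    by move=> p; rewrite inE.
  rewrite -(pair_big_dep xpredT (fun i j => chi j z <= chi i z) (fun i _ => chi i h)) /=.
  by apply: eq_bigr => i _; apply: eq_bigl => j; rewrite inE.
exists s, l, f; split => //.
have GM g h : G g -> G h -> G (g *m h) by case: hG => _ _ + _; apply.
have Gf i : G (f i) by exact: word_set_sub hG SG (lf i).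
have rp : 0 < r%:R :> R by rewrite ltr0n.
pose a := r%:R * c; have a0 : 0 < a by rewrite mulr_gt0.
exists (`|ln a| + `|ln a|); first by rewrite addr_ge0.
move=> g Gg; have [_ _ [i Hi]] := bE _ _ (kapC Gg) (kapE Gg).
exists i => k; rewrite thE in Hi.
have Gh : G (g *m f i) by exact: GM.
have Ghk : G ((g *m f i) ^+ k.+1) by exact: subgroupX.
have [H1 _ _] := bE _ _ (kapC Ghk) (kapE Ghk); rewrite thE in H1.
move: Hi H1; set X := \sum_j sumwt _ (kap g); set Y := \sum_j sumwt _ (kap (_ ^+ _)).
move=> Hi H1.
have H2 : expR (k.+1%:R * X) <= (a ^+ k.+1 * a) * expR Y.
  rewrite expRM_natl.
  apply: (@le_trans _ _ ((c * `|\tr (beta (g *m f i))|) ^+ k.+1)).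
    by rewrite lerXn2r ?nnegrE ?expR_ge0 ?mulr_ge0 // ltW.
  rewrite exprMn; apply: le_trans (ler_wpM2l _ (trace_power _ _ r0)) _.
    by rewrite exprn_ge0 // ltW.
  rewrite -betaX //.
  have -> : a ^+ k.+1 * a * expR Y = c ^+ k.+1 * (r%:R ^+ k.+1 * (r%:R * (c * expR Y))).
    by rewrite /a exprMn; ring.
  by do 3! (apply: ler_wpM2l; first by rewrite ?exprn_ge0 // ltW).
have := ln_bound _ H2; rewrite mulr_gt0 ?exprn_gt0 // => /(_ isT).
rewrite lnM ?posrE ?exprn_gt0 // lnXn // -mulr_natl.
have k1 : 1 <= k.+1%:R :> R by rewrite ler1n.
have : ln a <= k.+1%:R * `|ln a|.
  by apply: le_trans (ler_norm _) _; rewrite ler_peMl.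
have : k.+1%:R * ln a <= k.+1%:R * `|ln a| by rewrite ler_wpM2l // ler_norm.
lra.
Qed.

(** There are finitely many layers, although z varies in the chamber. *)
Lemma flag_upper_unif s (f : 'I_s -> 'M[R]_n) : (forall i, G (f i)) ->
  exists2 L : R, 0 <= L & forall z j g i k, C z -> G g ->
    sumwt (layer z j) (kap ((g *m f i) ^+ k.+1)) <=
      k.+1%:R * (sumwt (layer z j) (kap g) + L).
Proof.
move=> Gf.
have H (I : {set 'I_n}) : exists L : R, 0 <= L /\ forall z j g i k, C z ->
    layer z j = I -> G g -> sumwt I (kap ((g *m f i) ^+ k.+1)) <=
      k.+1%:R * (sumwt I (kap g) + L).
  have [[z [j [Cz zI]]]|N] := pselect (exists z j, C z /\ layer z j = I).
    have [L L0 HL] := flag_upper j Cz Gf; exists L; split => // z' j' g i k _ _ Gg.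
    by rewrite -zI; exact: HL.
  by exists 0; split => // z j g i k Cz zI; case: N; exists z, j.
have [L HL] := choice H.
exists (\sum_I L I) => [|z j g i k Cz Gg].
  by apply: sumr_ge0 => I _; case: (HL I).
have [_ /(_ z j g i k Cz erefl Gg) H1] := HL (layer z j).
apply: le_trans H1 _; rewrite ler_wpM2l // lerD2l (bigD1 (layer z j)) //= lerDl.
by apply: sumr_ge0 => I _; case: (HL I).
Qed.

Definition wtnorm (v : E) : R := \sum_i `|chi i v|.

Lemma wtnorm_ge0 v : 0 <= wtnorm v.
Proof. exact: sumr_ge0. Qed.

Lemma chi_wtnorm i v : `|chi i v| <= wtnorm v.
Proof. by rewrite /wtnorm (bigD1 i) //= lerDl sumr_ge0. Qed.

Lemma wtnorm_sqr v : wtnorm v ^+ 2 <= n%:R * \sum_i chi i v ^+ 2.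
Proof.
case: (posnP n) => [n0|n0].
  rewrite {1}/wtnorm big1 => [|i]; last by have := ltn_ord i; rewrite [X in (_ < X)%N -> _]n0.
  by rewrite expr0n mulr_ge0 // sumr_ge0 // => i _; exact: sqr_ge0.
have np : 0 < n%:R :> R by rewrite ltr0n.
have : \sum_i 2 * (n%:R * `|chi i v| * wtnorm v) <=
    \sum_i (n%:R ^+ 2 * chi i v ^+ 2 + wtnorm v ^+ 2).
  apply: ler_sum => i _; have := sqr_ge0 (n%:R * `|chi i v| - wtnorm v).
  by rewrite -[chi i v ^+ 2]real_normK ?num_real //; lra.
rewrite big_split sumr_const card_ord -!mulr_sumr -mulr_suml -mulr_sumr -/(wtnorm v) /=.
rewrite -mulr_natl => H; rewrite -(ler_pM2l np); move: H; rewrite !expr2; lra.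
Qed.

(** The weights of y - x are paired with those of y - x0.  The layers of y
    bound the part that comes from y, by the upper bounds, and the layers of x0
    bound the part that comes from x0, by the lower bounds. *)
Lemma layers_close x0 x y (e : R) : C x0 -> C y -> 0 <= e ->
  (forall z j, C z -> sumwt (layer z j) (y - x) <= e) ->
  (forall j, - e <= sumwt (layer x0 j) (y - x)) ->
  wtnorm (y - x0) ^+ 2 <=
    n%:R * (wtnorm (x - x0) + 6 * e) * (2 * wtnorm x0 + wtnorm (y - x0)).
Proof.
move=> C0 Cy e0 up low.
(* The full set of indices is the layer of the smallest weight of x0. *)
have full : - e <= \sum_i chi i (y - x) <= e.
  case: (pickP 'I_n) => [i0 _|none]; last first.
    by rewrite big1 => [|i]; [rewrite oppr_le0 e0|have := none i].
  case: (@arg_minP _ R _ i0 xpredT (chi^~ x0)) => // j _ jmin.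
  have -> : \sum_i chi i (y - x) = sumwt (layer x0 j) (y - x).
    by apply: eq_bigl => i; rewrite inE jmin.
  by rewrite low up.
have /andP[full1 full2] := full.
have H1 : \sum_i chi i y * chi i (y - x) <= 3 * wtnorm y * e.
  apply: layer_cake => //; [exact: wtnorm_ge0|by move=> i; exact: chi_wtnorm|].
  by move=> j; apply: le_trans (up y j Cy); rewrite /sumwt; under [leRHS]eq_bigl do rewrite inE.
have H2 : \sum_i chi i x0 * - chi i (y - x) <= 3 * wtnorm x0 * e.
  apply: layer_cake => //; [exact: wtnorm_ge0|by move=> i; exact: chi_wtnorm| |].
    move=> j; rewrite sumrN lerNl; apply: le_trans (low j) _.
    by rewrite /sumwt; under eq_bigl do rewrite inE.
  by rewrite sumrN lerN2.
have H3 : \sum_i chi i (y - x0) ^+ 2 <= wtnorm (y - x0) * wtnorm (x - x0) +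
    (\sum_i chi i y * chi i (y - x) + \sum_i chi i x0 * - chi i (y - x)).
  rewrite -big_split mulr_suml -big_split; apply: ler_sum => i _ /=.
  have : chi i (y - x0) * chi i (x - x0) <= `|chi i (y - x0)| * wtnorm (x - x0).
    apply: le_trans (ler_norm _) _; rewrite normrM ler_wpM2l //; exact: chi_wtnorm.
  rewrite !chiB; lra.
have H4 : wtnorm y <= wtnorm x0 + wtnorm (y - x0).
  rewrite /wtnorm -big_split; apply: ler_sum => i _ /=; rewrite chiB.
  by apply: le_trans (ler_normD _ _); rewrite addrC subrK.
apply: le_trans (wtnorm_sqr _) _; rewrite -mulrA ler_wpM2l //.
apply: le_trans H3 _; apply: (le_trans (lerD (lexx _) (lerD H1 H2))).
have := wtnorm_ge0 x0; have := wtnorm_ge0 (x - x0).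
have := wtnorm_ge0 (y - x0).
set a := wtnorm _; set b := wtnorm (x - x0); set c := wtnorm x0 => a0 b0 c0.
have : 3 * wtnorm y * e <= 3 * (c + a) * e by rewrite ler_wpM2r // ler_wpM2l.
have : 0 <= b * c by rewrite mulr_ge0.
have : 0 <= a * e by rewrite mulr_ge0.
have : 0 <= c * e by rewrite mulr_ge0.
lra.
Qed.

(** The upper bounds hold for each layer and the lower bound for the sum over
    the layers of x0, so each of these layers satisfies both, up to a constant.
    After division by the length the constants become negligible. *)
Lemma stable_power x0 : C x0 -> exists s (l : 'I_s -> nat) (f : 'I_s -> 'M[R]_n),
  (forall i, word_set S (l i) (f i)) /\
  forall e : R, 0 < e -> exists2 d : R, 0 < d & exists k0, forall k g,
    (k0 <= k)%N -> G g -> wtnorm (k.+1%:R^-1 *: kap g - x0) <= d ->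
    exists i, forall r,
      wtnorm ((r.+1 * k.+1)%:R^-1 *: kap ((g *m f i) ^+ r.+1) - x0) <= e.
Proof.
move=> C0; have [s [l [f [lf [L1 L10 low]]]]] := flag_lower C0.
have Gf i : G (f i) by exact: word_set_sub hG SG (lf i).
have [L2 L20 up] := flag_upper_unif Gf.
exists s, l, f; split => // e e0.
pose L := L1 + n%:R * L2.
have L0 : 0 <= L by rewrite addr_ge0 // mulr_ge0.
have b0 := wtnorm_ge0 x0; set b := wtnorm x0 in b0.
pose s0 := e ^+ 2 / (2 * n.+1%:R * (2 * b + e)).
have be0 : 0 < 2 * b + e by lra.
have s00 : 0 < s0 by rewrite divr_gt0 ?exprn_gt0 // !mulr_gt0.
have s0E : n.+1%:R * s0 * (2 * b + e) = e ^+ 2 / 2.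
  have : n.+1%:R != 0 :> R by rewrite pnatr_eq0.
  by rewrite /s0; move: (n.+1%:R : R) => m m0; field; rewrite m0 lt0r_neq0.
exists (s0 / 2); first by rewrite divr_gt0.
have [k0 [k0p Hk0]] := archi_le (12 * L) s00.
exists k0 => k g kk Gg; set x := _ *: kap g => xx0.
have [i Hi] := low g Gg; exists i => r.
have Gh : G (g *m f i) by case: hG => _ _ + _; apply.
have Ghr : G ((g *m f i) ^+ r.+1) by exact: subgroupX.
set y := _ *: kap _.
have Cy : C y by apply: Ccone; [rewrite invr_ge0|exact: kapC].
have kp : 0 < k.+1%:R :> R by rewrite ltr0n.
have r0p : 0 < r.+1%:R :> R by rewrite ltr0n.
have yx I : sumwt I (y - x) = k.+1%:R^-1 *
    (r.+1%:R^-1 * sumwt I (kap ((g *m f i) ^+ r.+1)) - sumwt I (kap g)).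
  by rewrite sumwtB !sumwtZ natrM invfM; ring.
have upy z j : C z -> sumwt (layer z j) (y - x) <= k.+1%:R^-1 * L2.
  move=> Cz; rewrite yx ler_wpM2l ?invr_ge0 // lerBlDl ler_pdivrMl //.
  exact: up.
have lowy : - (k.+1%:R^-1 * L1) <= \sum_j sumwt (layer x0 j) (y - x).
  under eq_bigr do rewrite yx; rewrite -mulr_sumr -mulrN ler_wpM2l ?invr_ge0 //.
  rewrite sumrB -mulr_sumr lerBrDl ler_pdivlMl //; exact: Hi.
pose e1 := k.+1%:R^-1 * L.
have e10 : 0 <= e1 by rewrite mulr_ge0 // invr_ge0.
have L2L : forall j : 'I_n, L2 <= L.
  move=> j; have n1 : 1 <= n%:R :> R by rewrite ler1n; case: j => j; apply: leq_trans.
  have : L2 <= n%:R * L2 by rewrite ler_peMl.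
  rewrite /L; lra.
have up1 z j : C z -> sumwt (layer z j) (y - x) <= e1.
  by move=> Cz; apply: le_trans (upy z j Cz) _; rewrite ler_wpM2l ?invr_ge0 //; exact: L2L.
have low1 j : - e1 <= sumwt (layer x0 j) (y - x).
  move: lowy; rewrite (bigD1 j) //=.
  have : \sum_(j' | j' != j) sumwt (layer x0 j') (y - x) <= n%:R * (k.+1%:R^-1 * L2).
    apply: (@le_trans _ _ (\sum_(j' < n) (k.+1%:R^-1 * L2))).
      rewrite big_mkcond; apply: ler_sum => j' _; case: ifP => _; first exact: upy.
      by rewrite mulr_ge0 // invr_ge0.
    by rewrite sumr_const card_ord [leRHS]mulr_natl.
  rewrite /e1 /L mulrDr; move: (sumwt _ _) (\sum_(_ | _) _) (k.+1%:R^-1 : R).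
  move=> s1 s2 q h1 h2.
  have {}h1 : s2 <= q * (n%:R * L2) by rewrite mulrCA.
  by rewrite opprD lerBlDr; apply: le_trans h2 _; rewrite lerD2l.
have := layers_close C0 Cy e10 up1 low1; rewrite -/b.
have e1s : 6 * e1 <= s0 / 2.
  move: Hk0; rewrite ler_pdivrMr ?ltr0n // => Hk0.
  have : s0 * k0%:R <= s0 * k.+1%:R by rewrite ler_wpM2l ?ler_nat 1?ltW // ltnW.
  rewrite /e1 mulrCA ler_pdivrMl // => h; have := le_trans Hk0 h.
  exact: half_bound.
have t0 := wtnorm_ge0 (y - x0); move: t0; set t := wtnorm _ => t0 H.
have : t ^+ 2 <= n.+1%:R * s0 * (2 * b + t).
  apply: le_trans H _; rewrite ler_wpM2r ?addr_ge0 ?mulr_ge0 //.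
  apply: ler_pM => //; rewrite ?ler_nat //; last by rewrite [leRHS]splitr lerD.
  by rewrite addr_ge0 // ?mulr_ge0 //; exact: wtnorm_ge0.
have ns0 : 0 < n.+1%:R * s0 by rewrite mulr_gt0.
move: s0E ns0; set q := n.+1%:R * s0 => qE q0 tq.
exact: quadratic_bound qE tq.
Qed.

End MainEstimate.

(** * Real points and split tori *)

Section RealPoints.
Variable R : realType.
Local Notation rc := (real_complex R).

Lemma complexify_inj n : injective (@complexify R n).
Proof. by move=> g h /matrixP H; apply/matrixP => i j; have := H i j; rewrite !mxE => -[]. Qed.

Lemma complexify1 n : complexify 1%:M = 1%:M :> 'M[complex R]_n.
Proof. exact: map_mx1. Qed.

Lemma complexifyM n (g h : 'M[R]_n) : complexify (g *m h) = complexify g *m complexify h.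
Proof. exact: map_mxM. Qed.

Lemma complexifyX n (g : 'M[R]_n) k : complexify (g ^+ k) = complexify g ^+ k.
Proof.
elim: k => [|k IH]; first by rewrite !expr0 complexify1.
by rewrite !exprS -IH; exact: complexifyM.
Qed.

Lemma poly_complexify n (p : mpoly.mpoly (n * n) R) (g : 'M[R]_n) :
  poly_at (complexify_poly p) (complexify g) = rc (poly_at p g).
Proof.
rewrite /poly_at !mpoly.mevalE.
rewrite (perm_big _ (mpoly.msupp_map_mpoly p (fmorph_inj rc))) /= rmorph_sum /=.
apply: eq_bigr => m _; rewrite mpoly.mcoeff_map_mpoly rmorphM rmorph_prod; congr (_ * _).
by apply: eq_bigr => i _; rewrite rmorphXn /=; case/mxvec_indexP: i => i j; rewrite !mxvecE mxE.
Qed.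

Lemma poly_continuous n (p : mpoly.mpoly (n * n) R) :
  continuous (fun g : 'M[R]_n => poly_at p g).
Proof.
have -> : (fun g : 'M[R]_n => poly_at p g) = (fun g => \sum_(m <- mpoly.msupp p)
    mpoly.mcoeff m p * \prod_i (mxvec g 0 i) ^+ mpoly.fun_of_multinom m i).
  by apply/funext => g; rewrite /poly_at mpoly.mevalE.
apply: continuous_big => [|m _]; first exact: add_continuous.
have prod_cont : continuous (fun g : 'M[R]_n =>
    \prod_i (mxvec g 0 i) ^+ mpoly.fun_of_multinom m i).
  apply: continuous_big => [|i _]; first exact: mul_continuous.
  move: (mpoly.fun_of_multinom m i) => k; case/mxvec_indexP: i => i j.
  rewrite (_ : (fun _ => _) = fun h : 'M[R]_n => h i j ^+ k); last first.
    by apply/funext => h; rewrite mxvecE.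
  move=> g; apply: (@continuous_comp _ _ _ (fun h : 'M[R]_n => h i j) (fun x : R => x ^+ k)).
    exact: coord_continuous.
  exact: exprn_continuous.
by move=> g; exact: (cvgM (cvg_cst _) (prod_cont g)).
Qed.

Lemma closure_approx n (G : set 'M[R]_n) g :
  (forall e : R, 0 < e -> exists h, G h /\ `|h - g| <= e) <-> closure G g.
Proof.
split=> [H B /nbhs_ballP[e /= e0 eB]|H e e0].
  have [h [Gh hg]] := H (e / 2) (divr_gt0 e0 (ltr0Sn _ _)).
  exists h; split => //; apply: eB; rewrite -ball_normE /= distrC.
  by apply: le_lt_trans hg _; rewrite ltr_pdivrMr // mulr_natr mulr2n ltrDl.
have [h [Gh]] := H _ (nbhsx_ballx g _ e0).
by rewrite -ball_normE /= distrC => /ltW hg; exists h.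
Qed.

Lemma mulmx_left_continuous n (a : 'M[R]_n) : continuous (fun g : 'M[R]_n => a *m g).
Proof.
move=> g B /nbhs_ballP[e /= e0 eB].
have e1 : 0 < e / (n%:R * `|a| + 1) by rewrite divr_gt0 // ltr_wpDl // mulr_ge0.
apply/nbhs_ballP; exists (e / (n%:R * `|a| + 1)) => //= h.
rewrite -ball_normE /= => hg; apply: eB; rewrite -ball_normE /= -mulmxBr.
apply: le_lt_trans (mx_norm_mul _ _) _.
have c0 : 0 < n%:R * `|a| + 1 by rewrite ltr_wpDl // mulr_ge0.
rewrite -(divfK (lt0r_neq0 c0) e) mulrC; apply: le_lt_trans (_ : _ <= `|g - h| * (n%:R * `|a| + 1)) _.
  by rewrite ler_wpM2l // lerDl.
by rewrite ltr_pM2r.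
Qed.

(** The identity component of a group is a group, because left translates of
    it by inverses of its elements are connected and contain 1. *)
Lemma component_subgroup n (Gr : set 'M[R]_n) : is_subgroup Gr ->
  is_subgroup (connected_component Gr 1%:M).
Proof.
move=> hGr; have [GU G1 GM GV] := hGr; set G := connected_component _ _.
have sub : G `<=` Gr by exact: connected_component_sub.
have Gone : G 1%:M by exact: connected_component_refl.
have VM a g : G a -> G g -> G (invmx a *m g).
  move=> Ga Gg; have au := GU _ (sub _ Ga).
  apply: (@connected_component_max _ Gr [set invmx a *m h | h in G]).
  - by exists a => //; rewrite mulVmx.
  - by move=> _ [h Gh <-]; apply: GM; [exact: GV (sub _ Ga)|exact: sub].
  - apply: connected_continuous_connected; first exact: component_connected.
    by apply: continuous_subspaceT; exact: mulmx_left_continuous.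
  - by exists g.
have V g : G g -> G (invmx g) by move=> Gg; have := VM _ _ Gg Gone; rewrite mulmx1.
split => //; first by move=> g /sub/GU.
by move=> g h Gg Gh; have := VM _ _ (V _ Gg) Gh; rewrite invmxK.
Qed.

(** A set between a connected set and its closure is connected. *)
Lemma component_rel_closed n (Gr : set 'M[R]_n) x : rel_closed Gr -> Gr x ->
  rel_closed (connected_component Gr x).
Proof.
move=> Gc Gx g gu /closure_approx clg; set G := connected_component _ _ in clg *.
have sub : G `<=` Gr by exact: connected_component_sub.
have Gg : Gr g by apply: Gc => //; apply/closure_approx; exact: closure_subset clg.
apply: (@connected_component_max _ Gr (G `|` [set g])).
- by left; exact: connected_component_refl.
- by move=> h [/sub|->].
- apply/connectedP => E [E0 GE sE].
  have conn : connected G by exact: component_connected.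
  have sub' b : G `<=` E b -> closure (E b) `&` E (~~ b) !=set0.
    move=> Gb; have [h Eh] := E0 (~~ b); exists h; split => //.
    have : (G `|` [set g]) h by rewrite GE; case: (b) Eh; [left|right].
    by case=> [/Gb Ebh|->]; [exact: subset_closure|exact: closure_subset clg].
  have [] := connected_subset sE _ conn.
  + by rewrite -GE => h; left.
  + by move/sub'; case: sE => [-> _] [].
  + by move/sub'; case: sE => [_ s2] /=; rewrite setIC s2 => -[].
- by right.
Qed.

Lemma real_points_subgroup n (H : set 'M[complex R]_n) :
  is_subgroup H -> is_subgroup (real_points H).
Proof.
move=> [HU H1 HM HV]; split.
- by move=> g /HU /=; rewrite map_unitmx.
- by rewrite /real_points /= complexify1.
- by move=> g h Hg Hh; rewrite /real_points /= complexifyM; exact: HM.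
- by move=> g Hg; rewrite /real_points /= /complexify map_invmx; exact: HV.
Qed.

Lemma real_points_rel_closed n (H : set 'M[complex R]_n) :
  closed_over_R H -> rel_closed (real_points H).
Proof.
move=> [I ->] g gu /closure_approx clg; split; first by rewrite map_unitmx.
move=> p Ip; rewrite poly_complexify.
suff -> : poly_at p g = 0 by rewrite rmorph0.
have cl0 : closed [set h : 'M[R]_n | poly_at p h = 0].
  apply: (@closed_comp _ _ (fun h : 'M[R]_n => poly_at p h) [set 0]).
    by move=> h _; exact: poly_continuous.
  exact: closed_eq.
apply: cl0; apply: closure_subset clg => h [hu /(_ p Ip)].
by rewrite poly_complexify => /eqP; rewrite fmorph_eq0 => /eqP.
Qed.

End RealPoints.

(** If p is the product of X - b over the bases b of the exponential sums, then
    g p(g) = 0; as g is invertible, it is killed by a split polynomial with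
    simple roots. *)
Lemma power_sums_diagonalizable (F : fieldType) n (g : 'M[F]_n) : g \in unitmx ->
  (forall i j, exists L : seq (F * F), forall k,
    (g ^+ k.+1) i j = \sum_(a <- L) a.1 * a.2 ^+ k.+1) ->
  diagonalizable g.
Proof.
case: n g => [|n] g gu HL; first by rewrite (thinmx0 g); exact: diagonalizable0.
have [L {}HL] := choice (fun p : 'I_n.+1 * 'I_n.+1 => HL p.1 p.2).
apply/diagonalizableP.
pose rs := undup [seq a.2 | p <- enum {: 'I_n.+1 * 'I_n.+1}, a <- L p].
exists rs; first exact: undup_uniq.
apply: mxminpoly_min; set q := \prod_(x <- rs) _.
have gq : g *m horner_mx g q = horner_mx g ('X * q) by rewrite rmorphM /= horner_mx_X.
suff H : horner_mx g ('X * q) = 0.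
  by rewrite -[horner_mx g q](mulKmx gu) gq H mulmx0.
have E : 'X * q = \sum_(k < size q) q`_k *: 'X^(k.+1).
  rewrite -{1}[q]coefK poly_def mulr_sumr; apply: eq_bigr => k _.
  by rewrite -scalerAr exprS.
apply/matrixP => i j; rewrite mxE E raddf_sum summxE /=.
transitivity (\sum_(k < size q) \sum_(a <- L (i, j)) a.1 * a.2 * (q`_k * a.2 ^+ k)).
  apply: eq_bigr => k _; rewrite linearZ /= rmorphXn /= horner_mx_X mxE (HL (i, j)) mulr_sumr.
  by apply: eq_bigr => a _; rewrite exprS; ring.
rewrite exchange_big /= big_seq big1 // => a aL; rewrite -mulr_sumr -horner_coef.
suff /eqP -> : root q a.2 by rewrite mulr0.
rewrite root_prod_XsubC mem_undup; apply/allpairsPdep; exists (i, j), a.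
by rewrite mem_enum.
Qed.

Section Torus.
Variables (R : realType) (n : nat).
Local Notation rc := (real_complex R).

(** Regular functions on a split torus are linear combinations of real
    characters, so that the entries of the powers of a real point are
    exponential sums with real bases. *)
Lemma split_torus_diagonalizable (T : set 'M[complex R]_n) g :
  split_algebraic_torus T -> real_points T g -> diagonalizable g.
Proof.
move=> [[hT _] [d [f [f' [rf rf' fT f'T fM]]]]] Tg.
have [TU T1 TM _] := hT.
have gu : g \in unitmx by have := TU _ Tg; rewrite /= map_unitmx.
have [[Lu Ld] fK] := fT _ Tg; set l := f _ in Lu Ld fK.
have [l0 l0E] : exists l0 : 'M[R]_d, l = complexify l0.
  have H (p : 'I_d * 'I_d) : exists x, l p.1 p.2 = rc x.
    have [P [k HP]] := rf p.1 p.2; exists (poly_at P g / (\det g) ^+ k).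
    by rewrite /l HP // poly_complexify det_map_mx rmorphM fmorphV rmorphXn.
  have [x Hx] := choice H; exists (\matrix_(i, j) x (i, j)).
  by apply/matrixP => i j; rewrite !mxE (Hx (i, j)).
have l0u : l0 \in unitmx by move: Lu; rewrite l0E map_unitmx.
have [e eE] : exists e, l0 = diag_mx e.
  apply/diag_mxP/is_diag_mxP => i j ij; apply: (fmorph_inj rc); rewrite rmorph0.
  by have /is_diag_mxP/(_ i j ij) := Ld; rewrite l0E mxE.
have TX k : T (complexify g ^+ k.+1) /\ f (complexify g ^+ k.+1) = l ^+ k.+1.
  elim: k => [|k [IH1 IH2]]; first by rewrite !expr1.
  rewrite ![_ ^+ k.+2]exprS -[complexify g * _]/(complexify g *m _); split; first exact: TM.
  by rewrite fM // IH2.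
apply: power_sums_diagonalizable => // i j.
have [P [r HP]] := rf' i j.
exists [seq (mpoly.mcoeff m P,
  (\prod_i (mxvec l0 0 i) ^+ mpoly.fun_of_multinom m i) / (\det l0) ^+ r) | m <- mpoly.msupp P].
move=> k; apply: (fmorph_inj rc); have [TX1 TX2] := TX k.
have [[LXu LXd] fXK] := fT _ TX1.
transitivity (rc (poly_at P (l0 ^+ k.+1) / (\det (l0 ^+ k.+1)) ^+ r)).
  rewrite rmorphM fmorphV rmorphXn /= -poly_complexify -(det_map_mx (real_complex R)).
  rewrite -[map_mx _ _]/(complexify _) complexifyX -l0E -TX2 -HP // fXK -complexifyX.
  by rewrite mxE.
congr rc.
rewrite /poly_at mpoly.mevalE mulr_suml [RHS]big_map.
apply: eq_bigr => m _ /=.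
rewrite -mulrA; congr (_ * _); rewrite exprMn exprVn -exprM mulnC exprM.
congr (_ / _); last by congr (_ ^+ _); elim: k {TX1 TX2 LXu LXd fXK} => [|k IH];
  rewrite ?expr1 // exprS det_mulmx IH -exprS.
rewrite -prodrXl; apply: eq_bigr => a _; rewrite -exprM mulnC exprM; congr (_ ^+ _).
rewrite eE diagX; case/mxvec_indexP: a => a b; rewrite !mxvecE !mxE.
by case: eqP => // _; rewrite !mulr0n expr0n.
Qed.

Lemma split_torus_comm (T : set 'M[complex R]_n) g h : split_algebraic_torus T ->
  real_points T g -> real_points T h -> g *m h = h *m g.
Proof.
move=> [[[_ _ TM _] _] [d [f [f' [_ _ fT _ fM]]]]] Tg Th.
apply: complexify_inj; rewrite !complexifyM.
have [_ <-] := fT _ (TM _ _ Tg Th); have [_ <-] := fT _ (TM _ _ Th Tg).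
rewrite !fM //; congr f'.
have [[_ /diag_mxP[a ->]] _] := fT _ Tg; have [[_ /diag_mxP[b ->]] _] := fT _ Th.
exact: diag_mxC.
Qed.

Lemma split_torus_codiag (T : set 'M[complex R]_n) : split_algebraic_torus T ->
  exists2 Q : 'M[R]_n, Q \in unitmx &
    forall g, real_points T g -> is_diag_mx (Q *m g *m invmx Q).
Proof.
move=> hT; pose P (v : 'rV[R]_(n * n)) := exists2 g, real_points T g & v = mxvec g.
have [r [B [HB _ HP]]] := span_basis P.
have [Q Qu /allP HQ] : codiagonalizable [seq vec_mx (row i B) | i <- enum 'I_r].
  apply/codiagonalizableP; split.
    move=> _ _ /mapP[i _ ->] /mapP[j _ ->]; have [g Tg ->] := HB i; have [h Th ->] := HB j.
    by rewrite !mxvecK; exact: split_torus_comm Tg Th.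
  move=> _ /mapP[i _ ->]; have [g Tg ->] := HB i; rewrite mxvecK.
  exact: split_torus_diagonalizable Tg.
exists Q => // g Tg.
have /submxP[c cE] : (mxvec g <= B)%MS by apply: HP; exists g.
have gE : g = \sum_i c 0 i *: vec_mx (row i B).
  by rewrite -[g]mxvecK cE mulmx_sum_row linear_sum; apply: eq_bigr => i _; rewrite linearZ.
apply/is_diag_mxP => i j ij; rewrite gE mulmx_sumr mulmx_suml summxE big1 // => k _.
have /HQ /= : vec_mx (row k B) \in [seq vec_mx (row i B) | i <- enum 'I_r].
  by apply: map_f; rewrite mem_enum.
move=> /(similar_diagP _ Qu)/(_ i j ij) H.
by rewrite -scalemxAr -scalemxAl mxE H mulr0.
Qed.

(** X is the first-order term of the diagonal matrices exp (s X). *)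
Lemma lie_diag (A : set 'M[R]_n) (Q X : 'M[R]_n) :
  (forall g, A g -> is_diag_mx (Q *m g *m invmx Q)) -> Q \in unitmx ->
  lie_algebra A X -> is_diag_mx (Q *m X *m invmx Q).
Proof.
move=> HA Qu AX; apply/is_diag_mxP => i j ij.
have : forall s, mexp (s *: (Q *m X *m invmx Q)) i j = 0.
  move=> s; have /is_diag_mxP/(_ i j ij) := HA _ (AX s).
  by rewrite -mexp_conj // -scalemxAr -scalemxAl.
move: (Q *m X *m invmx Q) => Z D.
have [c c0 Hc] := mexp_rem2 Z.
have H s : 0 < s -> s <= 1 -> `|Z i j| <= c * s.
  move=> s0 s1; have ss : `|s| <= 1 by rewrite gtr0_norm.
  have := le_trans (entry_le_norm _ i j) (Hc s ss).
  rewrite mxE D !mxE (negPf ij : (i == j) = false) !add0r normrN normrM gtr0_norm //.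
  by rewrite expr2 mulrA [_ * s * s]mulrC ler_pM2l.
apply/eqP; rewrite -normr_le0; apply/ler_addgt0Pr => e e0; rewrite add0r.
have c1 : 0 < c + 1 by rewrite ltr_wpDl.
have m0 : 0 < Num.min 1 (e / (c + 1)) by rewrite lt_min ltr01 divr_gt0.
apply: le_trans (H _ m0 _) _; first by rewrite ge_min lexx.
apply: (@le_trans _ _ (c * (e / (c + 1)))).
  by rewrite ler_wpM2l // ge_min lexx orbT.
by rewrite mulrCA ler_piMr ?(ltW e0) // ler_pdivrMr // mul1r lerDl.
Qed.

End Torus.

Section Setup.
Variables (R : realType) (n : nat).
Implicit Types (G A : set 'M[R]_n).

Lemma reductive_lie_group_connected G : connected_reductive_lie_group G ->
  [/\ is_subgroup G, rel_closed G & connected G].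
Proof.
move=> [GC [[hGC cGC] _] ->].
have hGr := real_points_subgroup hGC; have [_ one _ _] := hGr.
split; [exact: component_subgroup| |exact: component_connected].
by apply: component_rel_closed => //; exact: real_points_rel_closed.
Qed.

Lemma split_torus_lie_diag A : split_torus A -> A 1%:M /\
  exists2 Q : 'M[R]_n, Q \in unitmx &
    forall X, lie_algebra A X -> is_diag_mx (Q *m X *m invmx Q).
Proof.
move=> [T hT ->]; have [Q Qu HQ] := split_torus_codiag hT.
have [[hTg _] _] := hT; have [_ one _ _] := real_points_subgroup hTg.
split; first exact: connected_component_refl.
exists Q => // X; apply: lie_diag => // g Ag; apply: HQ.
exact: connected_component_sub Ag.
Qed.

(** The elements of the Lie algebra as a vector space generate one-parameter
    subgroups of A also for the default value of lie_space, which is 0. *)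
Lemma lie_space_sub A (x : lie A) : A 1%:M -> lie_algebra A (vsval x).
Proof.
move=> A1; have xV := subvsP x; move: xV; rewrite {2}/lie_space.
case: xgetP => [V _ /= HV|_]; first by move/HV.
by rewrite memv0 => /eqP -> t; rewrite scaler0 mexp0.
Qed.

(** The i-th weight of the torus in the basis given by Q. *)
Definition coord_wt A (Q : 'M[R]_n) (i : 'I_n) (x : lie A) : R :=
  (Q *m vsval x *m invmx Q) i i.

Lemma coord_wtL A Q i (c : R) (x y : lie A) :
  coord_wt Q i (c *: x + y) = c * coord_wt Q i x + coord_wt Q i y.
Proof.
have E : vsval (c *: x + y) = c *: vsval x + vsval y by rewrite linearP.
by rewrite /coord_wt E mulmxDr mulmxDl -scalemxAr -scalemxAl [LHS]mxE [in X in X + _]mxE.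
Qed.

Lemma coord_wtD A Q (x : lie A) : is_diag_mx (Q *m vsval x *m invmx Q) ->
  Q *m vsval x *m invmx Q = diag_mx (\row_i coord_wt Q i x).
Proof.
move=> /is_diag_mxP D; apply/matrixP => i j; rewrite [RHS]mxE [in RHS]mxE.
by case: eqP => [->|/eqP ij]; rewrite ?mulr1n // mulr0n D.
Qed.

(** A difference of two weights by which the torus acts on a root vector is a
    restricted root, hence has constant sign on the Weyl chamber. *)
Lemma root_vector_sign G A (P : set (lie_dual A)) Q X i j :
  positive_root_system G P -> lie_algebra G X -> X != 0 ->
  root_vector (fun x : lie A => vsval x) (@coord_wt A Q) X i j ->
  forall z, closed_weyl_chamber P z -> 0 < coord_wt Q i z - coord_wt Q j z ->
  forall x, closed_weyl_chamber P x -> 0 <= coord_wt Q i x - coord_wt Q j x.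
Proof.
move=> [_ Ppm _ _] GX X0 HX z Cz z0 x Cx.
pose a (y : lie A) : GRing.regular R := coord_wt Q i y - coord_wt Q j y.
have aL : linear a.
  move=> c y y'; rewrite /a !coord_wtL -[c *: _]/(c * _) mulrBr opprD addrACA; congr (_ + _).
pose aM := HB.pack_for {linear lie A -> GRing.regular R} a
  (GRing.isLinear.Build R (lie A) (GRing.regular R) _ a aL).
pose alpha : lie_dual A := linfun aM.
have alphaE y : alpha y = a y by rewrite /alpha lfunE.
have aroot : restricted_root G alpha.
  split.
    apply/eqP => E; have := alphaE z; rewrite E lfunE /= => E0.
    by move: z0; rewrite -[_ - _]/(a z) -E0 ltxx.
  by exists X; split => // h; rewrite alphaE; exact: HX.
have [Pa|Pa] := Ppm _ aroot.
  by rewrite -[_ - _]/(a x) -alphaE; exact: Cx.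
have := Cz _ Pa; rewrite opp_lfunE alphaE oppr_ge0 => H.
by have := lt_le_trans z0 H; rewrite ltxx.
Qed.

Lemma closed_weyl_chamberZ A (P : set (lie_dual A)) (c : R) x : 0 <= c ->
  closed_weyl_chamber P x -> closed_weyl_chamber P (c *: x).
Proof. by move=> c0 Cx a Pa; rewrite linearZ mulr_ge0 //; exact: Cx. Qed.

End Setup.

(** * Word length *)

Section WordLength.
Variables (R : realType) (n : nat) (G Om : set 'M[R]_n).
Hypothesis hG : is_subgroup G.
Hypothesis OmV : forall g, Om g -> Om (invmx g).
Hypothesis Omgen : forall g, G g -> exists k, word_set Om k g.
Hypothesis OmG : Om `<=` G.

Definition word_length (g : 'M[R]_n) : R := fine (word_dist Om 1%:M g).

(** Lengths are integers, so the infimum is attained. *)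
Lemma word_dist_min x y : (exists k, word_set Om k (invmx x *m y)) ->
  exists k, [/\ word_dist Om x y = k%:R%:E, word_set Om k (invmx x *m y) &
    forall k', word_set Om k' (invmx x *m y) -> (k <= k')%N].
Proof.
move=> [k0 Hk0]; have ex : exists k, `[< word_set Om k (invmx x *m y) >].
  by exists k0; apply/asboolP.
have [k /asboolP Hk kmin] := ex_minnP ex; exists k; split => //.
  apply/eqP; rewrite eq_le; apply/andP; split.
    by apply: ereal_inf_lbound; exists k.
  apply: le_ereal_inf_tmp => _ [k' /= Hk' <-].
  by rewrite lee_fin ler_nat; apply: kmin; apply/asboolP.
by move=> k' Hk'; apply: kmin; apply/asboolP.
Qed.

Lemma word_lengthP g : G g -> exists k, [/\ word_length g = k%:R, word_set Om k g &
  forall k', word_set Om k' g -> (k <= k')%N].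
Proof.
move=> Gg; have := @word_dist_min 1%:M g; rewrite invmx1 mul1mx => /(_ (Omgen Gg)).
by move=> [k [E H1 H2]]; exists k; split => //; rewrite /word_length E.
Qed.

Lemma word_dist_len x y : G x -> G y -> word_dist Om x y = (word_length (invmx x *m y))%:E.
Proof.
move=> Gx Gy; have [_ _ GM GV] := hG.
have Gxy : G (invmx x *m y) by apply: GM => //; exact: GV.
have [k [E Hk kmin]] := word_dist_min (Omgen Gxy).
have [k' [-> Hk' kmin']] := word_lengthP Gxy; rewrite E; congr (_%:R%:E).
by apply/eqP; rewrite eqn_leq kmin // kmin'.
Qed.

Lemma word_length_ge0 g : G g -> 0 <= word_length g.
Proof. by move=> Gg; have [k [-> _ _]] := word_lengthP Gg. Qed.

Lemma word_lengthM g h : G g -> G h -> word_length (g *m h) <= word_length g + word_length h.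
Proof.
move=> Gg Gh; have [_ _ GM _] := hG.
have [a [-> Ha _]] := word_lengthP Gg; have [b [-> Hb _]] := word_lengthP Gh.
have [c [-> _ Hc]] := word_lengthP (GM _ _ Gg Gh).
by rewrite -natrD ler_nat; apply: Hc; exact: word_setD.
Qed.

Lemma word_setV k g : word_set Om k g -> word_set Om k (invmx g).
Proof.
elim: k g => [|k IH] g [s Os ->].
  by rewrite big_ord0 invmx1; exact: word_set0.
have Gp : G (\prod_(i < k) s (lift ord0 i)).
  by apply: (word_set_sub hG OmG (k := k)); exists (fun i => s (lift ord0 i)).
have Gs : G (s ord0) by exact: OmG.
rewrite big_ord_recl -[_ * _]/(_ *m _) invmx_mul ?(subgroup_unit hG) //.
suff : word_set Om (k + 1) (invmx (\prod_(i < k) s (lift ord0 i)) *m invmx (s ord0)).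
  by rewrite addn1.
apply: word_setD; last by apply: word_set1; exact: OmV.
by apply: IH; exists (fun i => s (lift ord0 i)).
Qed.

Lemma word_lengthV g : G g -> word_length (invmx g) = word_length g.
Proof.
move=> Gg; have [_ _ _ GV] := hG.
have [a [-> Ha Ha']] := word_lengthP Gg; have [b [-> Hb Hb']] := word_lengthP (GV _ Gg).
apply/eqP; rewrite eqr_nat eqn_leq Hb' ?Ha' //; last exact: word_setV.
by have := word_setV Hb; rewrite invmxK.
Qed.

Lemma word_lengthX g k : G g -> word_length (g ^+ k.+1) <= k.+1%:R * word_length g.
Proof.
move=> Gg; elim: k => [|k IH]; first by rewrite expr1 mul1r.
rewrite exprS; apply: le_trans (word_lengthM Gg (subgroupX _ hG Gg)) _.
by rewrite -[k.+2]addn1 natrD mulrDl mul1r addrC lerD2r.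
Qed.

Lemma word_length_conj x g : G x -> G g -> word_length (invmx x *m g *m x) <= word_length g + 2 * word_length x.
Proof.
move=> Gx Gg; have [_ _ GM GV] := hG; have GxV := GV _ Gx.
have := word_lengthM (GM _ _ GxV Gg) Gx; have := word_lengthM GxV Gg; rewrite word_lengthV //; lra.
Qed.

Lemma word_length_conj_ge x g : G x -> G g -> word_length g <= word_length (invmx x *m g *m x) + 2 * word_length x.
Proof.
move=> Gx Gg; have [GU _ GM GV] := hG; have GxV := GV _ Gx.
have Gc : G (invmx x *m g *m x) by apply: (GM) => //; exact: GM.
have := word_length_conj GxV Gc; rewrite invmxK word_lengthV //.
by rewrite !mulmxA mulmxV ?GU // mul1mx -mulmxA mulmxV ?GU // mulmx1.
Qed.

(** By left invariance and symmetry of the word metric, the displacement at x is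
    the length of a conjugate of h, and the conjugates of the powers of h are the powers of that conjugate. *)
Lemma word_dist_move h x : G h -> G x ->
  word_dist Om (h *m x) x = (word_length (invmx x *m h *m x))%:E.
Proof.
move=> Gh Gx; have [GU _ GM GV] := hG.
have Gc : G (invmx x *m h *m x) by apply: (GM) => //; apply: (GM) => //; exact: GV.
rewrite (word_dist_len (GM _ _ Gh Gx) Gx) -(word_lengthV Gc); congr (word_length _)%:E.
have hu := GU _ Gh; have xu := GU _ Gx.
by rewrite !invmx_mul ?unitmx_mul ?unitmx_inv ?hu ?xu // invmxK mulmxA.
Qed.

Lemma conjX x g k : G x -> invmx x *m (g ^+ k) *m x = (invmx x *m g *m x) ^+ k.
Proof.
move=> Gx; have [GU _ _ _] := hG; elim: k => [|k IH].
  by rewrite !expr0 -[_ *m 1]/(_ *m 1%:M) mulmx1 mulVmx ?GU.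
rewrite !exprS -IH -[g * _]/(g *m _) -[X in _ = X]/(_ *m _) !mulmxA.
by rewrite -[_ *m g *m x *m invmx x]mulmxA mulmxV ?GU // mulmx1.
Qed.

Lemma word_length_power_le h x k : G h -> G x ->
  word_length (h ^+ k.+1) <= k.+1%:R * word_length (invmx x *m h *m x) + 2 * word_length x.
Proof.
move=> Gh Gx; have [_ _ GM GV] := hG.
have Gc : G (invmx x *m h *m x) by apply: (GM) => //; apply: (GM) => //; exact: GV.
apply: le_trans (word_length_conj_ge Gx (subgroupX _ hG Gh)) _.
by rewrite lerD2r conjX //; exact: word_lengthX.
Qed.

Lemma word_norm b k g : 1 <= b -> (forall g, Om g -> `|g| <= b) -> word_set Om k g ->
  `|g| <= (n%:R * b + 1) ^+ k.
Proof.
move=> b1 Hb [s Os ->]; have b0 : 0 <= n%:R * b by rewrite mulr_ge0 // (le_trans _ b1).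
have b2 : 0 <= n%:R * b + 1 by rewrite addr_ge0.
apply: norm_rowle; first exact: exprn_ge0.
elim: k s Os => [|k IH] s Os; first by rewrite big_ord0 expr0; exact: rowle1.
rewrite big_ord_recl exprS; apply: rowleM => //.
- exact: exprn_ge0.
- apply: rowle_le (rowle_norm _) _; apply: ler_wpDr => //.
  by rewrite ler_wpM2l // Hb.
- exact: IH.
Qed.

End WordLength.

Lemma compact_norm_bound (R : realType) n (A : set 'M[R]_n) : compact A ->
  exists2 b : R, 1 <= b & forall g, A g -> `|g| <= b.
Proof.
move/compact_bounded => [M [_ HM]]; exists (Num.max 1 (M + 1)).
  by rewrite le_max lexx.
by apply: HM; rewrite lt_max ltrDl ltr01 orbT.
Qed.

(** X is expanded in the elementary matrices.  Stating the bound for the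
    projections of all matrices gives at once the continuity of p. *)
Lemma seminorm_le (R : realType) n (A : set 'M[R]_n) (p : lie A -> R) :
  (forall (c : R) x, p (c *: x) = `|c| * p x) -> (forall x y, p (x + y) <= p x + p y) ->
  exists2 c, 0 < c & forall X : 'M[R]_n, p (vsproj (lie_space A) X) <= c * `|X|.
Proof.
move=> pZ pD; have p0 : p 0 = 0 by have := pZ 0 0; rewrite scaler0 normr0 mul0r.
have pN x : 0 <= p x.
  have := pD x (-1 *: x); rewrite pZ scaleN1r subrr p0 normrN1 mul1r; lra.
pose e i j : lie A := vsproj (lie_space A) (delta_mx i j).
pose c := 1 + \sum_i \sum_j p (e i j).
have c0 : 0 <= \sum_i \sum_j p (e i j).
  by apply: sumr_ge0 => i _; apply: sumr_ge0.
exists c => [|X]; first by rewrite ltr_pwDl.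
have psum (I : finType) (F : I -> lie A) : p (\sum_i F i) <= \sum_i p (F i).
  elim/big_rec2: _ => [|i y1 y2 _ IH]; first by rewrite p0.
  by apply: le_trans (pD _ _) _; rewrite lerD2l.
rewrite [X in vsproj _ X]matrix_sum_delta raddf_sum; apply: le_trans (psum _ _) _.
apply: (@le_trans _ _ (\sum_i \sum_j `|X| * p (e i j))).
  apply: ler_sum => i _; rewrite raddf_sum; apply: le_trans (psum _ _) _.
  apply: ler_sum => j _; rewrite [X in p X](_ : _ = X i j *: e i j); last exact: linearZ.
  by rewrite pZ ler_wpM2r //; exact: entry_le_norm.
rewrite /c mulrDl mul1r [X in _ <= _ + X]mulrC mulr_sumr -[leLHS]add0r lerD //.
by under [leRHS]eq_bigr do rewrite mulr_sumr.
Qed.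

(** * The coarse Cartan decomposition and the joint spectrum *)

Section Coarse.
Variables (R : realType) (n : nat) (G A K : set 'M[R]_n) (P : set (lie_dual A)).
Variables (Om : set 'M[R]_n) (N : lie A -> R).
Hypothesis hG : is_subgroup G.
Hypothesis hK : maximal_compact_subgroup G K.
Hypothesis hOm : symmetric_compact_nbhs_of_1 G Om.
Hypothesis hN : abels_margulis_norm G K P Om N.
Local Notation kap := (cartan_projection K P).

Lemma word_generates g : G g -> exists k, word_set Om k g.
Proof.
move=> Gg; apply: contrapT => nok; have [_ _ [C _ HC]] := hN; have [_ G1 _ _] := hG.
have := HC _ _ G1 Gg.
have -> : word_dist Om 1%:M g = +oo%E.
  rewrite /word_dist invmx1 mul1mx (_ : [set k | word_set Om k g] = set0) ?image_set0 ?ereal_inf0 //.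
  by rewrite -subset0 => k Hk; apply: nok; exists k.
by [].
Qed.

Lemma word_length_kap : exists2 C : R, 0 < C & forall g, G g -> `|word_length Om g - N (kap g)| <= C.
Proof.
have [_ _ [C C0 HC]] := hN; exists C => // g Gg; have [_ G1 _ _] := hG.
have [_ OmC _ OmV] := hOm; have := HC _ _ G1 Gg.
by rewrite (word_dist_len hG word_generates G1 Gg) invmx1 mul1mx.
Qed.

Lemma abels_margulis0 : N 0 = 0.
Proof. by have [[_ _ H _] _ _] := hN; have := H 0 0; rewrite scaler0 normr0 mul0r. Qed.

Lemma cartan_projection_chamber g : closed_weyl_chamber P (kap g).
Proof.
rewrite /cartan_projection; case: xgetP => [x _ [Cx _] //|_] a _.
by rewrite linear0.
Qed.

(** When g has no Cartan decomposition, its projection is the default value 0,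
    so that g has bounded word length; then g and its inverse are bounded and
    g = g exp 0 1 is a coarse decomposition. *)
Lemma cartan_projection_kak : exists B : R, forall g, G g ->
  kak G (fun x : lie A => vsval x) B g (kap g).
Proof.
have [[KU K1 _ KV] Kc KG _] := hK; have [_ G1 _ GV] := hG.
have [OmG Omc _ OmV] := hOm.
have [b1 b11 Hb1] := compact_norm_bound Kc.
have [b2 b21 Hb2] := compact_norm_bound Omc.
have [C C0 HC] := word_length_kap.
pose q := n%:R * b2 + 1.
have q1 : 1 <= q by rewrite /q lerDr mulr_ge0 // (le_trans _ b21).
pose B := b1 + q ^+ Num.bound C + 1.
have B1 : b1 <= B by rewrite /B -addrA lerDl addr_ge0 // exprn_ge0 // (le_trans _ q1).
exists B => g Gg; rewrite /cartan_projection.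
case: xgetP => [x _ [Cx [k1 [k2 [Kk1 Kk2 gE]]]]|none].
  exists k1, k2; split => //; first by split; exact: KG.
  - by split; apply: le_trans B1; apply: Hb1 => //; exact: KV.
  - by split; apply: le_trans B1; apply: Hb1 => //; exact: KV.
have kap0 : kap g = 0.
  by rewrite /cartan_projection; case: xgetP => // x _ Hx; have := none x.
have := HC _ Gg; rewrite kap0 abels_margulis0 subr0.
have [k [-> Hk _]] := word_lengthP word_generates Gg.
rewrite ger0_norm // => kC.
have kB : (k <= Num.bound C)%N.
  by rewrite -(ler_nat R); apply: le_trans kC _; apply: ltW; exact: archi_boundP (ltW C0).
have small h : word_set Om k h -> `|h| <= B.
  move=> Hh; apply: le_trans (word_norm b21 Hb2 Hh) _.
  apply: (@le_trans _ _ (q ^+ Num.bound C)); first exact: ler_weXn2l.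
  by rewrite /B addrAC lerDr addr_ge0 // (le_trans _ b11).
have one : `|1%:M : 'M[R]_n| <= B.
  apply: (@le_trans _ _ 1); last by rewrite /B lerDr addr_ge0 ?exprn_ge0 ?(le_trans _ q1) ?(le_trans _ b11).
  by apply/mx_norm_leP => // i j; rewrite mxE; case: (i == j); rewrite ?normr1 ?normr0.
exists g, 1%:M; split => //.
- by split; apply: small => //; exact: (word_setV hG OmV OmG).
- by rewrite invmx1.
- by rewrite mexp0 -[_ *m 1]/(_ *m 1%:M) !mulmx1.
Qed.

Variables (S : set 'M[R]_n) (J : set (lie A)).
Hypothesis hJ : is_joint_spectrum K P S J.

Lemma edist_inf_norm (Y : set 'M[R]_n) X e : (edist_inf Y X < e%:E)%E ->
  exists2 y, Y y & `|X - y| < e.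
Proof.
move=> /ereal_inf_lt[_ [y Yy <-]] /edist_lt_ball /=.
by rewrite -ball_normE; exists y.
Qed.

Lemma joint_spectrum_near e : 0 < e -> exists k0 : nat, forall k, (k0 <= k)%N ->
  (forall g, word_set S k g -> exists2 y, J y & `|k%:R^-1 *: vsval (kap g) - vsval y| <= e) /\
  (forall y, J y -> exists2 g, word_set S k g & `|k%:R^-1 *: vsval (kap g) - vsval y| <= e).
Proof.
move=> e0; have [_ _ /fine_cvgP[fin /cvgrPdist_lt /(_ e e0) lim]] := hJ.
have [k0 _ Hk0] := filterI fin lim; exists k0 => k k0k.
have [/= fk] := Hk0 k k0k; set D := hausdorff_dist _ _ in fk *.
rewrite sub0r normrN => dk.
have {}dk : (D < e%:E)%E by rewrite -(fineK fk) lte_fin; apply: le_lt_trans (ler_norm _) dk.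
move: dk; rewrite /D /hausdorff_dist gt_max => /andP[d1 d2]; split.
- move=> g Hg; have : (edist_inf (vsval @` J) (vsval (k%:R^-1 *: kap g)) < e%:E)%E.
    apply: le_lt_trans d1; apply: ereal_sup_ubound.
    by exists (vsval (k%:R^-1 *: kap g)) => //; exists (k%:R^-1 *: kap g) => //; exists g.
  by move=> /edist_inf_norm[_ [y Jy <-]] /ltW; exists y.
- move=> y Jy; have := le_lt_trans (ereal_sup_ubound _) d2.
  move=> /(_ _ (ex_intro2 _ _ (vsval y) (ex_intro2 _ _ y Jy erefl) erefl)).
  by move=> /edist_inf_norm[_ [_ [g Hg <-] <-]]; rewrite distrC => /ltW; exists g.
Qed.

End Coarse.

(** * Growth of words and displacement *)

Section ErealSequences.
Variable R : realType.
Implicit Types (u : nat -> \bar R) (m : R).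

Lemma ereal_cvg_squeeze u m : (forall e, 0 < e -> exists k0 : nat, forall k, (k0 <= k)%N ->
  ((m - e)%:E <= u k <= (m + e)%:E)%E) -> u k @[k --> \oo] --> m%:E.
Proof.
move=> H; have F e : 0 < e -> \forall k \near \oo, u k \is a fin_num /\ `|m - fine (u k)| <= e.
  move=> e0; have [k0 Hk] := H e e0; exists k0 => // k /= /Hk.
  case: (u k) => [r| |] /andP[] // h1 h2; split => //=.
  by move: h1 h2; rewrite !lee_fin ler_norml => h1 h2; apply/andP; split; lra.
apply/fine_cvgP; split; first by apply: filterS (F 1 ltr01) => k [].
by apply/cvgrPdist_le => e e0; apply: filterS (F e e0) => k [].
Qed.

Lemma limn_esup_eq u m : (forall e, 0 < e -> exists k0 : nat, forall k, (k0 <= k)%N ->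
    (u k <= (m + e)%:E)%E) ->
  (forall e, 0 < e -> forall k0 : nat, exists2 k, (k0 <= k)%N & ((m - e)%:E <= u k)%E) ->
  limn_esup u = m%:E.
Proof.
move=> up low; apply/eqP; rewrite eq_le; apply/andP; split.
  apply/lee_addgt0Pr => e e0; have [k0 Hk] := up e e0.
  apply: (@le_trans _ _ (ereal_sup (u @` [set k | (k0 <= k)%N]))).
    by apply: ereal_inf_lbound; exists [set k | (k0 <= k)%N] => //; exists k0.
  by apply: ge_ereal_sup => _ [k /= /Hk kk <-].
apply: le_ereal_inf_tmp => _ [V [k0 _ Vk0] <-]; apply/lee_addgt0Pr => e e0.
have [k k0k Hk] := low e e0 k0.
rewrite -leeBlDr // -EFinB; apply: le_trans Hk _.
by apply: ereal_sup_ubound; exists k => //; exact: Vk0.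
Qed.

Lemma scaled_sup_le (T : Type) (X : set T) (F : T -> \bar R) k b : (0 < k)%N ->
  (forall g, X g -> (F g <= b%:E)%E) ->
  ((k%:R^-1)%:E * ereal_sup (F @` X) <= (k%:R^-1 * b)%:E)%E.
Proof.
move=> k0 H; rewrite EFinM lee_pmul2l ?lte_fin ?invr_gt0 ?ltr0n //.
by apply: ge_ereal_sup => _ [g /H Hg <-].
Qed.

Lemma scaled_sup_ge (T : Type) (X : set T) (F : T -> \bar R) k a g : (0 < k)%N ->
  X g -> (a%:E <= F g)%E ->
  ((k%:R^-1 * a)%:E <= (k%:R^-1)%:E * ereal_sup (F @` X))%E.
Proof.
move=> k0 Xg H; rewrite EFinM lee_pmul2l ?lte_fin ?invr_gt0 ?ltr0n //.
by apply: le_trans H _; apply: ereal_sup_ubound; exists g.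
Qed.

End ErealSequences.

Section Growth.
Variables (R : realType) (n : nat) (G A K : set 'M[R]_n) (P : set (lie_dual A)).
Variables (Om : set 'M[R]_n) (N : lie A -> R) (S : set 'M[R]_n) (J : set (lie A)).
Hypothesis hG : connected_reductive_lie_group G.
Hypothesis hA : maximal_split_torus G A.
Hypothesis hK : maximal_compact_subgroup G K.
Hypothesis hP : positive_root_system G P.
Hypothesis hOm : symmetric_compact_nbhs_of_1 G Om.
Hypothesis hN : abels_margulis_norm G K P Om N.
Hypothesis hSG : S `<=` G.
Hypothesis hSd : zariski_dense G (generated_subgroup S).
Hypothesis hJ : is_joint_spectrum K P S J.
Local Notation kap := (cartan_projection K P).

Let subG : is_subgroup G. Proof. by have [] := reductive_lie_group_connected hG. Qed.

Lemma norm_matrix_le : exists2 c : R, 0 < c &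
  forall X : 'M[R]_n, N (vsproj (lie_space A) X) <= c * `|X|.
Proof. by have [[_ _ NZ ND] _ _] := hN; exact: seminorm_le. Qed.

Lemma norm_dist x y : `|N x - N y| <= N (x - y).
Proof.
have [[_ _ NZ ND] _ _] := hN.
have Nsym : N (y - x) = N (x - y).
  by rewrite -opprB -scaleN1r NZ normrN1 mul1r.
rewrite ler_norml; apply/andP; split.
  have := ND (y - x) x; rewrite subrK Nsym; lra.
have := ND (x - y) y; rewrite subrK; lra.
Qed.

Lemma spectrum_max : exists2 x0, J x0 & forall x, J x -> N x <= N x0.
Proof.
have [[y0 Jy0] Jc _] := hJ; have [c c0 Hc] := norm_matrix_le.
have [|||x0 x0J max] := @compact_EVT_max _ R
    (fun X : 'M[R]_n => N (vsproj (lie_space A) X)) (vsval @` J).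
- by exists (vsval y0), y0.
- exact: Jc.
- apply: continuous_subspaceT => X B /nbhs_ballP[e /= e0 eB].
  apply/nbhs_ballP; exists (e / c) => /=; first exact: divr_gt0.
  move=> Y; rewrite -ball_normE /= ltr_pdivlMr // mulrC => XY; apply: eB.
  rewrite -ball_normE /=; apply: le_lt_trans XY; apply: le_trans (norm_dist _ _) _.
  by rewrite -linearB; exact: Hc.
have [y Jy yE] := set_mem x0J; exists y => // x Jx.
have := max (vsval x); rewrite -yE !vsvalK; apply.
by apply: mem_set; exists x.
Qed.

(** The joint spectrum consists of limits of points of a closed cone. *)
Lemma spectrum_chamber y : J y -> closed_weyl_chamber P y.
Proof.
move=> Jy a Pa.
have [||c c0 Hc] := @seminorm_le R n A (fun x => `|a x : R|).
- by move=> t x; rewrite linearZ normrM.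
- by move=> x z; rewrite linearD; exact: ler_normD.
apply/ler_addgt0Pr => e e0.
have [k0 Hk0] := joint_spectrum_near hJ (divr_gt0 e0 c0).
have [_ /(_ y Jy) [g Hg Hgy]] := Hk0 k0 (leqnn _).
have := Hc (vsval (k0%:R^-1 *: kap g - y)); rewrite vsvalK => H.
have {}H : `|a (k0%:R^-1 *: kap g - y) : R| <= e.
  apply: le_trans H _; apply: le_trans (ler_wpM2l (ltW c0) Hgy) _.
  by rewrite mulrC divfK // lt0r_neq0.
have := le_trans (ler_norm _) H; rewrite linearB linearZ /= => H1.
have : 0 <= k0%:R^-1 * a (kap g) :> R.
  by rewrite mulr_ge0 // ?invr_ge0 //; exact: cartan_projection_chamber.
move: H1; rewrite /GRing.scale /=; move: (_ * _) (a y) => s t; lra.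
Qed.

Section Maximum.
Variable x0 : lie A.
Hypothesis Jx0 : J x0.
Hypothesis x0max : forall x, J x -> N x <= N x0.
Local Notation m := (N x0).

Lemma normZ_kap k g : (0 < k)%N -> N (k%:R^-1 *: kap g) = k%:R^-1 * N (kap g).
Proof.
by move=> k0; have [[_ _ NZ _] _ _] := hN; rewrite NZ ger0_norm // invr_ge0.
Qed.

Lemma growth_upper e : 0 < e -> exists k0 : nat, forall k g, (k0 <= k)%N -> (0 < k)%N ->
  word_set S k g -> k%:R^-1 * N (kap g) <= m + e.
Proof.
move=> e0; have [c c0 Hc] := norm_matrix_le.
have [k0 Hk0] := joint_spectrum_near hJ (divr_gt0 e0 c0).
exists k0 => k g k0k kp Hg; have [/(_ g Hg) [y Jy Hgy] _] := Hk0 k k0k.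
have := Hc (vsval (k%:R^-1 *: kap g - y)); rewrite vsvalK => H.
have {}H : N (k%:R^-1 *: kap g - y) <= e.
  apply: le_trans H _; apply: le_trans (ler_wpM2l (ltW c0) Hgy) _.
  by rewrite mulrC divfK // lt0r_neq0.
have := norm_dist (k%:R^-1 *: kap g) y; rewrite normZ_kap // ler_norml => /andP[_ H1].
have := x0max Jy; lra.
Qed.

Lemma growth_lower e : 0 < e -> exists k0 : nat, forall k, (k0 <= k)%N -> (0 < k)%N ->
  exists2 g, word_set S k g & m - e <= k%:R^-1 * N (kap g).
Proof.
move=> e0; have [c c0 Hc] := norm_matrix_le.
have [k0 Hk0] := joint_spectrum_near hJ (divr_gt0 e0 c0).
exists k0 => k k0k kp; have [_ /(_ x0 Jx0) [g Hg Hgy]] := Hk0 k k0k.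
have := Hc (vsval (k%:R^-1 *: kap g - x0)); rewrite vsvalK => H.
have {}H : N (k%:R^-1 *: kap g - x0) <= e.
  apply: le_trans H _; apply: le_trans (ler_wpM2l (ltW c0) Hgy) _.
  by rewrite mulrC divfK // lt0r_neq0.
exists g => //.
have := norm_dist (k%:R^-1 *: kap g) x0; rewrite normZ_kap // ler_norml => /andP[H1 _].
lra.
Qed.

Lemma displacement_bound x : G x -> exists2 C, 0 <= C & forall g, G g ->
  `|word_length Om (invmx x *m g *m x) - N (kap g)| <= C.
Proof.
move=> Gx; have gen := word_generates subG hN.
have [OmG _ _ OmV] := hOm; have [C C0 HC] := word_length_kap subG hOm hN.
have lx := word_length_ge0 gen Gx.
exists (C + 2 * word_length Om x); first by rewrite addr_ge0 // ?mulr_ge0 // ltW.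
move=> g Gg; have := HC g Gg.
have := word_length_conj subG OmV gen OmG Gx Gg; have := word_length_conj_ge subG OmV gen OmG Gx Gg.
rewrite !ler_norml => h1 h2 /andP[h3 h4]; apply/andP; split; lra.
Qed.

Lemma word_dist_displacement h x : G h -> G x ->
  word_dist Om (h *m x) x = (word_length Om (invmx x *m h *m x))%:E.
Proof.
have [OmG _ _ OmV] := hOm; have gen := word_generates subG hN.
exact: (word_dist_move subG OmV gen OmG).
Qed.

(** Conjugation by x changes lengths by a bounded amount. *)
Lemma drift_cvg x : G x -> drift_seq Om S x k @[k --> \oo] --> m%:E.
Proof.
move=> Gx; have [C C0 HC] := displacement_bound Gx.
apply: ereal_cvg_squeeze => e e0; have e2 : 0 < e / 2 by rewrite divr_gt0.
have [k1 Hk1] := growth_upper e2; have [k2 Hk2] := growth_lower e2.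
have [k3 [k3p Hk3]] := archi_le C e2.
exists (k1 + k2 + k3)%N => k kk.
have [kk1 kk2 kk3] : [/\ (k1 <= k)%N, (k2 <= k)%N & (k3 <= k)%N].
  split; apply: leq_trans kk; last exact: leq_addl.
    by rewrite -addnA leq_addr.
  by rewrite addnAC leq_addl.
have kp : (0 < k)%N by exact: leq_trans kk3.
have Ck : k%:R^-1 * C <= e / 2.
  apply: le_trans Hk3; rewrite mulrC ler_wpM2l // lef_pV2 ?posrE ?ltr0n // ler_nat.
  exact: kk3.
have kV : 0 <= k%:R^-1 :> R by rewrite invr_ge0.
apply/andP; split.
  have [g Hg Hgm] := Hk2 k kk2 kp.
  have Gg : G g by exact: word_set_sub Hg.
  have := HC g Gg; rewrite ler_norml => /andP[h1 _].
  apply: le_trans (scaled_sup_ge (a := N (kap g) - C) kp Hg _); last first.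
    by rewrite word_dist_displacement // lee_fin; lra.
  rewrite lee_fin mulrBr; lra.
have : forall g, word_set S k g -> (word_dist Om (g *m x) x <= (k%:R * (m + e / 2) + C)%:E)%E.
  move=> g Hg; have Gg : G g by exact: word_set_sub Hg.
  rewrite word_dist_displacement // lee_fin.
  have := HC g Gg; rewrite ler_norml => /andP[_ h1].
  have := Hk1 k g kk1 kp Hg; rewrite ler_pdivrMl ?ltr0n // => h2; lra.
move/(scaled_sup_le kp); move/le_trans; apply; rewrite lee_fin mulrDr mulKf ?pnatr_eq0 -?lt0n //.
lra.
Qed.

Lemma norm_wtnorm_le (Q : 'M[R]_n) : Q \in unitmx ->
  (forall v : lie A, is_diag_mx (Q *m vsval v *m invmx Q)) ->
  exists2 c : R, 0 < c & forall v : lie A, N v <= c * wtnorm (@coord_wt R n A Q) v.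
Proof.
move=> Qu QD; have [c c0 Hc] := norm_matrix_le.
pose b := n%:R * n%:R * `|invmx Q| * `|Q|.
have b0 : 0 <= b by rewrite !mulr_ge0.
exists (c * (b + 1)) => [|v]; first by rewrite mulr_gt0 // ltr_wpDl.
have w0 := wtnorm_ge0 (@coord_wt R n A Q) v.
rewrite -[v in N v]vsvalK; apply: le_trans (Hc _) _; rewrite -mulrA ler_wpM2l ?(ltW c0) //.
have -> : vsval v = invmx Q *m diag_mx (\row_i coord_wt Q i v) *m Q.
  by rewrite -coord_wtD // -!mulmxA mulVmx // mulmx1 mulmxA mulVmx // mul1mx.
apply: le_trans (mx_norm_mul3 _ _ _) _.
have D : `|diag_mx (\row_i coord_wt Q i v)| <= wtnorm (@coord_wt R n A Q) v.
  apply/mx_norm_leP => // i j; rewrite !mxE; case: eqP => [_|_].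
    by rewrite mulr1n; exact: chi_wtnorm.
  by rewrite mulr0n normr0.
rewrite mulrDl mul1r; apply: ler_wpDr => //.
by rewrite ler_wpM2l.
Qed.

(** The length of h^r is at most r times the displacement of x, up to a bounded
    term; divide by r. *)
Lemma displacement_lower h a x : G h -> G x ->
  (forall r, r.+1%:R * a <= N (kap (h ^+ r.+1))) -> a <= word_length Om (invmx x *m h *m x).
Proof.
move=> Gh Gx Ha; have gen := word_generates subG hN.
have [OmG _ _ OmV] := hOm; have [C C0 HC] := word_length_kap subG hOm hN.
apply/ler_addgt0Pr => e e0; set D := word_length _ _.
have [[|r] [r0 Hr]] := archi_le (2 * word_length Om x + C) e0; first by [].
have := word_length_power_le subG OmV gen OmG r Gh Gx; rewrite -/D => H1.
have := HC _ (subgroupX r.+1 subG Gh); rewrite ler_norml => /andP[H2 _].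
have := Ha r; move: Hr; rewrite ler_pdivrMr ?ltr0n // => Hr H3.
have rp : 0 < r.+1%:R :> R by rewrite ltr0n.
rewrite -(ler_pM2l rp) mulrDr; lra.
Qed.

(** A word g of length k + 1 in the direction of x0 exists by the definition of
    the joint spectrum; multiplying it by one of the words of stable_power
    changes its length by at most l0. *)
Lemma stable_words e : 0 < e -> exists l0 k0 : nat, forall k, (k0 <= k)%N ->
  exists l h, [/\ (l <= l0)%N, word_set S (k.+1 + l) h &
    forall r, r.+1%:R * (k.+1%:R * (m - e)) <= N (kap (h ^+ r.+1))].
Proof.
move=> e0.
have [_ Gclosed Gconn] := reductive_lie_group_connected hG.
have [At AG _] := hA; have [A1 [Q Qu QD]] := split_torus_lie_diag At.
have lieA (v : lie A) : lie_algebra A (vsval v) by exact: lie_space_sub.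
have QDv (v : lie A) : is_diag_mx (Q *m vsval v *m invmx Q) by exact: QD.
have [B HB] := cartan_projection_kak subG hK hOm hN.
have C0 := spectrum_chamber Jx0.
have elG (v : lie A) : lie_algebra G (vsval v) by move=> t; apply: AG; exact: lieA.
have elD (v : lie A) : Q *m vsval v *m invmx Q = diag_mx (\row_i coord_wt Q i v).
  exact: coord_wtD.
have [s [l [f [lf H]]]] := stable_power subG Gclosed Gconn Qu elG elD
  (fun i c x y => coord_wtL Q i c x y) (fun X i j => @root_vector_sign _ _ G A P Q X i j hP)
  (fun c x => @closed_weyl_chamberZ _ _ A P c x) hSG hSd
  (fun g _ => @cartan_projection_chamber R n A K P g) HB C0.
have [cN cN0 HcN] := norm_wtnorm_le Qu QDv.
have [||cw cw0 Hcw] := @seminorm_le R n A (wtnorm (@coord_wt R n A Q)).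
- move=> c v; rewrite /wtnorm mulr_sumr; apply: eq_bigr => i _.
  by rewrite (chiZ (fun i c x y => coord_wtL Q i c x y)) normrM.
- move=> v w; rewrite /wtnorm -big_split; apply: ler_sum => i _ /=.
  by have := coord_wtL Q i 1 v w; rewrite scale1r mul1r => ->; exact: ler_normD.
have [d d0 [k1 Hk1]] := H _ (divr_gt0 e0 cN0).
have [k2 Hk2] := joint_spectrum_near hJ (divr_gt0 d0 cw0).
exists (\sum_i l i)%N, (k1 + k2)%N => k kk.
have kk1 : (k1 <= k)%N by apply: leq_trans kk; exact: leq_addr.
have kk2 : (k2 <= k.+1)%N by apply: leqW; apply: leq_trans kk; exact: leq_addl.
have [_ /(_ x0 Jx0) [g Hg Hgx]] := Hk2 _ kk2.
have Gg : G g by exact: word_set_sub Hg.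
have gx : wtnorm (@coord_wt R n A Q) (k.+1%:R^-1 *: kap g - x0) <= d.
  have := Hcw (vsval (k.+1%:R^-1 *: kap g - x0)); rewrite vsvalK => h.
  apply: le_trans h _; apply: le_trans (ler_wpM2l (ltW cw0) Hgx) _.
  by rewrite mulrC divfK // lt0r_neq0.
have [i Hi] := Hk1 _ _ kk1 Gg gx.
exists (l i), (g *m f i); split.
- by rewrite (bigD1 i) //= leq_addr.
- exact: word_setD.
move=> r; have := HcN ((r.+1 * k.+1)%:R^-1 *: kap ((g *m f i) ^+ r.+1) - x0).
set y := _ *: _ => h1.
have {}h1 : N (y - x0) <= e.
  apply: le_trans h1 _; apply: le_trans (ler_wpM2l (ltW cN0) (Hi r)) _.
  by rewrite mulrC divfK // lt0r_neq0.
have := norm_dist y x0; rewrite normZ_kap ?muln_gt0 // ler_norml => /andP[h2 _].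
have p0 : 0 < (r.+1 * k.+1)%:R :> R by rewrite ltr0n muln_gt0.
rewrite mulrA -natrM -(ler_pdivlMl _ _ p0).
apply: (@le_trans _ _ (m - N (y - x0))); first by rewrite lerD2l lerN2.
by move: h2; rewrite lerBrDr addrC.
Qed.

(** The upper bound is the displacement at 1.  For the lower bound, the words of
    stable_words have length k + 1 + l with l bounded, and displace all points
    by at least (k + 1) (m - e / 2). *)
Lemma lambda_infty_eq : lambda_infty G Om S = m%:E.
Proof.
have [_ G1 _ _] := subG; have gen := word_generates subG hN.
have m0 : 0 <= m by have [[]] := hN.
apply: limn_esup_eq => e e0.
  have [C C0 HC] := displacement_bound G1; have e3 : 0 < e / 2 by rewrite divr_gt0.
  have [k1 Hk1] := growth_upper e3; have [k3 [k3p Hk3]] := archi_le C e3.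
  exists (k1 + k3)%N => k kk.
  have kk1 : (k1 <= k)%N by apply: leq_trans kk; exact: leq_addr.
  have kk3 : (k3 <= k)%N by apply: leq_trans kk; exact: leq_addl.
  have kp : (0 < k)%N by exact: leq_trans kk3.
  have Ck : k%:R^-1 * C <= e / 2.
    apply: le_trans Hk3; rewrite mulrC ler_wpM2l // lef_pV2 ?posrE ?ltr0n // ler_nat.
    exact: kk3.
  apply: le_trans (scaled_sup_le (b := k%:R * (m + e / 2) + C) kp _) _.
    move=> g Hg; have Gg : G g by exact: word_set_sub Hg.
    apply: le_trans (ereal_inf_lbound _) _; first by exists 1%:M.
    rewrite word_dist_displacement // lee_fin.
    have := HC g Gg; rewrite ler_norml => /andP[_ h1].
    have := Hk1 k g kk1 kp Hg; rewrite ler_pdivrMl ?ltr0n // => h2; lra.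
  rewrite lee_fin mulrDr mulKf ?pnatr_eq0 -?lt0n //; lra.
move=> k0; have e2 : 0 < e / 2 by rewrite divr_gt0.
have [l0 [k1 Hk1]] := stable_words e2.
have [k2 [k2p Hk2]] := archi_le (l0%:R * m) e2.
pose k := (k0 + k1 + k2)%N.
have [|l [h [ll0 Hh Hr]]] := Hk1 k; first by rewrite /k addnAC leq_addl.
have Gh : G h by exact: word_set_sub Hh.
exists (k.+1 + l)%N; first by rewrite (leq_trans _ (leq_addr _ _)) // leqW // /k -addnA leq_addr.
have kp : (0 < k.+1 + l)%N by [].
apply: le_trans (scaled_sup_ge (a := k.+1%:R * (m - e / 2)) kp Hh _); last first.
  apply: le_ereal_inf_tmp => _ [x Gx <-].
  by rewrite word_dist_displacement // lee_fin; exact: displacement_lower.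
have kl : 0 < (k.+1 + l)%:R :> R by rewrite ltr0n.
rewrite lee_fin ler_pdivlMl // natrD.
have lm : l%:R * m <= l0%:R * m by rewrite ler_wpM2r // ler_nat.
have kk2 : (k2%:R : R) <= k.+1%:R by rewrite ler_nat leqW // /k leq_addl.
have : k2%:R * (e / 2) <= k.+1%:R * (e / 2) by rewrite ler_wpM2r // ltW.
move: Hk2; rewrite ler_pdivrMr ?ltr0n // => Hk2.
have : 0 <= l%:R * e by rewrite mulr_ge0 // ltW.
lra.
Qed.

End Maximum.
End Growth.

Theorem proposition4p24 (R : realType) (n : nat)
  (G A K : set 'M[R]_n) (P : set (lie_dual A))
  (hG : connected_reductive_lie_group G)
  (hA : maximal_split_torus G A)
  (hK : maximal_compact_subgroup G K)
  (hKA : killing_orthogonal G K A)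
  (hP : positive_root_system G P)
  (Om : set 'M[R]_n) (hOm : symmetric_compact_nbhs_of_1 G Om)
  (N : lie A -> R) (hN : abels_margulis_norm G K P Om N)
  (S : set 'M[R]_n) (hSG : S `<=` G) (hS0 : S !=set0) (hSc : compact S)
  (hSd : zariski_dense G (generated_subgroup S))
  (J : set (lie A)) (hJ : is_joint_spectrum K P S J) :
  exists m : R,
    [/\ is_max_on J N m,
        forall x, G x -> drift_seq Om S x k @[k --> \oo] --> m%:E &
        lambda_infty G Om S = m%:E].
Proof.
have [x0 Jx0 x0max] := spectrum_max hN hJ.
exists (N x0); split.
- by split => //; exists x0.
- by move=> x Gx; exact: (drift_cvg hG hOm hN hSG hJ Jx0 x0max).
- exact: (lambda_infty_eq hG hA hK hP hOm hN hSG hSd hJ Jx0 x0max).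
Qed.
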